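(* For integers $p\ge 2$, $d\ge 2$ let $$a_{p,d}=1-p^{-2/(d-1)}c_{p,d},\qquad b_{p,d}=\frac{2}{d-1}\,p^{-2/(d-1)}c_{p,d},$$ $$c_{p,d}=\Big(\frac{d-1}{2}\,B\Big(\frac12,\frac{d-1}{2}\Big)\sqrt{1-p^{-2/(d-1)}}\Big)^{2/(d-1)},$$ where $B(s,t)$ is the Beta function. 1. Suppose $L_1,\ldots,L_p$ are i.i.d. uniformly distributed on $S^{d-1}\subset\mathbb{R}^d$, independent of $Z\sim\mathcal{EC}_d(0,I)$, and suppose that $(\|Z\|_2^2-u_d)/v_d\to F_\infty$ in distribution as $d\to\infty$ for some sequences of positive constants $u_d,v_d$ and a proper random variable $F_\infty$. Let $K_{p,d}=\max_{1\le j\le p}|\langle L_j,Z\rangle|^2$. Then: (a) If $d$ is fixed and $p\to\infty$, then $K_{p,d}\to\|Z\|_2^2$ in distribution. (b) Suppose $d\to\infty$ and $p\to\infty$. (i) If $\frac{v_da_{p,d}}{u_db_{p,d}}\to\infty$, then $\frac{K_{p,d}-u_da_{p,d}}{v_da_{p,d}}\to F_\infty$ in distribution. (ii) If $\frac{v_da_{p,d}}{u_db_{p,d}}\to c$ with $0<c<\infty$, then $\frac{K_{p,d}-u_da_{p,d}}{v_da_{p,d}}\to F_\infty+\frac1c H$ in distribution, where $H\sim\mathrm{Gumbel}(0,1)$ and $F_\infty$ and $H$ are independent. (iii) If $\frac{v_da_{p,d}}{u_db_{p,d}}\to 0$, then $\frac{K_{p,d}-u_da_{p,d}}{u_db_{p,d}}\to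 H$ in distribution, where $H\sim\mathrm{Gumbel}(0,1)$. 2. In particular, if $Z\sim\mathcal{N}_d(0,I)$, then: (a) If $d$ is fixed and $p\to\infty$, then $K_{p,d}\to\chi_d^2$ in distribution. (b) Suppose $d\to\infty$ and $p\to\infty$. (i) If $(\log p)^2/d\to\infty$, then $\frac{K_{p,d}-da_{p,d}}{\sqrt{2d}\,a_{p,d}}\to G$ in distribution, where $G\sim\mathcal{N}(0,1)$. (ii) If $(\log p)^2/d\to c$ with $0<c<\infty$, then $\frac{K_{p,d}-da_{p,d}}{\sqrt{2d}\,a_{p,d}}\to G+\frac{1}{\sqrt{2c}}H$ in distribution, where $G\sim\mathcal{N}(0,1)$, $H\sim\mathrm{Gumbel}(0,1)$, and $G$ and $H$ are independent. (iii) If $(\log p)^2/d\to 0$, then $\frac{K_{p,d}-da_{p,d}}{d\,b_{p,d}}\to H$ in distribution, where $H\sim\mathrm{Gumbel}(0,1)$.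
   Context: $Z\sim\mathcal{EC}_d(0,I)$ means that $Z$ is a random vector in $\mathbb{R}^d$ with density $f(z)\propto g(z^Tz)$ for some continuous integrable function $g$; then $Z=\|Z\|_2U$ with $U$ uniform on the unit sphere $S^{d-1}$ and independent of $\|Z\|_2$, and the law of $\|Z\|_2$ is taken to depend only on $d$. A proper random variable is one that is almost surely finite. $\mathrm{Gumbel}(0,1)$ is the distribution with distribution function $\exp(-e^{-x})$, $x\in\mathbb{R}$. In the parts with $d\to\infty$ and $p\to\infty$, the limits are along any joint sequence $(p,d)$ satisfying the stated condition. With $M_{p,d}=\max_j|\langle L_j,U\rangle|$ one has $K_{p,d}=\|Z\|_2^2M_{p,d}^2$. *)

(* Defs.v *)
From HB Require Import structures.
From mathcomp Require Import all_boot all_order all_algebra.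
From mathcomp Require Import all_classical all_reals all_analysis.

Set Implicit Arguments.
Unset Strict Implicit.
Unset Printing Implicit Defensive.

Import Order.TTheory GRing.Theory Num.Theory.
Import numFieldNormedType.Exports.

Local Open Scope classical_set_scope.
Local Open Scope ring_scope.

Section tuple_measure.
Context d (T : measurableType d) (R : realType).
Local Open Scope ereal_scope.

Definition tuple_cons n (xt : T * n.-tuple T) : n.+1.-tuple T :=
  [the n.+1.-tuple T of xt.1 :: xt.2].

(* The n-fold product measure m^n, on the product sigma-algebra of n.-tuple T. *)
Fixpoint tuple_measure (m : set T -> \bar R) n : set (n.-tuple T) -> \bar R :=
  match n with
  | 0 => \d_([tuple] : 0.-tuple T)
  | n'.+1 => pushforward (m \x @tuple_measure m n') (@tuple_cons n')
  end.

Arguments tuple_measure m n A : clear implicits.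

Lemma measurable_tuple_cons n : measurable_fun [set: T * n.-tuple T] (@tuple_cons n).
Proof. exact: (@measurable_cons _ _ _ _ fst n snd). Qed.

Variable m : {sigma_finite_measure set T -> \bar R}.

Lemma tuple_measure_sigma_finite_measure n :
  exists mu : {sigma_finite_measure set (n.-tuple T) -> \bar R},
    tuple_measure m n = mu :> (set _ -> \bar R).
Proof.
elim: n => [|n [mu muE]]; first by eexists.
rewrite /= muE.
pose nu (A : set (n.+1.-tuple T)) := (m \x mu) (@tuple_cons n @^-1` A).
have nu0 : nu set0 = 0 by rewrite /nu preimage_set0 measure0.
have nuge A : 0 <= nu A by rewrite /nu; exact: measure_ge0.
have mpre A : measurable A -> measurable (@tuple_cons n @^-1` A).
  by move=> mA; rewrite -[X in measurable X]setTI; exact: measurable_tuple_cons.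
have nuadd : semi_sigma_additive nu.
  move=> F mF tF mUF; rewrite /nu preimage_bigcup.
  apply: measure_semi_sigma_additive.
  - by move=> k; exact: mpre.
  - apply/trivIsetP => /= i j _ _ ij; rewrite -preimage_setI.
    by move/trivIsetP : tF => /(_ _ _ _ _ ij) ->//; rewrite preimage_set0.
  - by rewrite -preimage_bigcup; exact: mpre.
have nufin : sigma_finite setT nu.
  have /sigma_finiteP[F [TF ndF Foo]] := sigma_finiteT m.
  have /sigma_finiteP[G [TG ndG Goo]] := sigma_finiteT mu.
  pose h (t : n.+1.-tuple T) : T * n.-tuple T := (thead t, [tuple of behead t]).
  have mh : measurable_fun setT h.
    by apply: measurable_fun_pair; [exact: measurable_tnth|exact: measurable_behead].
  have hK : cancel (@tuple_cons n) h.
    by move=> [x t]; congr pair; exact/val_inj.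
  exists (fun k => h @^-1` (F k `*` G k)).
    rewrite -preimage_bigcup -[LHS](preimage_setT h) -setXTT TF TG; congr (_ @^-1` _).
    apply/seteqP; split=> [[x y] [/= [k _ Fkx] [l _ Gly]]|[x y] [k _ [/= Fkx Gky]]].
      exists (maxn k l) => //; split.
      - by move: x Fkx; exact/subsetPset/ndF/leq_maxl.
      - by move: y Gly; exact/subsetPset/ndG/leq_maxr.
    by split; exists k.
  move=> k; have [mFk Fk] := Foo k; have [mGk Gk] := Goo k; split.
    by rewrite -[X in measurable X]setTI; apply: mh => //; exact: measurableX.
  rewrite /nu (_ : _ @^-1` _ = F k `*` G k).
    by rewrite product_measure1E// lte_mul_pinfty// ge0_fin_numE.
  by apply/funext => x; exact: (congr1 (F k `*` G k) (hK x)).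
pose M := isMeasure.Build _ _ _ nu nu0 nuge nuadd.
pose N : {measure set _ -> \bar R} := HB.pack nu M.
pose S := @Measure_isSigmaFinite.Build _ _ _ N nufin.
by exists (HB.pack_for {sigma_finite_measure set (n.+1.-tuple T) -> \bar R} nu M S).
Qed.

Let tuple_measure0 n : tuple_measure m n set0 = 0.
Proof. by have [mu ->] := tuple_measure_sigma_finite_measure n; rewrite measure0. Qed.

Let tuple_measure_ge0 n A : 0 <= tuple_measure m n A.
Proof. by have [mu ->] := tuple_measure_sigma_finite_measure n; exact: measure_ge0. Qed.

Let tuple_measure_sigma_additive n : semi_sigma_additive (tuple_measure m n).
Proof.
by have [mu ->] := tuple_measure_sigma_finite_measure n; exact: measure_semi_sigma_additive.
Qed.

HB.instance Definition _ n := isMeasure.Build _ _ _ (tuple_measure m n)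
  (tuple_measure0 n) (@tuple_measure_ge0 n) (@tuple_measure_sigma_additive n).

Let tuple_measure_sigma_finite n : sigma_finite setT (tuple_measure m n).
Proof. by have [mu ->] := tuple_measure_sigma_finite_measure n; exact: sigma_finiteT. Qed.

HB.instance Definition _ n := Measure_isSigmaFinite.Build _ _ _ (tuple_measure m n)
  (tuple_measure_sigma_finite n).

End tuple_measure.
Arguments tuple_measure {d T R} m n A.

Section euclidean.
Context {R : realType}.

Definition dotp d (x y : d.-tuple R) : R := \sum_(i < d) tnth x i * tnth y i.

Definition enorm d (x : d.-tuple R) : R := Num.sqrt (dotp x x).

Definition lebesgue_tuple d : set (d.-tuple R) -> \bar R :=
  tuple_measure (@lebesgue_measure R) d.

(* The part of the cone over A : set S^(d-1) that lies in the unit ball, without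
   the origin. *)
Definition unit_cone d (A : set (d.-tuple R)) : set (d.-tuple R) :=
  [set x | 0 < enorm x <= 1 /\ A [tuple tnth x i / enorm x | i < d]].

(* Normalised surface measure of S^(d-1): the surface area of a Borel subset A
   of the sphere is d times the Lebesgue measure of unit_cone A, and
   unit_cone setT is the punctured unit ball. *)
Definition sphere_law d (A : set (d.-tuple R)) : \bar R :=
  (fine (lebesgue_tuple (unit_cone A)) / fine (@lebesgue_tuple d (unit_cone setT)))%:E.

(* EC_d(0, I); k is the normalising constant of the density. For d >= 2 the
   integrability of g on [0, +oo[ follows from that of z |-> g (z^T z). *)
Definition spherical_law d (mu : set (d.-tuple R) -> \bar R) : Prop :=
  exists (g : R -> R) (k : R),
    [/\ {within `[0, +oo[, continuous g},
        (forall t, 0 <= t -> 0 <= g t),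
        (@lebesgue_measure R).-integrable `[0, +oo[ (EFin \o g),
        0 < k &
        forall A, measurable A ->
          mu A = (\int[@lebesgue_tuple d]_(z in A) (k * g (enorm z ^+ 2))%:E)%E].

Definition std_normal_tuple d : set (d.-tuple R) -> \bar R :=
  tuple_measure (@normal_prob R 0 1) d.

Definition chi2_law d : set R -> \bar R :=
  pushforward (@std_normal_tuple d)
    (fun z : d.-tuple R => \sum_(i < d) tnth z i ^+ 2).

Definition gumbel_cdf (x : R) : R := expR (- expR (- x)).

Definition beta_real (s t : R) : R :=
  \int[lebesgue_measure]_(x in `]0, 1[) (x `^ (s - 1) * (1 - x) `^ (t - 1)).

End euclidean.

Section laws.
Context {R : realType}.

Definition same_law d (T : measurableType d) (mu nu : set T -> \bar R) : Prop :=
  forall A, measurable A -> mu A = nu A.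

Definition cvg_law (mu : nat -> set R -> \bar R) (nu : set R -> \bar R) : Prop :=
  forall x : R, {for x, continuous (fun y : R => nu `]-oo, y]%classic)} ->
    mu n `]-oo, x]%classic @[n --> \oo] --> nu `]-oo, x]%classic.

(* The family is finite and some A i may be the full space, so the product rule
   for the whole family contains the one for every subfamily. *)
Definition independent d d' (T : measurableType d) (E : measurableType d')
    (P : probability T R) (I : finType) (X : I -> T -> E) : Prop :=
  forall A : I -> set E, (forall i, measurable (A i)) ->
    P (\bigcap_(i in [set: I]) (X i @^-1` A i)) =
    (\big[*%E/1%E]_(i : I) P (X i @^-1` A i))%E.

Definition independent2 d d' d'' (T : measurableType d) (E : measurableType d')
    (E' : measurableType d'') (P : probability T R) (X : T -> E) (Y : T -> E') : Prop :=
  forall A B, measurable A -> measurable B ->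
    P (X @^-1` A `&` Y @^-1` B) = (P (X @^-1` A) * P (Y @^-1` B))%E.

Definition gumbel d (T : measurableType d) (P : probability T R)
    (H : {RV P >-> R}) : Prop :=
  forall x, cdf H x = (gumbel_cdf x)%:E.

Definition std_normal d (T : measurableType d) (P : probability T R)
    (G : {RV P >-> R}) : Prop :=
  same_law (distribution P G) (normal_prob 0 1).

(* L_1, ..., L_p i.i.d. uniform on S^(d-1) and jointly independent of Z *)
Definition uniform_sample dT (T : measurableType dT) (P : probability T R)
    (p d : nat) (L : 'I_p -> {RV P >-> d.-tuple R}) (Z : {RV P >-> d.-tuple R}) : Prop :=
  (forall j, same_law (distribution P (L j)) (@sphere_law R d)) /\
  independent P (fun o : option 'I_p => if o is Some j then L j : T -> _ else Z).

End laws.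

Section constants.
Context {R : realType}.
Variables p d : nat.

Let p_pow : R := p%:R `^ (- (2 / (d%:R - 1))).

Definition c_pd : R :=
  ((d%:R - 1) / 2 * beta_real (1 / 2) ((d%:R - 1) / 2) * Num.sqrt (1 - p_pow))
    `^ (2 / (d%:R - 1)).

Definition a_pd : R := 1 - p_pow * c_pd.

Definition b_pd : R := 2 / (d%:R - 1) * p_pow * c_pd.

End constants.

Definition K_pd {R : realType} (p d : nat) (l : 'I_p -> d.-tuple R)
    (z : d.-tuple R) : R :=
  \big[Num.max/0]_(j < p) `|dotp (l j) z| ^+ 2.

(* Main.v *)
(** Write K = |Z|^2 M with M = max_j <L_j, U>^2 and U the direction of Z.  Given Z, the events
    <L_j, U>^2 > t are independent, and their probability is the same cap ratio G(t) for every
    direction; so M is independent of |Z| and P(M <= t) = (1 - G(t))^p.  Integration by parts gives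
      G(t) ~ (1 - t)^((d-1)/2) / (sqrt t * (d-1)/2 * B(1/2, (d-1)/2)),
    and c_pd is such that p G(a + b x) -> exp (- x): (M - a) / b converges to the Gumbel law.
    With F = (|Z|^2 - u) / v and H = (M - a) / b,
      (K - u a) / (v a) = F + (u b) / (v a) H + (b / a) F H,
    where b / a -> 0, and the three regimes follow from Slutsky's lemma and the convergence of sums
    of independent variables.  For normal Z, a layer cake formula expresses the law of |Z|^2 by
    volumes of balls, from which dominated convergence gives the central limit theorem; moreover
    a / b ~ log p as soon as (log p) / d -> 0. *)

Require Import Defs.
From HB Require Import structures.
From mathcomp Require Import all_boot all_order all_algebra.
From mathcomp Require Import all_classical all_reals all_analysis.
From mathcomp Require Import measurable_realfun.
From mathcomp Require Import ring lra.

Set Implicit Arguments.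
Unset Strict Implicit.
Unset Printing Implicit Defensive.

Import Order.TTheory GRing.Theory Num.Theory.
Import numFieldNormedType.Exports.

Local Open Scope classical_set_scope.
Local Open Scope ring_scope.

(** * Spherical caps *)

(** The obstacle is uniformity: nothing ties the growth of [p] to that of [d], so log p / d may tend
    to 0, to infinity or oscillate, and the level t = a + b x may approach 0, 1 or neither. All
    error terms are therefore measured by one quantity, [gap] = (d-1)(1 - p^(-2/(d-1))), which is
    comparable to min (2 log p, d-1) and diverges along every joint sequence. The level is
    asymptotic to 1 - p^(-2/(d-1)), so the correction 1/((d-1) t) left by the integration by parts
    is of order 1/gap. The sphere is never parametrised: its measure is a ratio of cone volumes,
    computed by slicing along the first axis, and one reflection carries any other direction to that
    axis. The laws live on unrelated probability spaces, so convergence is argued on distribution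
    functions alone, by inclusions of events up to small probability; sums of independent variables
    are compared on finite grids of continuity points. In the chi-squared limit no normalising
    constant is evaluated: both sides are quotients of two integrals with the same unknown
    factor. *)

Section affine_lebesgue.
Context {R : realType}.
Notation mu := (@lebesgue_measure R).
Local Open Scope ereal_scope.

Lemma measurable_affine (c s : R) :
  measurable_fun [set: R] (fun x => c * x + s : measurableTypeR R)%R.
Proof. by apply: measurable_funD => //; exact: measurable_funM. Qed.

(** By uniqueness of Lebesgue measure: [c] times its image under the affine map gives every interval
    []a, b]] its length. *)
Lemma lebesgue_measure_affine (c s : R) (A : set R) : (0 < c)%R -> measurable A ->
  mu ((fun x => c * x + s)%R @^-1` A) = (c^-1)%:E * mu A.
Proof.
move=> c0 mA; pose f (x : measurableTypeR R) : measurableTypeR R := (c * x + s)%R.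
have mf : measurable_fun [set: measurableTypeR R] f := measurable_affine c s.
pose nu : {measure set (measurableTypeR R) -> \bar R} :=
  mscale (NngNum (ltW c0)) (pushforward mu f).
have -> : mu A = nu mf A.
  apply: lebesgue_measure_unique => // _ [[a b]] _ <-.
  rewrite /nu/= /mscale/= /pushforward.
  have -> : f @^-1` `]a, b]%classic = `](a - s) / c, (b - s) / c]%classic%R.
    apply/seteqP; split => x; rewrite /f /= !in_itv/= ltr_pdivrMr// ler_pdivlMr//.
      by rewrite ltrBlDr lerBrDr ![(x * c)%R]mulrC.
    by rewrite ltrBlDr lerBrDr ![(x * c)%R]mulrC.
  rewrite !lebesgue_measure_itv/= !lte_fin ltr_pM2r ?invr_gt0// ltrD2r.
  case: ifPn => _; rewrite ?mule0//.
  rewrite -!EFinB -EFinM; congr EFin; field; exact: lt0r_neq0.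
rewrite /nu /= /mscale/= /pushforward muleA -EFinM mulVf ?gt_eqF// mul1e//.
Qed.

Lemma ge0_integral_affine (c s : R) (f : R -> \bar R) : (0 < c)%R ->
  measurable_fun [set: R] f -> (forall x, 0 <= f x) ->
  \int[mu]_x f (c * x + s)%R = (c^-1)%:E * \int[mu]_x f x.
Proof.
move=> c0 mf f0; pose g (x : measurableTypeR R) : measurableTypeR R := (c * x + s)%R.
have mg : measurable_fun [set: measurableTypeR R] g := measurable_affine c s.
transitivity (\int[pushforward mu g]_x f x).
  by rewrite ge0_integral_pushforward//= preimage_setT.
have ic0 : (0 <= c^-1)%R by rewrite invr_ge0 ltW.
rewrite -[RHS](ge0_integral_mscale _ measurableT (NngNum ic0))//.
apply: eq_measure_integral => A mA _.
by rewrite /= /mscale/= -(lebesgue_measure_affine s).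
Qed.

End affine_lebesgue.

(** * Measurability of the Euclidean operations *)

Section tuple_measurability.
Context {R : realType} dT (T : measurableType dT).

Lemma measurable_set_le (f g : T -> R) :
  measurable_fun [set: T] f -> measurable_fun [set: T] g ->
  measurable [set x | f x <= g x].
Proof.
move=> mf mg; rewrite (_ : [set x | _] = (g \- f) @^-1` `[0, +oo[%classic).
  by rewrite -[X in measurable X]setTI; apply: measurable_funB.
by apply/seteqP; split=> x /=; rewrite in_itv/= andbT subr_ge0.
Qed.

Lemma measurable_set_lt (f g : T -> R) :
  measurable_fun [set: T] f -> measurable_fun [set: T] g ->
  measurable [set x | f x < g x].
Proof.
move=> mf mg; rewrite (_ : [set x | _] = ~` [set x | g x <= f x]).
  by apply: measurableC; exact: measurable_set_le.
by apply/seteqP; split=> x /=; rewrite ltNge => /negP.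
Qed.

Lemma measurable_mktuple n (f : 'I_n -> T -> R) :
  (forall i, measurable_fun [set: T] (f i)) ->
  measurable_fun [set: T] (fun x => [tuple f i x | i < n]).
Proof.
move=> mf; apply/measurable_fun_tnthP => i.
by apply: eq_measurable_fun (mf i) => x _ /=; rewrite tnth_mktuple.
Qed.

Lemma measurable_fun_tnth n (f : T -> n.-tuple R) (i : 'I_n) :
  measurable_fun [set: T] f -> measurable_fun [set: T] (fun x => tnth (f x) i).
Proof. by move=> mf; apply: (measurableT_comp (measurable_tnth i)). Qed.

Lemma measurable_dotp n (f g : T -> n.-tuple R) :
  measurable_fun [set: T] f -> measurable_fun [set: T] g ->
  measurable_fun [set: T] (fun x => dotp (f x) (g x)).
Proof.
by move=> mf mg; apply: measurable_sum => i; apply: measurable_funM;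
  exact: measurable_fun_tnth.
Qed.

Lemma measurable_enorm n (f : T -> n.-tuple R) :
  measurable_fun [set: T] f -> measurable_fun [set: T] (fun x => enorm (f x)).
Proof.
move=> mf; have msqrt : measurable_fun [set: R] (@Num.sqrt R).
  by apply: continuous_measurable_fun; exact: sqrt_continuous.
by apply: measurableT_comp msqrt _; exact: measurable_dotp.
Qed.

End tuple_measurability.

(** * Inner products and reflections *)

Section euclidean_algebra.
Context {R : realType} {n : nat}.
Implicit Types x y z : n.-tuple R.

Definition addt x y := [tuple tnth x i + tnth y i | i < n].
Definition scalet (c : R) x := [tuple c * tnth x i | i < n].

Lemma dotpC x y : dotp x y = dotp y x.
Proof. by apply: eq_bigr => i _; rewrite mulrC. Qed.

Lemma dotpDl x y z : dotp (addt x y) z = dotp x z + dotp y z.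
Proof.
by rewrite -big_split; apply: eq_bigr => i _; rewrite tnth_mktuple/= mulrDl.
Qed.

Lemma dotpZl c x z : dotp (scalet c x) z = c * dotp x z.
Proof.
by rewrite /dotp mulr_sumr; apply: eq_bigr => i _; rewrite tnth_mktuple mulrA.
Qed.

Lemma dotpDr x y z : dotp z (addt x y) = dotp z x + dotp z y.
Proof. by rewrite dotpC dotpDl !(dotpC z). Qed.

Lemma dotpZr c x z : dotp z (scalet c x) = c * dotp z x.
Proof. by rewrite dotpC dotpZl dotpC. Qed.

Definition dotpE := (dotpDl, dotpDr, dotpZl, dotpZr).

Lemma dotp_ge0 x : 0 <= dotp x x.
Proof. by apply: sumr_ge0 => i _; rewrite -expr2 sqr_ge0. Qed.

Lemma sqr_enorm x : enorm x ^+ 2 = dotp x x.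
Proof. by rewrite sqr_sqrtr// dotp_ge0. Qed.

Lemma dotp_eq0 x i : dotp x x = 0 -> tnth x i = 0.
Proof.
move=> /eqP; rewrite psumr_eq0 => [/allP x0|j _]; last by rewrite -expr2 sqr_ge0.
by have := x0 i; rewrite mem_index_enum -expr2 sqrf_eq0 => /(_ isT)/eqP.
Qed.

Lemma dotp0_eq x y : dotp x x = 0 -> dotp x y = 0.
Proof. by move=> x0; rewrite /dotp big1// => i _; rewrite dotp_eq0// mul0r. Qed.

(* Householder reflection in the hyperplane orthogonal to w; it is the identity for w = 0 *)
Definition reflect_along (w x : n.-tuple R) :=
  addt x (scalet (- (2 / dotp w w * dotp x w)) w).

Lemma reflect_alongK w : involutive (reflect_along w).
Proof.
move=> x; apply/eq_from_tnth => i; rewrite /reflect_along !tnth_mktuple !dotpE.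
have [w0|w0] := eqVneq (dotp w w) 0; last by field.
by rewrite (dotpC x) (dotp0_eq x w0) w0; ring.
Qed.

Lemma reflect_along_isometry w x : dotp (reflect_along w x) (reflect_along w x) = dotp x x.
Proof.
rewrite /reflect_along !dotpE (dotpC w x).
have [w0|w0] := eqVneq (dotp w w) 0; last by field.
by rewrite (dotpC x) (dotp0_eq x w0) w0; ring.
Qed.

Lemma reflect_along_addt w x y : reflect_along w (addt x y) = addt (reflect_along w x) (reflect_along w y).
Proof.
by apply/eq_from_tnth => i; rewrite /reflect_along !tnth_mktuple !dotpE; ring.
Qed.

Lemma dotp_reflect_along w x y : dotp (reflect_along w x) y = dotp x (reflect_along w y).
Proof. by rewrite /reflect_along !dotpE (dotpC w y); ring. Qed.

(** A single reflection along the difference exchanges two vectors of equal norm, so reflections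
    replace the whole orthogonal group. With w = x - y, equality of the norms gives <w, w> = 2 <x,
    w>; the coefficient of [w] is then exactly -1. *)
Lemma reflect_along_swap x y : dotp x x = dotp y y ->
  reflect_along (addt x (scalet (-1) y)) x = y.
Proof.
move=> xy; apply/eq_from_tnth => i; set w := addt x _.
have ww : dotp w w = 2 * (dotp x x - dotp x y).
  by rewrite !dotpE (dotpC y x) -xy; ring.
have xw : dotp x w = dotp x x - dotp x y by rewrite dotpDr dotpZr; ring.
have wi : tnth w i = tnth x i - tnth y i by rewrite !tnth_mktuple; ring.
rewrite /reflect_along !tnth_mktuple xw.
have [w0|w0] := eqVneq (dotp w w) 0.
  by have := dotp_eq0 i w0; rewrite wi w0 invr0 => h; lra.
rewrite ww in w0 *; field.
by move: w0; apply: contra => /eqP h; rewrite mulf_eq0 h eqxx orbT.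
Qed.

End euclidean_algebra.

(** * Slicing and dilating Lebesgue measure *)

Section lebesgue_tuple.
Context {R : realType}.
Notation mu := (@lebesgue_measure R).
Notation lam := (tuple_measure (@lebesgue_measure R)).
Local Open Scope ereal_scope.

Lemma tnth_tuple_cons0 n (x : R) (y : n.-tuple R) : tnth (tuple_cons (x, y)) ord0 = x.
Proof. by rewrite (tnth_nth 0%R). Qed.

Lemma tnth_tuple_consS n (x : R) (y : n.-tuple R) (i : 'I_n) :
  tnth (tuple_cons (x, y)) (lift ord0 i) = tnth y i.
Proof. by rewrite !(tnth_nth 0%R). Qed.

Lemma affine_tuple_cons n (c x : R) (y : n.-tuple R) (s : n.+1.-tuple R) :
  addt (scalet c (tuple_cons (x, y))) s =
  tuple_cons ((c * x + tnth s ord0)%R, addt (scalet c y) [tuple of behead s]).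
Proof.
apply/eq_from_tnth => i; rewrite !tnth_mktuple.
case: (unliftP ord0 i) => [j|] ->; rewrite ?tnth_tuple_cons0 ?tnth_tuple_consS//.
by rewrite !tnth_mktuple; congr (_ + _)%R; rewrite !(tnth_nth 0%R)/= nth_behead.
Qed.

Lemma tonelli_section d1 d2 (T1 : measurableType d1) (T2 : measurableType d2)
    (m1 : {sigma_finite_measure set T1 -> \bar R})
    (m2 : {sigma_finite_measure set T2 -> \bar R}) (E : set (T1 * T2)) :
  measurable E ->
  \int[m1]_x m2 [set y | E (x, y)] = \int[m2]_y m1 [set x | E (x, y)].
Proof.
move=> mE; have := indic_fubini_tonelli m1 m2 mE.
rewrite indic_fubini_tonelli_FE// indic_fubini_tonelli_GE// => h.
transitivity (\int[m1]_x (m2 \o xsection E) x).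
  by apply: eq_integral => x _ /=; rewrite xsectionE.
by rewrite h; apply: eq_integral => x _ /=; rewrite ysectionE.
Qed.

Lemma measurable_tuple_section n (A : set (n.+1.-tuple R)) x : measurable A ->
  measurable [set y | A (tuple_cons (x, y))].
Proof.
move=> mA; rewrite -[X in measurable X]setTI.
by apply: (measurableT_comp (@measurable_tuple_cons _ R n) (@pair1_measurable _ _ _ _ x)).
Qed.

(** Cavalieri's principle along the first coordinate; balls, cones and normal probabilities are all
    computed from it by recursion on the dimension. *)
Lemma tuple_measureS (m : {sigma_finite_measure set (measurableTypeR R) -> \bar R}) n
    (A : set (n.+1.-tuple R)) :
  tuple_measure m n.+1 A = \int[m]_x tuple_measure m n [set y | A (tuple_cons (x, y))].
Proof. by apply: eq_integral => x _ /=; rewrite xsectionE. Qed.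

Lemma measurable_tuple_measure_section
    (m : {sigma_finite_measure set (measurableTypeR R) -> \bar R}) n
    (A : set (n.+1.-tuple R)) : measurable A ->
  measurable_fun [set: measurableTypeR R]
    (fun x => tuple_measure m n [set y | A (tuple_cons (x, y))]).
Proof.
move=> mA.
have mA' : measurable (@tuple_cons _ (measurableTypeR R) n @^-1` A).
  by rewrite -[X in measurable X]setTI; apply: measurable_tuple_cons.
apply: eq_measurable_fun (measurable_fun_xsection (tuple_measure m n) mA') => x _ /=.
by rewrite xsectionE.
Qed.

(** Induction on the dimension: the one-dimensional change of variables in the first coordinate
    contributes one factor [c^-1], the slices contribute the others. *)
Lemma lebesgue_tuple_affine n (c : R) (s : n.-tuple R) (A : set (n.-tuple R)) :
  (0 < c)%R -> measurable A ->
  lam n [set x | A (addt (scalet c x) s)] = (c ^- n)%:E * lam n A.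
Proof.
move=> c0; elim: n s A => [|n IH] s A mA.
  rewrite expr0 invr1 mul1e; congr (lam 0 _); apply/seteqP; split=> x /=;
  by rewrite (tuple0 x) (tuple0 (addt _ _)).
rewrite !tuple_measureS.
pose phi x := lam n [set y | A (tuple_cons (x, y))].
transitivity (\int[mu]_x ((c ^- n)%:E * phi (c * x + tnth s ord0)%R)).
  apply: eq_integral => x _; rewrite /phi.
  rewrite -(IH [tuple of behead s]); last exact: measurable_tuple_section.
  by congr (lam n _); apply/funext => y /=; rewrite affine_tuple_cons.
have mphi : measurable_fun [set: R] phi by exact: measurable_tuple_measure_section.
have phi0 x : 0 <= phi x by exact: measure_ge0.
have cn0 : (0 <= c ^- n)%R by rewrite invr_ge0 exprn_ge0// ltW.
rewrite ge0_integralZl_EFin//.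
  rewrite ge0_integral_affine// muleA -EFinM exprS invfM mulrC//.
by apply: measurableT_comp mphi _; exact: measurable_affine.
Qed.

End lebesgue_tuple.
#[local] Arguments tuple_measure : simpl never.

(** * Volumes of balls *)

Section isometry_invariance.
Context {R : realType}.
Notation mu := (@lebesgue_measure R).
Notation lam := (tuple_measure (@lebesgue_measure R)).
Local Open Scope ereal_scope.

(** The parameter is the squared radius: the slice at height [x] is then again a ball, with
    parameter [s - x ^+ 2], and a negative parameter simply gives the empty set. *)
Definition tball n (s : R) := [set y : n.-tuple R | (dotp y y <= s)%R].
Definition oball n (s : R) := [set y : n.-tuple R | (dotp y y < s)%R].

Lemma measurable_tball n s : measurable (@tball n s).
Proof. by apply: measurable_set_le => //; exact: measurable_dotp. Qed.

Lemma measurable_oball n s : measurable (@oball n s).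
Proof. by apply: measurable_set_lt => //; exact: measurable_dotp. Qed.

Definition zerot n : n.-tuple R := [tuple 0%R | i < n].

Lemma dotp_addt0 n (c : R) (x : n.-tuple R) :
  dotp (addt (scalet c x) (zerot n)) (addt (scalet c x) (zerot n)) = (c ^+ 2 * dotp x x)%R.
Proof.
have -> : addt (scalet c x) (zerot n) = scalet c x.
  by apply/eq_from_tnth => i; rewrite !tnth_mktuple addr0.
by rewrite !dotpE; ring.
Qed.

Lemma lebesgue_tuple_addt n (s : n.-tuple R) (A : set (n.-tuple R)) : measurable A ->
  lam n [set x | A (addt x s)] = lam n A.
Proof.
move=> mA; have := @lebesgue_tuple_affine R n 1 s A ltr01 mA.
rewrite expr1n invr1 mul1e => <-.
by congr (lam n _); apply/funext => x /=; congr A; apply/eq_from_tnth => i;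
  rewrite !tnth_mktuple mul1r.
Qed.

Lemma lebesgue_tuple_tball_gt0 n s : (0 < s)%R ->
  lam n (tball s) = (Num.sqrt s ^+ n)%:E * lam n (tball 1).
Proof.
move=> s0; have r0 : (0 < (Num.sqrt s)^-1)%R by rewrite invr_gt0 sqrtr_gt0.
rewrite -[(Num.sqrt s ^+ n)%R]invrK -exprVn -(lebesgue_tuple_affine (zerot n) r0); last first.
  exact: measurable_tball.
congr (lam n _); apply/funext => x; rewrite /tball/= dotp_addt0 exprVn (sqr_sqrtr (ltW s0)).
by rewrite ler_pdivrMl// mulr1.
Qed.

Lemma lebesgue_tuple_oball_gt0 n s : (0 < s)%R ->
  lam n (oball s) = (Num.sqrt s ^+ n)%:E * lam n (oball 1).
Proof.
move=> s0; have r0 : (0 < (Num.sqrt s)^-1)%R by rewrite invr_gt0 sqrtr_gt0.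
rewrite -[(Num.sqrt s ^+ n)%R]invrK -exprVn -(lebesgue_tuple_affine (zerot n) r0); last first.
  exact: measurable_oball.
congr (lam n _); apply/funext => x; rewrite /oball/= dotp_addt0 exprVn (sqr_sqrtr (ltW s0)).
by rewrite ltr_pdivrMl// mulr1.
Qed.

Lemma dotp_tuple_cons n (x : R) (y : n.-tuple R) :
  dotp (tuple_cons (x, y)) (tuple_cons (x, y)) = (x ^+ 2 + dotp y y)%R.
Proof.
rewrite /dotp big_ord_recl tnth_tuple_cons0 -expr2; congr (_ + _)%R.
by apply: eq_bigr => i _; rewrite tnth_tuple_consS.
Qed.

(** Only the slice at [x = 0] is nonempty, and one point is negligible for the outer integral. The
    dimension must be positive, since the measure on 0-tuples is a Dirac mass. *)
Lemma lebesgue_tuple_tball0 n : lam n.+1 (tball 0) = 0.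
Proof.
rewrite tuple_measureS.
transitivity (\int[mu]_(x in [set 0%R]) lam n [set y | tball 0 (tuple_cons (x, y))]).
  rewrite [RHS]integral_mkcond; apply: eq_integral => x _; rewrite patchE.
  case: ifPn => // /negP; rewrite inE/= => x0; rewrite (_ : [set y | _] = set0) ?measure0//.
  rewrite -subset0 => y; rewrite /tball/= dotp_tuple_cons => h; apply: x0; apply/eqP.
  rewrite -sqrf_eq0 eq_le sqr_ge0 andbT; apply: le_trans h.
  by rewrite lerDl dotp_ge0.
by rewrite integral_set1.
Qed.

Lemma lebesgue_tuple_tball n s : (0 <= s)%R ->
  lam n (tball s) = (Num.sqrt s ^+ n)%:E * lam n (tball 1).
Proof.
rewrite le_eqVlt => /predU1P[<-|]; last exact: lebesgue_tuple_tball_gt0.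
(* In dimension 0 every ball with [0 <= s] is the one-point space and [0 ^+ 0 = 1]; in positive
   dimension both sides vanish. *)
case: n => [|n]; last by rewrite sqrtr0 expr0n mul0e lebesgue_tuple_tball0.
rewrite expr0 mul1e; congr (lam 0 _); apply/seteqP; split => x _;
by rewrite /tball/= /dotp big_ord0.
Qed.

Lemma measurable_sqrt : measurable_fun [set: R] (@Num.sqrt R).
Proof. by apply: continuous_measurable_fun; exact: sqrt_continuous. Qed.

Lemma measurable_sqrt_pow n (f : R -> R) : measurable_fun [set: R] f ->
  measurable_fun [set: R] (fun x => Num.sqrt (f x) ^+ n)%R.
Proof.
by move=> mf; apply: measurable_funX; exact: (measurableT_comp measurable_sqrt).
Qed.

Lemma measurable_sqr : measurable_fun [set: R] (fun x => x ^+ 2)%R.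
Proof. by apply: measurable_funX; exact: measurable_id. Qed.

Lemma measurable_1Bsqr : measurable_fun [set: R] (fun x => 1 - x ^+ 2)%R.
Proof. by apply: measurable_funB => //; exact: measurable_sqr. Qed.

(** Keeps the ball of one dimension less as a factor: the volume of a cone has the same factor, and
    it cancels in the cap ratio. *)
Lemma lebesgue_tuple_tballS n :
  lam n.+1 (tball 1) =
  (\int[mu]_(x in `[(-1)%R, 1%R]) (Num.sqrt (1 - x ^+ 2) ^+ n)%:E) * lam n (tball 1).
Proof.
rewrite tuple_measureS.
transitivity (\int[mu]_(x in `[(-1)%R, 1%R]) ((Num.sqrt (1 - x ^+ 2) ^+ n)%:E * lam n (tball 1))).
  rewrite [RHS]integral_mkcond; apply: eq_integral => x _; rewrite patchE.
  have -> : [set y | tball 1 (tuple_cons (x, y))] = @tball n (1 - x ^+ 2).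
    by apply/funext => y; rewrite /tball/= dotp_tuple_cons lerBrDl.
  case: ifPn; rewrite mem_setE in_itv/= -ler_norml => x1.
    rewrite lebesgue_tuple_tball// subr_ge0 -real_normK ?num_real//.
    by rewrite expr_le1.
  rewrite (_ : tball _ = set0) ?measure0// -subset0 => y; rewrite /tball/= => h.
  have := le_trans (dotp_ge0 y) h; rewrite subr_ge0 -real_normK ?num_real// => x2.
  by move: x1; rewrite -(@expr_le1 _ 2)// x2.
rewrite ge0_integralZr//.
apply/measurable_EFinP/measurable_funTS; apply: measurable_sqrt_pow.
exact: measurable_1Bsqr.
Qed.

Lemma integral_sqrt_pow_gt0 n :
  0 < \int[mu]_(x in `[(-1)%R, 1%R]) (Num.sqrt (1 - x ^+ 2) ^+ n)%:E.
Proof.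
apply: (@lt_le_trans _ _ (\int[mu]_(x in `[(- 2^-1)%R, 2^-1%R]) (2^-1 ^+ n)%:E)).
  rewrite integral_cst//= lebesgue_measure_itv/= lte_fin ifT; last by lra.
  by rewrite -EFinB -EFinM lte_fin mulr_gt0// ?exprn_gt0//; lra.
apply: (@le_trans _ _ (\int[mu]_(x in `[(- 2^-1)%R, 2^-1%R]) (Num.sqrt (1 - x ^+ 2) ^+ n)%:E)).
  apply: ge0_le_integral => //.
  - apply/measurable_EFinP/measurable_funTS; apply: measurable_sqrt_pow.
    exact: measurable_1Bsqr.
  - move=> x /=; rewrite in_itv/= => /andP[x1 x2]; rewrite lee_fin lerXn2r ?nnegrE//.
    rewrite -[leLHS]ger0_norm// -sqrtr_sqr ler_wsqrtr//; nra.
apply: ge0_subset_integral => //=.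
- apply/measurable_EFinP/measurable_funTS; apply: measurable_sqrt_pow.
  exact: measurable_1Bsqr.
- by move=> x /=; rewrite !in_itv/=; lra.
Qed.

Lemma integral_sqrt_pow_lty n :
  \int[mu]_(x in `[(-1)%R, 1%R]) (Num.sqrt (1 - x ^+ 2) ^+ n)%:E < +oo.
Proof.
apply: (@le_lt_trans _ _ (\int[mu]_(x in `[(-1)%R, 1%R]) 1%:E)).
  apply: ge0_le_integral => //.
  - apply/measurable_EFinP/measurable_funTS; apply: measurable_sqrt_pow.
    exact: measurable_1Bsqr.
  - move=> x _; rewrite lee_fin exprn_ile1// -[leRHS]sqrtr1 ler_wsqrtr//.
    by rewrite gerBl sqr_ge0.
by rewrite integral_cst//= lebesgue_measure_itv/= lte_fin ifT ?ltry//; lra.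
Qed.

(** Both bounds are used throughout: [sphere_law] divides real parts of volumes, which is meaningful
    only if these are finite and nonzero. *)
Lemma lebesgue_tuple_tball1 n : 0 < lam n (tball 1) < +oo.
Proof.
elim: n => [|n /andP[IH0 IHy]].
  have -> : tball 1 = [set: 0.-tuple R].
    by apply/seteqP; split=> x _ //; rewrite /tball/= /dotp big_ord0.
  have -> : lam 0 [set: 0.-tuple R] = 1 by exact: diracT.
  by rewrite lte01 ltry.
rewrite lebesgue_tuple_tballS mule_gt0 ?integral_sqrt_pow_gt0//=.
by rewrite lte_mul_pinfty ?integral_sqrt_pow_lty// ?ge0_fin_numE ?integral_sqrt_pow_lty// ltW// integral_sqrt_pow_gt0.
Qed.

(** For c < 1 the closed ball of radius c lies in the open unit ball, and its volume, c to the power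
    of the dimension times that of the closed unit ball, tends to the latter as c increases to 1. *)
Lemma lebesgue_tuple_oball1 n : lam n.+1 (oball 1) = lam n.+1 (tball 1).
Proof.
have /andP[w0 wy] := lebesgue_tuple_tball1 n.+1.
have vw : lam n.+1 (oball 1) <= lam n.+1 (tball 1).
  by rewrite le_measure ?inE//; [exact: measurable_oball|exact: measurable_tball|move=> x /ltW].
apply/eqP; rewrite eq_le vw/=.
have wfin : lam n.+1 (tball 1) \is a fin_num by rewrite ge0_fin_numE// ltW.
have vfin : lam n.+1 (oball 1) \is a fin_num.
  by rewrite ge0_fin_numE// (le_lt_trans vw).
rewrite -(fineK wfin) -(fineK vfin) lee_fin leNgt; apply/negP => lt.
have cv : (c ^+ n.+1 * fine (lam n.+1 (tball 1)))%R @[c --> (1:R)%R]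
    --> (1 ^+ n.+1 * fine (lam n.+1 (tball 1)))%R.
  by apply: cvgM; [exact: exprn_continuous|exact: cvg_cst].
rewrite expr1n mul1r in cv.
have := cvgr_gt _ cv _ lt => H.
near (1:R)%R^'- => c.
have c0 : (0 < c)%R by near: c; apply: nbhs_left_gt.
have : (fine (lam n.+1 (oball 1)) < c ^+ n.+1 * fine (lam n.+1 (tball 1)))%R.
  by near: c; apply: cvg_within; exact: H.
rewrite -lte_fin EFinM !fineK//.
have -> : (c = Num.sqrt (c ^+ 2))%R by rewrite sqrtr_sqr gtr0_norm.
rewrite -lebesgue_tuple_tball ?sqr_ge0// ltNge => /negP; apply.
apply: le_measure; rewrite ?inE; [exact: measurable_tball|exact: measurable_oball|].
move=> x /le_lt_trans; apply; rewrite expr_lt1 ?ltW//.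
Unshelve. all: by end_near.
Qed.

Lemma lebesgue_tuple_oball n s : (0 <= s)%R ->
  lam n.+1 (oball s) = (Num.sqrt s ^+ n.+1)%:E * lam n.+1 (tball 1).
Proof.
rewrite le_eqVlt => /predU1P[<-|s0].
  rewrite sqrtr0 expr0n mul0e (_ : oball _ = set0) ?measure0//.
  by rewrite -subset0 => x; rewrite /oball/= ltNge dotp_ge0.
by rewrite lebesgue_tuple_oball_gt0// lebesgue_tuple_oball1.
Qed.

End isometry_invariance.

(** * Reflection invariance and the measure of a cap *)

Section sphere_law.
Context {R : realType}.
Notation mu := (@lebesgue_measure R).
Notation lam := (tuple_measure (@lebesgue_measure R)).
Local Open Scope ereal_scope.

Lemma measurable_reflect_along n (w : n.-tuple R) :
  measurable_fun [set: n.-tuple R] (reflect_along w).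
Proof.
apply: measurable_mktuple => i; apply: measurable_funD; first exact: measurable_tnth.
apply: measurable_fun_tnth; apply: measurable_mktuple => j.
apply: measurable_funM => //; apply: measurable_funN; apply: measurable_funM => //.
exact: measurable_dotp.
Qed.

Lemma measurable_addt dT (T : measurableType dT) n (f g : T -> n.-tuple R) :
  measurable_fun [set: T] f -> measurable_fun [set: T] g ->
  measurable_fun [set: T] (fun x => addt (f x) (g x)).
Proof.
by move=> mf mg; apply: measurable_mktuple => i; apply: measurable_funD;
  exact: measurable_fun_tnth.
Qed.

(* For an isometric linear involution O and the unit ball B, Tonelli applied to
   {(x, y) | O x + y \in A, y \in B} and translation invariance give
   lam (O^-1 A) * lam B = lam A * lam B. *)
Lemma lebesgue_tuple_reflect_along n (w : n.-tuple R) (A : set (n.-tuple R)) :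
  measurable A -> lam n (reflect_along w @^-1` A) = lam n A.
Proof.
move=> mA; pose O := reflect_along w; pose B : set (n.-tuple R) := tball 1.
have mB : measurable B by exact: measurable_tball.
have mO : measurable_fun [set: n.-tuple R] O := measurable_reflect_along w.
have mOA : measurable (O @^-1` A) by rewrite -[X in measurable X]setTI; exact: mO.
pose E : set (n.-tuple R * n.-tuple R) := [set xy | A (addt (O xy.1) xy.2) /\ B xy.2].
pose E' : set (n.-tuple R * n.-tuple R) :=
  [set xy | A xy.2 /\ B (addt xy.2 (scalet (-1) (O xy.1)))].
have mE : measurable E.
  apply: measurableI; rewrite -[X in measurable X]setTI.
    apply: (measurable_addt (measurableT_comp mO measurable_fst) measurable_snd) => //.
  exact: (@measurable_snd _ _ (n.-tuple R) (n.-tuple R) measurableT _ mB).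
have mE' : measurable E'.
  apply: measurableI; rewrite -[X in measurable X]setTI.
    exact: (@measurable_snd _ _ (n.-tuple R) (n.-tuple R) measurableT _ mA).
  apply: measurable_addt => //; apply: measurable_mktuple => i.
  apply: measurable_funM => //; apply: measurable_fun_tnth.
  exact: measurableT_comp.
have addtC x y : @addt R n x y = addt y x.
  by apply/eq_from_tnth => i; rewrite !tnth_mktuple addrC.
have H1 : \int[lam n]_x lam n [set y | E (x, y)] = lam n (O @^-1` A) * lam n B.
  rewrite tonelli_section//.
  transitivity (\int[lam n]_(y in B) lam n (O @^-1` A)); last first.
    by rewrite integral_cst.
  rewrite [RHS]integral_mkcond; apply: eq_integral => y _; rewrite patchE.
  case: ifPn => [/set_mem yB|/negP]; last first.
    rewrite inE => yB; rewrite (_ : [set x | _] = set0) ?measure0// -subset0.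
    by move=> x [].
  rewrite -(lebesgue_tuple_addt (O y) mOA); congr (lam n _).
  apply/seteqP; split => x; rewrite /E /O /= reflect_along_addt reflect_alongK.
    by case.
  by split.
have H2 : \int[lam n]_x lam n [set y | E (x, y)] = \int[lam n]_x lam n [set y | E' (x, y)].
  apply: eq_integral => x _.
  have mEx : measurable [set y | E' (x, y)].
    by have := measurable_xsection x mE'; rewrite xsectionE.
  rewrite -(lebesgue_tuple_addt (O x) mEx); congr (lam n _).
  apply/funext => y; rewrite /E /E' /= addtC; congr (_ /\ B _).
  by apply/eq_from_tnth => i; rewrite !tnth_mktuple; ring.
have H3 : \int[lam n]_x lam n [set y | E' (x, y)] = lam n A * lam n B.
  rewrite tonelli_section// muleC.
  transitivity (\int[lam n]_(y in A) lam n B); last first.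
    by rewrite integral_cst// muleC.
  rewrite [RHS]integral_mkcond; apply: eq_integral => y _; rewrite patchE.
  case: ifPn => [/set_mem yB|/negP]; last first.
    rewrite inE => yB; rewrite (_ : [set x | _] = set0) ?measure0// -subset0.
    by move=> x [].
  pose y' := scalet (-1) (O y).
  rewrite -(lebesgue_tuple_addt y' mB); congr (lam n _); apply/funext => x.
  (* [O] is isometric and self-adjoint, so |y - O x| = |x - O y|: for fixed [y] the condition on [x]
     is membership in a translate of [B]. *)
  rewrite /E' /=; have -> : B (addt x y') = B (addt y (scalet (-1) (O x))).
    congr (is_true (_ <= _))%R.
    rewrite /y' /O; move: (reflect_along_isometry w y) (reflect_along_isometry w x).
    move: (dotp_reflect_along w x y).
    move: (reflect_along w x) (reflect_along w y) => x1 y1 xy yy xx.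
    by rewrite !dotpE yy xx (dotpC y1) (dotpC y) xy; ring.
  by apply/propext; split => [[]|].
have /andP[B0 By] := @lebesgue_tuple_tball1 R n.
have : lam n (O @^-1` A) * lam n B = lam n A * lam n B by rewrite -H1 H2 H3.
move=> /(congr1 (fun z => z * ((fine (lam n B))^-1)%:E)).
have Bfin : lam n B \is a fin_num by rewrite ge0_fin_numE// ltW.
by rewrite -!muleA -{1 3}(fineK Bfin) -EFinM mulfV ?mule1// gt_eqF// fine_gt0// B0.
Qed.

(** The [n]-th power of the radius of the slice of [cone n t] at height [x]. The slice is the
    intersection of two concentric balls, one from the cone condition and one from the unit ball,
    hence the minimum of two squared radii. *)
Definition cap_profile n (t x : R) : R :=
  (Num.sqrt (Num.min (x ^+ 2 * (1 - t) / t) (1 - x ^+ 2)) ^+ n)%R.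

(** The part in the unit ball of the double cone over the two opposite caps around the first axis;
    stating the condition homogeneously avoids normalising [z]. *)
Definition cone n (t : R) := [set z : n.+1.-tuple R |
  (0 < dotp z z <= 1)%R /\ (t * dotp z z < tnth z ord0 ^+ 2)%R].

Lemma measurable_cone n t : measurable (@cone n t).
Proof.
have mdot : measurable_fun [set: n.+1.-tuple R] (fun z : n.+1.-tuple R => dotp z z).
  exact: measurable_dotp.
have -> : @cone n t = [set z | 0 < dotp z z]%R `&` [set z | dotp z z <= 1]%R `&`
    [set z | t * dotp z z < tnth z ord0 ^+ 2]%R.
  by apply/seteqP; split => z /=; rewrite /cone/=; [by case=> /andP[]|by move=> [[-> ->]]].
apply: measurableI; [apply: measurableI|].
- exact: measurable_set_lt.
- exact: measurable_set_le.
- apply: measurable_set_lt; first exact: measurable_funM.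
  by apply: measurable_funX; exact: measurable_tnth.
Qed.

Lemma measurable_cap_profile n t : measurable_fun [set: R] (cap_profile n t).
Proof.
apply: measurable_sqrt_pow; apply: measurable_minr; last exact: measurable_1Bsqr.
by do 2 apply: measurable_funM => //; exact: measurable_sqr.
Qed.

Lemma lebesgue_tuple_cone n t : (0 < t < 1)%R ->
  lam n.+2 (@cone n.+1 t) =
  (\int[mu]_(x in `[(-1)%R, 1%R]) (cap_profile n.+1 t x)%:E) * lam n.+1 (tball 1).
Proof.
move=> /andP[t0 t1]; rewrite tuple_measureS.
transitivity (\int[mu]_(x in `[(-1)%R, 1%R]) ((cap_profile n.+1 t x)%:E * lam n.+1 (tball 1))).
  rewrite [RHS]integral_mkcond; apply: eq_integral => x _; rewrite patchE.
  have -> : [set y | cone t (tuple_cons (x, y))] =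
      @oball R n.+1 (x ^+ 2 * (1 - t) / t) `&` tball (1 - x ^+ 2).
    apply/seteqP; split => y; rewrite /cone /oball /tball/= dotp_tuple_cons tnth_tuple_cons0.
      case=> /andP[h0 h1] h2; split; last by lra.
      by rewrite ltr_pdivlMr//; nra.
    rewrite ltr_pdivlMr// => -[h1 h2]; have := dotp_ge0 y => h3; split; last by nra.
    apply/andP; split; last by lra.
    (* The point is not the origin: with [x = 0] and [y] of norm 0 the strict inequality [h1] would
       read 0 < 0. *)
    rewrite lt_neqAle addr_ge0 ?sqr_ge0// andbT eq_sym paddr_eq0 ?sqr_ge0//.
    by apply/negP => /andP[/eqP x0 /eqP y0]; rewrite x0 y0 !mul0r ltxx in h1.
  case: ifPn; rewrite mem_setE in_itv/= -ler_norml => x1.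
    have x2 : (0 <= 1 - x ^+ 2)%R.
      by rewrite subr_ge0 -real_normK ?num_real// expr_le1.
    have x3 : (0 <= x ^+ 2 * (1 - t) / t)%R.
      apply: divr_ge0; last exact: ltW.
      by apply: mulr_ge0; [exact: sqr_ge0|rewrite subr_ge0 ltW].
    rewrite /cap_profile; case: (leP (x ^+ 2 * (1 - t) / t)%R (1 - x ^+ 2)%R) => le.
      have /setIidPl -> : @oball R n.+1 (x ^+ 2 * (1 - t) / t) `<=` tball (1 - x ^+ 2).
        by move=> y /ltW h; exact: le_trans le.
      by rewrite lebesgue_tuple_oball.
    have /setIidPr -> : @tball R n.+1 (1 - x ^+ 2) `<=` oball (x ^+ 2 * (1 - t) / t).
      by move=> y h; exact: le_lt_trans le.
    by rewrite lebesgue_tuple_tball.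
  rewrite (_ : tball _ = set0) ?setI0 ?measure0// -subset0 => y; rewrite /tball/= => h.
  have := le_trans (dotp_ge0 y) h; rewrite subr_ge0 -real_normK ?num_real// => x2.
  by move: x1; rewrite -(@expr_le1 _ 2)// x2.
rewrite ge0_integralZr//; last by move=> x _; rewrite lee_fin exprn_ge0.
by apply/measurable_EFinP/measurable_funTS; exact: measurable_cap_profile.
Qed.

Lemma enorm_dotp n (x : n.-tuple R) :
  ((0 < enorm x <= 1) = (0 < dotp x x <= 1))%R.
Proof.
rewrite /enorm sqrtr_gt0; congr andb.
by rewrite -[leLHS]ger0_norm ?sqrtr_ge0// -(@expr_le1 _ 2)// real_normK ?num_real//
  sqr_sqrtr// dotp_ge0.
Qed.

Lemma lebesgue_unit_cone n : lam n.+1 (unit_cone setT) = lam n.+1 (tball 1).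
Proof.
have muc : measurable (@unit_cone R n.+1 setT).
  rewrite (_ : unit_cone _ = [set x | 0 < dotp x x]%R `&` tball 1).
    apply: measurableI; last exact: measurable_tball.
    by apply: measurable_set_lt => //; exact: measurable_dotp.
  apply/seteqP; split => x; rewrite /unit_cone/= enorm_dotp.
    by case=> /andP[].
  by move=> [-> ->].
have -> : @tball R n.+1 1 = unit_cone setT `|` tball 0.
  apply/seteqP; split => x; rewrite /unit_cone/= enorm_dotp /tball/=.
    by move=> x1; case: (leP (dotp x x) 0%R); [right|left; rewrite x1].
  by case=> [[/andP[_ ->]]//|h]; lra.
have mt : measurable (@tball R n.+1 0) by exact: measurable_tball.
rewrite measureU//; first by rewrite /= lebesgue_tuple_tball0 adde0.
rewrite -subset0 => x; rewrite /unit_cone/tball/= enorm_dotp => -[[/andP[h _] _]].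
by rewrite leNgt h.
Qed.

(** The reflection exchanging [z] with the first basis vector maps the cone over the caps around [z]
    onto [cone n t] and preserves volume. The right-hand side is free of [z], which is the source of
    the independence of radius and maximum. *)
Lemma sphere_law_cap n t (z : n.+1.-tuple R) : dotp z z = 1%R ->
  sphere_law [set u | t < dotp u z ^+ 2]%R =
  (fine (lam n.+1 (@cone n t)) / fine (lam n.+1 (tball 1)))%R%:E.
Proof.
move=> z1; rewrite /sphere_law /lebesgue_tuple lebesgue_unit_cone; congr (fine _ / _)%R%:E.
pose e0 : n.+1.-tuple R := [tuple (i == ord0)%:R%R | i < n.+1].
have dote0 x : dotp x e0 = tnth x ord0.
  rewrite /dotp (bigD1 ord0)//= big1 ?addr0 ?tnth_mktuple ?eqxx ?mulr1// => i i0.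
  by rewrite tnth_mktuple (negbTE i0) mulr0.
have e01 : dotp z z = dotp e0 e0 by rewrite dote0 tnth_mktuple eqxx.
pose w := addt z (scalet (-1) e0).
have we0 : reflect_along w e0 = z by rewrite -(reflect_along_swap e01) reflect_alongK.
rewrite -(lebesgue_tuple_reflect_along w (@measurable_cone n t)); congr (lam _ _).
apply/funext => x; rewrite /unit_cone /cone /= enorm_dotp.
rewrite reflect_along_isometry -dote0 dotp_reflect_along we0.
have [x0|x0] := boolP (0 < dotp x x)%R; last first.
  by apply/propext; split => -[].
congr (_ /\ is_true _).
have -> : dotp [tuple (tnth x i / enorm x)%R | i < n.+1] z = (dotp x z / enorm x)%R.
  by rewrite /dotp mulr_suml; apply: eq_bigr => i _; rewrite tnth_mktuple mulrAC.
by rewrite expr_div_n sqr_enorm ltr_pdivlMr.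
Qed.

End sphere_law.

(** * Integrals of powers of sqrt (1 - x^2) *)

Section circle_integrals.
Context {R : realType}.
Notation mu := (@lebesgue_measure R).

Lemma within_continuous_integrable (a b : R) (f : R -> R) :
  {within `[a, b], continuous f} -> mu.-integrable `[a, b] (EFin \o f).
Proof. by move=> cf; apply: continuous_compact_integrable => //; exact: segment_compact. Qed.

Lemma Rintegral_continuous_FTC2 (f F : R -> R) (a b : R) : a < b ->
  {within `[a, b], continuous f} -> {within `[a, b], continuous F} ->
  (forall x, a < x < b -> is_derive x 1 F (f x)) ->
  \int[mu]_(x in `[a, b]) f x = F b - F a.
Proof.
move=> ab cf cF dF; rewrite /Rintegral (continuous_FTC2 ab cf (F := F))//.
  have [_ Fa Fb] := (continuous_within_itvP F ab).1 cF.
  by split => // x; rewrite in_itv/= => /dF [].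
by move=> x; rewrite in_itv/= => /dF [? <-]; rewrite derive1E.
Qed.

(** With [k = d - 3], the power [rho x ^+ k] is, up to a constant, the density of one coordinate of
    a uniform point of the sphere in dimension d. *)
Definition rho (x : R) : R := Num.sqrt (1 - x ^+ 2).

Lemma continuous_rho : continuous rho.
Proof.
move=> x; apply: (@continuous_comp R R R (fun x => 1 - x ^+ 2) (@Num.sqrt R)); last exact: sqrt_continuous.
by apply: cvgB; [exact: cvg_cst|exact: exprn_continuous].
Qed.

Lemma continuous_rhoX k : continuous (fun x => rho x ^+ k).
Proof.
move=> x; apply: (@continuous_comp R R R rho (fun x => x ^+ k)); first exact: continuous_rho.
exact: exprn_continuous.
Qed.

Lemma rho_ge0 x : 0 <= rho x. Proof. exact: sqrtr_ge0. Qed.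

Lemma rho_le1 x : rho x <= 1.
Proof. by rewrite /rho -[leRHS]sqrtr1 ler_wsqrtr// gerBl sqr_ge0. Qed.

Lemma sqr_rho x : -1 <= x <= 1 -> rho x ^+ 2 = 1 - x ^+ 2.
Proof. by move=> x1; rewrite /rho sqr_sqrtr//; nra. Qed.

Lemma rho_gt0 x : -1 < x < 1 -> 0 < rho x.
Proof. by move=> x1; rewrite /rho sqrtr_gt0; nra. Qed.

Lemma rho1 : rho 1 = 0. Proof. by rewrite /rho expr1n subrr sqrtr0. Qed.

Lemma is_derive_rhoX k (x : R) : -1 < x < 1 ->
  is_derive x 1 (fun x => rho x ^+ k.+2) (- (k.+2%:R * x * rho x ^+ k)).
Proof.
move=> x1; have r0 := rho_gt0 x1.
have d1 : is_derive x (1:R) (fun x : R => 1 - x ^+ 2) (- (2 * x)).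
  apply: (is_derive_eq (is_deriveB (is_derive_cst (1:R) x (1:R)) (is_deriveX 2 (is_derive_id x (1:R))))).
  by rewrite sub0r /= expr1 -[_ *: 1]/(_ * 1) mulr1.
have x2 : 0 < 1 - x ^+ 2 by nra.
have d2 : is_derive x (1:R) rho (- x / rho x).
  have d3 : is_derive x (1:R) rho ((2 * Num.sqrt (1 - x ^+ 2))^-1 * - (2 * x)).
    exact: (@is_derive1_comp R (@Num.sqrt R) (fun x => 1 - x ^+ 2) x _ _ (is_derive1_sqrt x2) d1).
  apply: (is_derive_eq d3).
  by rewrite -/(rho x); field; rewrite gt_eqF.
have := is_deriveX k.+2 d2; rewrite exprfctE => d4.
apply: (is_derive_eq d4).
by rewrite -[_ *: _]/(_ * _) /= exprS; field; rewrite gt_eqF.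
Qed.

(** The derivative of [x * rho x ^+ k.+2] is [k.+3%:R * rho x ^+ k.+2 - k.+2%:R * rho x ^+ k]. The
    recursion turns the exponent k + 2 of cone volumes into the exponent k of the marginal
    density. *)
Lemma Rintegral_rhoX_rec k (s : R) : 0 <= s < 1 ->
  k.+2%:R * \int[mu]_(x in `[s, 1]) rho x ^+ k =
  k.+3%:R * \int[mu]_(x in `[s, 1]) rho x ^+ k.+2 + s * rho s ^+ k.+2.
Proof.
move=> /andP[s0 s1].
have intr j (c : R) : mu.-integrable `[s, 1] (EFin \o (fun x => c * rho x ^+ j)).
  apply: within_continuous_integrable; apply: continuous_subspaceT => x.
  by apply: cvgM; [exact: cvg_cst|exact: continuous_rhoX].
have intr1 j : mu.-integrable `[s, 1] (EFin \o (fun x => rho x ^+ j)).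
  by apply: within_continuous_integrable; apply: continuous_subspaceT; exact: continuous_rhoX.
have := @Rintegral_continuous_FTC2
  (fun x => k.+3%:R * rho x ^+ k.+2 - k.+2%:R * rho x ^+ k) (fun x => x * rho x ^+ k.+2) s 1 s1.
rewrite RintegralB// !RintegralZl// rho1 expr0n mulr0 sub0r => h.
suff : k.+3%:R * \int[mu]_(x in `[s, 1]) rho x ^+ k.+2 -
       k.+2%:R * \int[mu]_(x in `[s, 1]) rho x ^+ k = - (s * rho s ^+ k.+2) by lra.
apply: h.
- apply: continuous_subspaceT => x; apply: cvgB; apply: cvgM; (try exact: cvg_cst);
  exact: continuous_rhoX.
- by apply: continuous_subspaceT => x; apply: cvgM; [exact: cvg_id|exact: continuous_rhoX].
- move=> x /andP[sx x1]; have x01 : -1 < x < 1 by rewrite x1 andbT; lra.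
  apply: (is_derive_eq (is_deriveM (is_derive_id x (1:R)) (is_derive_rhoX k x01))).
  have -> : rho x ^+ k.+2 = rho x ^+ k * (1 - x ^+ 2).
    by rewrite -addn2 exprD sqr_rho//; lra.
  by rewrite -![_ *: _]/(_ * _) /= -[k.+3]addn1 natrD; ring.
Qed.

(** The integration by parts behind the tail asymptotics: the derivative of [- (rho x ^+ k.+2 / x)]
    is [k.+2%:R * rho x ^+ k] plus a remainder between 0 and [s ^- 2 * rho x ^+ k]. With t = s^2 and
    k + 2 = d - 1 the relative error is 1/((d-1) t). *)
Lemma Rintegral_rhoX_bounds k (s : R) : 0 < s < 1 ->
  k.+2%:R * \int[mu]_(x in `[s, 1]) rho x ^+ k <= rho s ^+ k.+2 / s <=
  (k.+2%:R + s ^- 2) * \int[mu]_(x in `[s, 1]) rho x ^+ k.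
Proof.
move=> /andP[s0 s1].
have intr (c : R) : mu.-integrable `[s, 1] (EFin \o (fun x => c * rho x ^+ k)).
  apply: within_continuous_integrable; apply: continuous_subspaceT => x.
  by apply: cvgM; [exact: cvg_cst|exact: continuous_rhoX].
have intr1 : mu.-integrable `[s, 1] (EFin \o (fun x => rho x ^+ k)).
  by apply: within_continuous_integrable; apply: continuous_subspaceT; exact: continuous_rhoX.
pose f x : R := k.+2%:R * rho x ^+ k + rho x ^+ k.+2 / x ^+ 2.
pose F x : R := - (rho x ^+ k.+2 / x).
have x0 x : s <= x -> x != 0 by move=> sx; rewrite gt_eqF// (lt_le_trans s0).
have cf : {within `[s, 1], continuous f}.
  apply: continuous_in_subspaceT => x; rewrite mem_setE in_itv/= => /andP[sx _].
  apply: cvgD; first by apply: cvgM; [exact: cvg_cst|exact: continuous_rhoX].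
  apply: cvgM; first exact: continuous_rhoX.
  by apply: cvgV; [rewrite expf_neq0// x0|exact: exprn_continuous].
have cF : {within `[s, 1], continuous F}.
  apply: continuous_in_subspaceT => x; rewrite mem_setE in_itv/= => /andP[sx _].
  apply: cvgN; apply: cvgM; first exact: continuous_rhoX.
  by apply: cvgV; [exact: x0|exact: cvg_id].
have dF x : s < x < 1 -> is_derive x 1 F (f x).
  move=> /andP[sx x1]; have x01 : -1 < x < 1 by rewrite x1 andbT; lra.
  have xn0 := x0 _ (ltW sx).
  have d1 := is_deriveN (is_deriveM (is_derive_rhoX k x01) (is_deriveV xn0 (is_derive_id x (1:R)))).
  apply: (is_derive_eq d1).
  rewrite -![_ *: _]/(_ * _) /f /=.
  by field.
have -> : rho s ^+ k.+2 / s = \int[mu]_(x in `[s, 1]) f x.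
  rewrite (Rintegral_continuous_FTC2 s1 cf cF dF) /F rho1 expr0n mul0r oppr0 sub0r opprK//.
have intf := within_continuous_integrable cf.
rewrite -!RintegralZl//; apply/andP; split; apply: le_Rintegral => //.
- move=> x _; rewrite /f lerDl; apply: divr_ge0; last exact: sqr_ge0.
  by apply: exprn_ge0; exact: rho_ge0.
- move=> x /=; rewrite in_itv/= => /andP[sx x1]; rewrite /f [leRHS]mulrDl lerD2l mulrC.
  apply: ler_pM; rewrite ?exprn_ge0 ?rho_ge0 ?invr_ge0 ?sqr_ge0//.
    have xp : 0 < x := lt_le_trans s0 sx.
    by rewrite lef_pV2 ?posrE ?exprn_gt0//; nra.
  by rewrite ler_wiXn2l ?rho_ge0 ?rho_le1// -addn2 leq_addr.
Qed.

Lemma Rintegral_rhoX_ge0 k (s : R) : 0 <= \int[mu]_(x in `[s, 1]) rho x ^+ k.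
Proof. by apply: Rintegral_ge0 => x _; rewrite exprn_ge0 ?rho_ge0. Qed.

Lemma Rintegral_rhoX_0s k (s : R) : 0 <= s <= 1 ->
  s * rho s ^+ k <= \int[mu]_(x in `[0, s]) rho x ^+ k <= s.
Proof.
move=> /andP[s0 s1].
have intr : mu.-integrable `[0, s] (EFin \o (fun x => rho x ^+ k)).
  by apply: within_continuous_integrable; apply: continuous_subspaceT; exact: continuous_rhoX.
have intc (c : R) : mu.-integrable `[0, s] (EFin \o (fun x => c)).
  by apply: within_continuous_integrable; apply: continuous_subspaceT => x; exact: cvg_cst.
have cstE (c : R) : \int[mu]_(x in `[0, s]) c = s * c.
  rewrite Rintegral_cst//= lebesgue_measure_itv/= lte_fin mulrC; case: ltgtP s0 => //= [_ _|<- _].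
    by rewrite oppr0 addr0.
  by rewrite mul0r.
apply/andP; split; [rewrite -cstE|rewrite -[leRHS]mulr1 -cstE]; apply: le_Rintegral => // x /=;
  rewrite in_itv/= => /andP[x0 xs].
  rewrite lerXn2r ?nnegrE ?rho_ge0// ler_wsqrtr// lerD2l lerN2 lerXn2r ?nnegrE//.
by rewrite exprn_ile1 ?rho_ge0 ?rho_le1.
Qed.

End circle_integrals.

(** * The cap ratio as a quotient of one-dimensional integrals *)

Section cap_ratio.
Context {R : realType}.
Notation mu := (@lebesgue_measure R).
Notation lam := (tuple_measure (@lebesgue_measure R)).
Local Notation S k s := (\int[mu]_(x in `[s, 1]) rho x ^+ k).

Lemma EFin_Rintegral (a b : R) (f : R -> R) : {within `[a, b], continuous f} ->
  (\int[mu]_(x in `[a, b]) (f x)%:E)%E = (\int[mu]_(x in `[a, b]) f x)%:E.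
Proof.
move=> cf; rewrite /Rintegral fineK// integrable_fin_num//.
exact: within_continuous_integrable.
Qed.

Lemma Rintegral_itv_split (a c b : R) (f : R -> R) : a <= c <= b -> continuous f ->
  \int[mu]_(x in `[a, b]) f x =
  \int[mu]_(x in `[a, c]) f x + \int[mu]_(x in `[c, b]) f x.
Proof.
move=> /andP[ac cb] cf.
have intr (a' b' : R) : mu.-integrable `[a', b'] (EFin \o f).
  by apply: within_continuous_integrable; apply: continuous_subspaceT.
have e : `[a, b]%classic = `[a, c]%classic `|` `]c, b]%classic :> set R.
  by rewrite -itv_bndbnd_setU// !bnd_simp.
have sub : `]c, b] `<=` (`[c, b] : set R) by exact: subset_itv_oc_cc.
rewrite e Rintegral_setU//=.
- by rewrite Rintegral_itv_obnd_cbnd//; apply: integrableS (intr c b).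
- by have := intr a b; rewrite e.
- rewrite disj_set2E; apply/eqP; rewrite -subset0 => x [] /=; rewrite !in_itv/=.
  by move=> /andP[_ h] /andP[/lt_le_trans/(_ h)]; rewrite ltxx.
Qed.

Lemma Rintegral_even (r : R) (f : R -> R) : 0 <= r -> continuous f ->
  (forall x, f (- x) = f x) ->
  \int[mu]_(x in `[(- r), r]) f x = 2 * \int[mu]_(x in `[0, r]) f x.
Proof.
move=> r0 cf fN; rewrite (@Rintegral_itv_split _ 0)//; last by lra.
rewrite mulr2n mulrDl !mul1r; congr (_ + _).
rewrite /Rintegral; congr fine; rewrite -[X in `[_, X]]oppr0.
rewrite integration_by_substitution_oppr//; last exact: continuous_subspaceT.
by apply: eq_integral => x _ /=; rewrite fN.
Qed.

Lemma continuous_cap_profile n (t : R) : continuous (cap_profile n t).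
Proof.
move=> x; apply: (@continuous_comp R R R (fun x => Num.sqrt (Num.min (x ^+ 2 * (1 - t) / t) (1 - x ^+ 2)))
  (fun x => x ^+ n)); last exact: exprn_continuous.
apply: (@continuous_comp R R R (fun x => Num.min (x ^+ 2 * (1 - t) / t) (1 - x ^+ 2))
  (@Num.sqrt R)); last exact: sqrt_continuous.
apply: (@continuous_min R R (fun x => x ^+ 2 * (1 - t) / t) (fun x => 1 - x ^+ 2)).
  by do 2 (apply: cvgM; last exact: cvg_cst); exact: exprn_continuous.
by apply: cvgB; [exact: cvg_cst|exact: exprn_continuous].
Qed.

Lemma Rintegral_exprn n (s : R) : 0 < s -> \int[mu]_(x in `[0, s]) x ^+ n = s ^+ n.+1 / n.+1%:R.
Proof.
move=> s0.
have := @Rintegral_continuous_FTC2 R (fun x => x ^+ n) (fun x => x ^+ n.+1 / n.+1%:R) 0 s s0.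
rewrite expr0n mul0r subr0; apply.
- by apply: continuous_subspaceT; exact: exprn_continuous.
- apply: continuous_subspaceT => x; apply: cvgM; last exact: cvg_cst.
  exact: exprn_continuous.
- move=> x _; have := is_deriveX n.+1 (is_derive_id x (1:R)); rewrite exprfctE => d1.
  have d2 := is_deriveM d1 (is_derive_cst (n.+1%:R^-1 : R) x (1:R)).
  by apply: (is_derive_eq d2); rewrite -![_ *: _]/(_ * _) /= mulr0 add0r mulr1 mulKf// pnatr_eq0.
Qed.

(** The two branches of the minimum meet at [Num.sqrt t]. Below it the slice radius is linear in x,
    and the integral is [s * rho s ^+ k.+2 / k.+3%:R]; this is the boundary term of the recursion,
    so only the integral of [rho x ^+ k] remains. *)
Lemma Rintegral_cap_profile k (t : R) : 0 < t < 1 ->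
  \int[mu]_(x in `[-1, 1]) cap_profile k.+2 t x =
  2 * (k.+2%:R / k.+3%:R * S k (Num.sqrt t)).
Proof.
move=> /andP[t0 t1]; set s := Num.sqrt t.
have s0 : 0 < s by rewrite sqrtr_gt0.
have s2 : s ^+ 2 = t by rewrite sqr_sqrtr ?ltW.
have s1 : s < 1 by nra.
have rs : rho s ^+ 2 = 1 - t by rewrite sqr_rho ?s2//; lra.
have capN x : cap_profile k.+2 t (- x) = cap_profile k.+2 t x by rewrite /cap_profile sqrrN.
rewrite Rintegral_even//; last exact: continuous_cap_profile.
congr (2 * _); rewrite (@Rintegral_itv_split _ s); [|lra|exact: continuous_cap_profile].
have -> : \int[mu]_(x in `[0, s]) cap_profile k.+2 t x =
    (rho s / s) ^+ k.+2 * (s ^+ k.+3 / k.+3%:R).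
  rewrite -Rintegral_exprn// -RintegralZl//.
    apply: eq_Rintegral => x; rewrite inE/= in_itv/= => /andP[x0 xs].
    rewrite -exprMn; congr (_ ^+ _).
    have min1 : x ^+ 2 * (1 - t) / t <= 1 - x ^+ 2.
      by rewrite ler_pdivrMr//; nra.
    have r0 : 0 <= rho s / s * x.
      by apply: mulr_ge0 => //; apply: divr_ge0; [exact: rho_ge0|exact: ltW].
    rewrite min_l// -[RHS]ger0_norm//.
    rewrite -sqrtr_sqr. congr (@Num.sqrt R _); rewrite !exprMn exprVn rs s2.
    by field; rewrite gt_eqF.
  by apply: within_continuous_integrable; apply: continuous_subspaceT; exact: exprn_continuous.
have -> : \int[mu]_(x in `[s, 1]) cap_profile k.+2 t x = S k.+2 s.
  apply: eq_Rintegral => x; rewrite inE/= in_itv/= => /andP[sx x1].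
  rewrite /cap_profile /rho min_r// ler_pdivlMr//; nra.
have := @Rintegral_rhoX_rec R k s; rewrite (ltW s0) s1 => /(_ isT) rec.
have N0 : k.+3%:R != 0 :> R by rewrite pnatr_eq0.
apply: (mulfI N0); have -> (a b : R) : k.+3%:R * (a / k.+3%:R * b) = a * b.
  by rewrite mulrCA mulrA mulfVK// mulrC.
rewrite rec mulrDr addrC; congr (_ + _).
rewrite expr_div_n (exprS s) mulrCA [k.+3%:R * _]mulrC mulfVK//.
by rewrite mulrCA mulfVK// expf_neq0// gt_eqF.
Qed.

Lemma Rintegral_rhoX_sym k :
  \int[mu]_(x in `[-1, 1]) rho x ^+ k.+2 = 2 * (k.+2%:R / k.+3%:R * S k 0).
Proof.
rewrite Rintegral_even//; last 2 first.
  exact: continuous_rhoX.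
  by move=> x; rewrite /rho sqrrN.
congr (2 * _); have := @Rintegral_rhoX_rec R k 0; rewrite lexx ltr01 => /(_ isT).
by rewrite mul0r addr0 mulrAC => ->; rewrite [_ * _]mulrC mulKf ?pnatr_eq0.
Qed.

Lemma Rintegral_rhoX_gt0 k (s : R) : 0 <= s < 1 -> 0 < S k s.
Proof.
(* The integration by parts needs a positive left endpoint, whereas [s] may be 0; positivity is
   obtained on [[u, 1]] only. *)
move=> /andP[s0 s1]; pose u := (s + 1) / 2.
have u1 : 0 < u < 1 by rewrite /u; lra.
apply: lt_le_trans (_ : S k u <= _); last first.
  rewrite (@Rintegral_itv_split s u); [|by rewrite /u; lra|exact: continuous_rhoX].
  by rewrite lerDr; apply: Rintegral_ge0 => x _; rewrite exprn_ge0// rho_ge0.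
have /andP[_ h] := Rintegral_rhoX_bounds k u1.
have : 0 < rho u ^+ k.+2 / u by rewrite divr_gt0 ?exprn_gt0 ?rho_gt0//; lra.
move=> /lt_le_trans/(_ h); rewrite pmulr_rgt0// addr_gt0// invr_gt0 exprn_gt0//; lra.
Qed.

(** Cone and ball share the factor 2 (k+2)/(k+3) and the volume of the unit ball of one dimension
    less; after cancellation two integrals with exponent k = d - 3 are left. *)
Lemma sphere_law_cap_ratio k t (z : k.+3.-tuple R) : 0 < t < 1 -> dotp z z = 1 ->
  sphere_law [set u | t < dotp u z ^+ 2] = (S k (Num.sqrt t) / S k 0)%:E.
Proof.
move=> t01 z1; rewrite sphere_law_cap// lebesgue_tuple_cone// (lebesgue_tuple_tballS k.+2).
rewrite (EFin_Rintegral (continuous_subspaceT (@continuous_cap_profile k.+2 t))).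
rewrite (EFin_Rintegral (f := fun x => rho x ^+ _)); last first.
  by apply: continuous_subspaceT; exact: continuous_rhoX.
have /andP[B0 By] := @lebesgue_tuple_tball1 R k.+2.
have Bfin : lam k.+2 (tball 1) \is a fin_num by rewrite ge0_fin_numE// ltW.
rewrite -(fineK Bfin) -!EFinM /= Rintegral_cap_profile// Rintegral_rhoX_sym.
have w0 : fine (lam k.+2 (tball 1)) != 0 by rewrite gt_eqF// fine_gt0// B0.
have S0 : S k 0 != 0 by rewrite gt_eqF// Rintegral_rhoX_gt0// lexx ltr01.
have N0 : k.+2%:R != 0 :> R by rewrite pnatr_eq0.
have N1 : k.+3%:R != 0 :> R by rewrite pnatr_eq0.
move: w0 S0 N0 N1; move: (fine _) (S k 0) (k.+2%:R) (k.+3%:R) => w x y z' w0 S0 N0 N1.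
by congr EFin; field; rewrite w0 S0 N0 N1.
Qed.

End cap_ratio.

(** * The Beta function and the size of its values *)

Section beta_integral.
Context {R : realType}.
Notation mu := (@lebesgue_measure R).
Local Notation S k s := (\int[mu]_(x in `[s, 1]) rho x ^+ k).

(** Substitution of the square of the variable; the positive lower limit keeps away from the
    singularity at 0. *)
Lemma Rintegral_beta_substitution k (a : R) : 0 < a < 1 ->
  (\int[mu]_(x in `[(a ^+ 2)%R, 1%R]) ((Num.sqrt x)^-1 * Num.sqrt (1 - x) ^+ k)%:E)%E =
   (2 * S k a)%:E.
Proof.
move=> /andP[a0 a1]; pose F (x : R) := x ^+ 2.
pose G (x : R) := (Num.sqrt x)^-1 * Num.sqrt (1 - x) ^+ k.
have F' : derive1 F = (fun x : R => 2 * x).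
  apply/funext => x; rewrite derive1E /F; have := is_deriveX 2 (is_derive_id x (1:R)).
  by rewrite exprfctE => -[_ ->]; rewrite -[_ *: _]/(_ * _) /= expr1 mulr1.
have cF' x : derive1 F y @[y --> x] --> derive1 F x.
  by rewrite F'; apply: cvgM; [exact: cvg_cst|exact: cvg_id].
have cG : {within `[F a, F 1], continuous G}.
  apply: continuous_in_subspaceT => x; rewrite mem_setE in_itv/= => /andP[ax _].
  have x0 : 0 < x by apply: lt_le_trans ax; rewrite exprn_gt0.
  apply: cvgM.
    by apply: cvgV; [rewrite gt_eqF// sqrtr_gt0|exact: sqrt_continuous].
  apply: (@continuous_comp R R R (fun x => Num.sqrt (1 - x)) (fun x => x ^+ k)); last exact: exprn_continuous.
  apply: (@continuous_comp R R R (fun x => 1 - x) (@Num.sqrt R)); last exact: sqrt_continuous.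
  by apply: cvgB; [exact: cvg_cst|exact: cvg_id].
have := @integration_by_substitution_increasing R F G a 1 (ltW a1).
have F1 : F 1 = 1 by rewrite /F expr1n.
rewrite F1 => ->//; first last.
- by rewrite -F1.
- split; first by move=> x _; exact: exprn_derivable.
    by apply: cvg_at_right_filter; exact: exprn_continuous.
  by apply: cvg_at_left_filter; exact: exprn_continuous.
- by apply/cvg_ex; exists (derive1 F 1); apply: cvg_at_left_filter; exact: cF'.
- by apply/cvg_ex; exists (derive1 F a); apply: cvg_at_right_filter; exact: cF'.
- by move=> x _; exact: cF'.
- by move=> x y; rewrite !in_itv/= => /andP[ax _] /andP[ay _] xy; rewrite /F; nra.
rewrite -RintegralZl//; last first.
  by apply: within_continuous_integrable; apply: continuous_subspaceT; exact: continuous_rhoX.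
rewrite -EFin_Rintegral; last first.
  by apply: continuous_subspaceT => x; apply: cvgM; [exact: cvg_cst|exact: continuous_rhoX].
apply: eq_integral => x; rewrite mem_setE in_itv/= => /andP[ax x1].
have x0 : 0 < x := lt_le_trans a0 ax.
congr EFin; rewrite F' -[LHS]/(G (F x) * (2 * x)) /G /F -/(rho x) sqrtr_sqr gtr0_norm//.
by field; rewrite gt_eqF.
Qed.

Lemma Rintegral_rhoX_near0 k (s : R) : 0 <= s <= 1 -> S k 0 - s <= S k s <= S k 0.
Proof.
move=> s01; have /andP[h1 h2] := Rintegral_rhoX_0s k s01.
rewrite (@Rintegral_itv_split _ 0 s 1 _ s01); last exact: continuous_rhoX.
have : 0 <= \int[mu]_(x in `[0, s]) rho x ^+ k.
  by apply: Rintegral_ge0 => x _; rewrite exprn_ge0// rho_ge0.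
lra.
Qed.

(** Since (k+3-1)/2 - 1 = k/2, the Beta integrand is the one of the substitution lemma. The interval
    []0, 1]] is exhausted by intervals bounded away from 0: the left integrals converge by monotone
    convergence, the right ones because [rho <= 1]. *)
Lemma beta_realE k : beta_real (1 / 2) ((k.+3%:R - 1) / 2) = 2 * S k 0.
Proof.
pose g (x : R) : R := (Num.sqrt x)^-1 * Num.sqrt (1 - x) ^+ k.
have mg0 : measurable_fun (`]0, +oo[%classic : set R) g.
  apply: measurable_funM; last first.
    apply: measurable_funTS; apply: (@measurable_sqrt_pow R k (fun x => 1 - x)).
    by apply: measurable_funB; [exact: measurable_cst|exact: measurable_id].
  apply: open_continuous_measurable_fun => // x; rewrite mem_setE in_itv/= andbT => x0.
  by apply: cvgV; [rewrite gt_eqF// sqrtr_gt0|exact: sqrt_continuous].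
have mg (D : set R) : (forall x, D x -> 0 < x) -> measurable_fun D g.
  move=> D0; apply: measurable_funS mg0 => //.
  by move=> x /D0; rewrite /= in_itv/= andbT.
have g0 x : 0 <= g x by rewrite /g mulr_ge0 ?invr_ge0 ?exprn_ge0 ?sqrtr_ge0.
rewrite /beta_real /Rintegral.
transitivity (fine (\int[mu]_(x in `]0, 1]) (g x)%:E)).
  congr fine; rewrite -integral_itv_bndo_bndc//; last first.
    apply/measurable_EFinP; apply: mg => // x /=; rewrite in_itv/=.
    by case/andP.
  apply: eq_integral => x; rewrite mem_setE in_itv/= => /andP[x0 x1]; congr EFin.
  rewrite (_ : 1 / 2 - 1 = - 2^-1); last by lra.
  rewrite powRN powR12_sqrt ?ltW//; congr (_ * _).
  rewrite (_ : (k.+3%:R - 1) / 2 - 1 = 2^-1 * k%:R); last first.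
    by rewrite -addn3 natrD; field.
  by rewrite powRrM powR_mulrn ?powR_ge0// powR12_sqrt// subr_ge0 ltW.
(* Starting at [j.+2] keeps every [a_ j] strictly below 1. *)
pose a_ j : R := (j.+2%:R)^-1.
have a01 j : 0 < a_ j < 1 by rewrite /a_ invr_gt0 ltr0n/= invf_lt1 ?ltr0n// ltr1n.
have -> : `]0, 1]%classic = \bigcup_j (`[a_ j ^+ 2, 1]%classic : set R).
  apply/seteqP; split => x /=; rewrite in_itv/=.
    move=> /andP[x0 x1]; have s0 : 0 < Num.sqrt x by rewrite sqrtr_gt0.
    have [j jx] : exists j : nat, (Num.sqrt x)^-1 <= j.+2%:R.
      exists (Num.truncn (Num.sqrt x)^-1); apply: ltW.
      apply: lt_le_trans (truncnS_gt _) _.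
      by rewrite ler_nat.
    exists j => //=; rewrite in_itv/= x1 andbT -[leRHS](sqr_sqrtr (ltW x0)).
    by rewrite lerXn2r ?nnegrE ?(ltW s0)//; [rewrite ltW//; case/andP: (a01 j)|rewrite /a_ invf_ple ?posrE].
  move=> [j _ /=]; rewrite in_itv/= => /andP[ax ->]; rewrite andbT.
  by apply: lt_le_trans ax; rewrite exprn_gt0//; case/andP: (a01 j).
have cv1 := @ge0_nondecreasing_set_cvg_integral _ (measurableTypeR R) R (fun j => `[a_ j ^+ 2, 1]%classic)
  (EFin \o g) mu.
have cv3 : (\int[mu]_(x in `[(a_ j ^+ 2)%R, 1%R]) (g x)%:E)%E @[j --> \oo] -->
    (\int[mu]_(x in \bigcup_j `[(a_ j ^+ 2)%R, 1%R]%classic) (g x)%:E)%E.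
  apply: cv1 => //.
  - move=> i j ij; apply/subsetPset => x /=; rewrite !in_itv/= => /andP[ax ->]; rewrite andbT.
    apply: le_trans ax; have /andP[i0 _] := a01 i; have /andP[j0 _] := a01 j.
    by rewrite lerXn2r ?nnegrE ?(ltW i0) ?(ltW j0)// /a_ lef_pV2 ?posrE ?ltr0n// ler_nat.
  - move=> i; apply/measurable_EFinP; apply: mg => // x /=; rewrite in_itv/=.
    case/andP => ax _; apply: lt_le_trans ax.
    by rewrite exprn_gt0//; case/andP: (a01 i).
  - by move=> i x _; rewrite lee_fin.
have cv2 : (2 * S k (a_ j))%:E @[j --> \oo] --> (2 * S k 0)%:E.
  apply: cvg_EFin; first by near=> j.
  apply: cvgM; first exact: cvg_cst.
  have ca : a_ j @[j --> \oo] --> (0 : R).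
    by have := @cvg_harmonic R; rewrite -(cvg_shiftS).
  apply: (@squeeze_cvgr _ _ _ _ (fun j => S k 0 - a_ j) (fun=> S k 0)).
  - near=> j; have /andP[i0 i1] := a01 j; apply: Rintegral_rhoX_near0.
    by rewrite !ltW.
  - by rewrite -[X in _ --> X]subr0; apply: cvgB => //; exact: cvg_cst.
  - exact: cvg_cst.
rewrite (cvg_unique _ cv3 (y := (2 * S k 0)%:E))//.
apply: cvg_trans cv2; apply: near_eq_cvg; near=> j.
by rewrite /= -Rintegral_beta_substitution.
Unshelve. all: by end_near.
Qed.

(** The integrand stays of order 1 up to x of order 1/sqrt k, which gives the square root without
    Gamma function asymptotics. These two-sided bounds are all that is needed about the Beta value
    inside [c_pd]. *)
Lemma Rintegral_rhoX_sqrt_bounds k :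
  3 / 8 * Num.sqrt k.+2%:R <= k.+2%:R * S k 0 <= 2 * Num.sqrt k.+2%:R.
Proof.
set r := Num.sqrt k.+2%:R.
have r0 : 0 < r by rewrite sqrtr_gt0 ltr0n.
have r2 : k.+2%:R = r ^+ 2 by rewrite sqr_sqrtr// ler0n.
have r1 : 1 < r.
  by rewrite -[ltLHS]sqrtr1 ltr_sqrt ?ltr0n// ltr1n.
apply/andP; split.
  (* With this [s] one has k s^2 <= 1/4, so Bernoulli's inequality gives [rho x ^+ k >= 3 / 4] on
     [[0, s]]; then r^2 s (3/4) = (3/8) r. *)
  pose s := (2 * r)^-1.
  have s0 : 0 < s by rewrite invr_gt0 mulr_gt0.
  have s1 : s < 1 by rewrite invf_lt1 ?mulr_gt0//; lra.
  have s01 : 0 <= s <= 1 by rewrite !ltW.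
  have sr : s * r = 1 / 2 by rewrite /s; field; rewrite gt_eqF.
  have /andP[h _] := Rintegral_rhoX_0s k s01.
  have h0 := Rintegral_rhoX_ge0 k s.
  have rk : 3 / 4 <= rho s ^+ k.
    apply: (@le_trans _ _ ((1 - s ^+ 2) ^+ k)); last first.
      rewrite -sqr_rho; last by lra.
      rewrite lerXn2r ?nnegrE ?sqr_ge0 ?rho_ge0// expr2 ger_pMl ?rho_gt0 ?rho_le1//.
      by rewrite s1 andbT; lra.
    have bern : 1 - k%:R * s ^+ 2 <= (1 - s ^+ 2) ^+ k.
      have u0 : 0 <= s ^+ 2 <= 1 by rewrite sqr_ge0 expr_le1// ltW.
      move: (s ^+ 2) u0 => u /andP[u0 u1]; elim: (k) => [|j IH].
        by rewrite mul0r subr0 expr0.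
      rewrite exprS -[j.+1]addn1 natrD.
      have : (1 - u) * (1 - j%:R * u) <= (1 - u) * (1 - u) ^+ j.
        by rewrite ler_wpM2l// subr_ge0.
      have : 0 <= j%:R * (u * u) by rewrite mulr_ge0 ?ler0n// mulr_ge0.
      lra.
    apply: le_trans bern; have : k%:R * s ^+ 2 <= k.+2%:R * s ^+ 2.
      by rewrite ler_wpM2r ?sqr_ge0// ler_nat -addn2 leq_addr.
    rewrite r2 -exprMn [r * s]mulrC sr; lra.
  rewrite (@Rintegral_itv_split _ 0 s 1 _ s01); last exact: continuous_rhoX.
  have h2 : s * (3 / 4) <= \int[mu]_(x in `[0, s]) rho x ^+ k.
    by apply: le_trans h; rewrite ler_pM2l.
  rewrite r2; have : r ^+ 2 * (s * (3 / 4)) <= r ^+ 2 * (\int[mu]_(x in `[0, s]) rho x ^+ k).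
    by rewrite ler_pM2l ?exprn_gt0.
  have -> : r ^+ 2 * (s * (3 / 4)) = 3 / 8 * r.
    by transitivity ((s * r) * r * (3 / 4)); [ring|rewrite sr; field].
  by rewrite mulrDr; have := mulr_ge0 (sqr_ge0 r) h0; lra.
(* The piece over [[0, s]] and, by the integration by parts, the tail each contribute at most
   [r]. *)
pose s := r^-1.
have s0 : 0 < s by rewrite invr_gt0.
have s1 : s < 1 by rewrite invf_lt1.
have s01 : 0 <= s <= 1 by rewrite !ltW.
have /andP[_ h] := Rintegral_rhoX_0s k s01.
have s01' : 0 < s < 1 by rewrite s0.
have /andP[h2 _] := Rintegral_rhoX_bounds k s01'.
have h3 : rho s ^+ k.+2 / s <= r.
  by rewrite /s invrK ler_piMl ?exprn_ile1 ?rho_ge0 ?rho_le1// ltW.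
rewrite (@Rintegral_itv_split _ 0 s 1 _ s01); last exact: continuous_rhoX.
rewrite mulrDr; have : k.+2%:R * \int[mu]_(x in `[0, s]) rho x ^+ k <= k.+2%:R * s.
  by rewrite ler_pM2l ?ltr0n.
have : k.+2%:R * s = r by rewrite r2 /s expr2 mulfK// gt_eqF.
lra.
Qed.

End beta_integral.

(** * Extreme value asymptotics *)

Section extreme_tail.
Context {R : realType}.

Lemma cvg_expR_comp I (F : set_system I) (f : I -> R) (l : R) : Filter F ->
  f x @[x --> F] --> l -> expR (f x) @[x --> F] --> expR l.
Proof. by move=> FF fl; apply: (cvg_comp f _ fl); exact: continuous_expR. Qed.

Lemma cvg_sqrt_comp I (F : set_system I) (f : I -> R) (l : R) : Filter F ->
  f x @[x --> F] --> l -> Num.sqrt (f x) @[x --> F] --> Num.sqrt l.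
Proof. by move=> FF fl; apply: (cvg_comp f _ fl); exact: sqrt_continuous. Qed.

Implicit Types (x u t : R).

(** The upper bound ln (1 + y) <= y at y = - x/(1+x), where 1 + y is the inverse of 1 + x. *)
Lemma ge_ln1Dx x : -1 < x -> x / (1 + x) <= ln (1 + x).
Proof.
move=> x1; have x0 : 0 < 1 + x by lra.
have h : -1 < - (x / (1 + x)).
  by rewrite -subr_gt0 (_ : _ - _ = (1 + x)^-1) ?invr_gt0//; field; rewrite gt_eqF.
have := le_ln1Dx h; have -> : 1 + - (x / (1 + x)) = (1 + x)^-1 by field; rewrite gt_eqF.
by rewrite lnV ?posrE// lerN2.
Qed.

(** The exponent [m n] is real: it will be (d-1)/2. The logarithm is squeezed between u/(1 + u/m)
    and u. *)
Lemma cvg_expR_ln1D (m u : nat -> R) (u0 : R) :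
  m n @[n --> \oo] --> +oo -> u n @[n --> \oo] --> u0 ->
  expR (m n * ln (1 + u n / m n)) @[n --> \oo] --> expR u0.
Proof.
move=> moo uu; apply: cvg_expR_comp.
have mV : (m n)^-1 @[n --> \oo] --> 0 by apply/gtr0_cvgV0 => //; exact: cvgry_gt.
have umV : u n / m n @[n --> \oo] --> 0 by rewrite -[0](mulr0 u0); exact: cvgM.
apply: (@squeeze_cvgr _ _ _ _ (fun n => u n / (1 + u n / m n)) u) => //.
- near=> n; have mn : 0 < m n by near: n; exact: cvgry_gt.
  have un : -1 < u n / m n.
    by near: n; apply: (cvgr_gt 0) => //; lra.
  have mn0 : m n != 0 by rewrite gt_eqF.
  apply/andP; split.
    by have := ge_ln1Dx un; rewrite -(ler_pM2l mn) mulrA [m n * (_ / _)]mulrC mulfVK.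
  by have := le_ln1Dx un; rewrite -(ler_pM2l mn) [m n * (_ / _)]mulrC mulfVK.
- rewrite -[X in _ --> X](divr1 u0) -[X in _ --> u0 / X](addr0 1).
  apply: cvgM => //; apply: cvgV; first by rewrite addr0 oner_neq0.
  by apply: cvgD => //; exact: cvg_cst.
Unshelve. all: by end_near.
Qed.

Lemma cvg_1Ddiv_exprn (m : nat -> nat) (u : nat -> R) (u0 : R) :
  m n @[n --> \oo] --> \oo -> u n @[n --> \oo] --> u0 ->
  (1 + u n / (m n)%:R) ^+ m n @[n --> \oo] --> expR u0.
Proof.
move=> moo uu.
have mR : ((m n)%:R : R) @[n --> \oo] --> +oo by apply/cvgrnyP.
apply: cvg_trans (cvg_expR_ln1D mR uu); apply: near_eq_cvg.
have mV : ((m n)%:R^-1 : R) @[n --> \oo] --> 0.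
  by apply/gtr0_cvgV0 => //; exact: cvgry_gt.
have umV : u n / (m n)%:R @[n --> \oo] --> 0 by rewrite -[0](mulr0 u0); exact: cvgM.
near=> n; have un : -1 < u n / (m n)%:R.
  by near: n; apply: (cvgr_gt 0) => //; lra.
by rewrite mulrC expRM_natr lnK// posrE; lra.
Unshelve. all: by end_near.
Qed.

End extreme_tail.

(** * Bounds for the constants and the cap ratio at fixed p and d *)

Section cap_asymptotics.
Context {R : realType}.
Notation mu := (@lebesgue_measure R).
Local Notation S k s := (\int[mu]_(x in `[s, 1]) rho x ^+ k).

(** The subtraction is truncated, so the formula is the cap probability only for [3 <= d]; this
    holds eventually when [d] grows. Dimension 2 is covered by [cap_prob]. *)
Definition cap_ratio d (t : R) : R := S (d - 3)%N (Num.sqrt t) / S (d - 3)%N 0.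

Section constants.
Variables p d : nat.
Hypotheses (p2 : (2 <= p)%N) (d3 : (3 <= d)%N).

Let N : R := d%:R - 1.
Let l : R := ln p%:R.
Definition p_pow : R := expR (- (2 / (d%:R - 1)) * ln p%:R).
Let q := p_pow.
(** Lies between half of min (2 log p, d-1) and that minimum, by the lemmas below; it is the scale
    against which all errors are measured. *)
Definition gap : R := (d%:R - 1) * (1 - p_pow).
(** The base of the power that defines [c_pd], once the Beta value is replaced by twice the
    integral; it is of the order of the square root of [gap]. *)
Definition weight : R := (d%:R - 1) * S (d - 3)%N 0 * Num.sqrt (1 - p_pow).

Let N2 : 2 <= N.
Proof. by rewrite /N lerBrDr -(natrD _ 2 1) ler_nat. Qed.

Let NE : N = (d - 3).+2%:R.
Proof. by rewrite /N -{1}(subnK d3) natrD -addn2 natrD; ring. Qed.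

Let p0 : 0 < p%:R :> R. Proof. by rewrite ltr0n (leq_trans _ p2). Qed.

Let l0 : 0 < l. Proof. by rewrite ln_gt0// ltr1n. Qed.

Let q01 : 0 < q < 1.
Proof.
rewrite expR_gt0 -expR0 ltr_expR mulNr oppr_lt0 mulr_gt0// divr_gt0//.
by have := N2; rewrite /N; lra.
Qed.

Lemma p_powE : p%:R `^ (- (2 / (d%:R - 1))) = p_pow.
Proof. by rewrite /powR gt_eqF. Qed.

Lemma gap_gt0 : 0 < gap.
Proof. by rewrite mulr_gt0//; [have := N2; rewrite /N|move: q01; rewrite /q]; lra. Qed.

Lemma gap_le : gap <= d%:R - 1.
Proof. by rewrite /gap; have := N2; have := q01; rewrite /q /N; nra. Qed.

Lemma gap_le_ln : gap <= 2 * l.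
Proof.
have : 1 + - (2 / N) * l <= p_pow := expR_ge1Dx _.
rewrite mulNr => h; have : N * (1 - p_pow) <= N * (2 / N * l).
  by rewrite ler_pM2l; [rewrite lerBlDr -lerBlDl|have := N2; lra].
by rewrite !mulrA [N * 2]mulrC mulfK//; have := N2; lra.
Qed.

(** Put v = 2 log p/(d-1). From exp v >= 1 + v follows 1 - exp (- v) >= v/(1+v), and the inverse of
    (d-1) v/(1+v) is exactly the right-hand side. *)
Lemma gapV_le : gap^-1 <= (2 * l)^-1 + (d%:R - 1)^-1.
Proof.
have N0 : 0 < N by have := N2; lra.
have := expR_ge1Dx (2 / N * l); set v := 2 / N * l => h.
have v0 : 0 < v by rewrite mulr_gt0// divr_gt0.
have qE : p_pow = (expR v)^-1 by rewrite -expRN /p_pow -/N -/l /v; congr expR; ring.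
have : p_pow <= (1 + v)^-1 by rewrite qE lef_pV2 ?posrE ?expR_gt0//; lra.
move=> h1; have h2 : N * (v / (1 + v)) <= gap.
  have -> : v / (1 + v) = 1 - (1 + v)^-1 by field; rewrite gt_eqF//; lra.
  by rewrite /gap -/N ler_pM2l//; lra.
have -> : (2 * l)^-1 + N^-1 = (N * (v / (1 + v)))^-1.
  by rewrite /v; field; rewrite !gt_eqF//= addr_gt0// mulr_gt0.
by rewrite lef_pV2 ?posrE ?gap_gt0// mulr_gt0// divr_gt0//; lra.
Qed.

Lemma weight_bounds : 3 / 8 * Num.sqrt gap <= weight <= 2 * Num.sqrt gap.
Proof.
rewrite /weight /gap sqrtrM; last by have := N2; rewrite /N; lra.
rewrite !mulrA -/N NE; have /andP[h1 h2] := @Rintegral_rhoX_sqrt_bounds R (d - 3)%N.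
by rewrite !ler_wpM2r ?sqrtr_ge0.
Qed.

Lemma c_pdE : c_pd p d = weight `^ (2 / (d%:R - 1)).
Proof.
have bE : beta_real (1 / 2) ((d%:R - 1) / 2) = 2 * S (d - 3)%N 0 :> R.
  by rewrite -beta_realE -addn3 subnK.
by rewrite /c_pd p_powE bE /weight; congr (_ `^ _); field.
Qed.

Section weight_large.
Hypotheses (W1 : 1 <= weight).

Lemma c_pd_expR : (c_pd p d : R) = expR (2 / (d%:R - 1) * ln weight).
Proof. by rewrite c_pdE /powR gt_eqF// (lt_le_trans ltr01). Qed.

Lemma a_pdE : (a_pd p d : R) = 1 - expR (- (2 / (d%:R - 1) * (ln p%:R - ln weight))).
Proof.
by rewrite /a_pd p_powE c_pd_expR -expRD; congr (1 - expR _); rewrite -/N -/l; ring.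
Qed.

Lemma b_pdE : (b_pd p d : R) = 2 / (d%:R - 1) * (1 - a_pd p d).
Proof. by rewrite /b_pd /a_pd p_powE subKr mulrA. Qed.

Lemma a_pd_lt1 : (a_pd p d : R) < 1.
Proof. by rewrite a_pdE gtrBl expR_gt0. Qed.

Lemma b_pd_gt0 : 0 < (b_pd p d : R).
Proof.
by rewrite b_pdE mulr_gt0 ?divr_gt0 ?subr_gt0 ?a_pd_lt1//; have := N2; rewrite /N; lra.
Qed.

Lemma expR_sub1_bounds (z : R) : z <= expR z - 1 <= z * expR z.
Proof.
have := expR_ge1Dx z; have := expR_ge1Dx (- z); rewrite expRN => h1 h2.
have := expR_gt0 z => e0; have : expR z * (1 - z) <= 1.
  by rewrite -ler_pdivlMl// mulr1.
lra.
Qed.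

Lemma a_pd_div_b_pd : a_pd p d / b_pd p d =
  (d%:R - 1) / 2 * (expR (2 / (d%:R - 1) * (ln p%:R - ln weight)) - 1).
Proof.
rewrite b_pdE a_pdE expRN; set z := expR _; have z0 : z != 0 by rewrite gt_eqF ?expR_gt0.
have N0 : N != 0 by rewrite gt_eqF//; have := N2; lra.
by rewrite -/N; field; rewrite z0 N0 /= subKr oner_neq0.
Qed.

(** Apply z <= exp z - 1 <= z exp z at z = (2/(d-1)) (log p - ln W), where W is [weight]. Below, ln
    W <= W <= 2 sqrt (2 log p); above, ln W is dropped, being nonnegative. The lower bound does not
    involve [d], so it serves every regime. *)
Lemma a_pd_div_b_pd_bounds : ln p%:R - 2 * Num.sqrt (2 * ln p%:R) <= (a_pd p d / b_pd p d : R) <=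
  ln p%:R * expR (2 / (d%:R - 1) * ln p%:R).
Proof.
have N0 : 0 < N by have := N2; lra.
rewrite a_pd_div_b_pd -/N -/l; have /andP[h1 h2] := expR_sub1_bounds (2 / N * (l - ln weight)).
have lW : 0 <= ln weight by rewrite ln_ge0.
have W0 : 0 < weight by apply: lt_le_trans W1.
have NM z : N / 2 * (2 / N * z) = z by field; rewrite gt_eqF.
have N20 : 0 < N / 2 by rewrite divr_gt0.
apply/andP; split.
  apply: (@le_trans _ _ (l - ln weight)); last by rewrite -[leLHS]NM ler_pM2l.
  rewrite lerB//; apply: le_trans (ltW (ln_sublinear W0)) _.
  have /andP[_ h] := weight_bounds; apply: le_trans h _.
  by rewrite ler_pM2l// ler_wsqrtr// gap_le_ln.
apply: (@le_trans _ _ ((l - ln weight) * expR (2 / N * (l - ln weight)))).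
  by rewrite -[leRHS]NM ler_pM2l// mulrA.
apply: (@le_trans _ _ (l * expR (2 / N * (l - ln weight)))).
  by rewrite ler_pM2r ?expR_gt0//; lra.
by rewrite ler_pM2l// ler_expR ler_pM2l ?divr_gt0//; lra.
Qed.

Hypothesis gapN : 8 * Num.sqrt gap <= d%:R - 1.

(** Here [c_pd] is exp v with v = (2/(d-1)) ln W <= 4 sqrt gap/(d-1). The hypothesis [gapN] makes v
    <= 1/2, hence exp v <= 2 and exp v - 1 <= 2 v. *)
Lemma c_pd_bounds : 1 <= (c_pd p d : R) <= 1 + 8 * Num.sqrt gap / (d%:R - 1).
Proof.
have N0 : 0 < N by have := N2; lra.
have lW : 0 <= ln weight by rewrite ln_ge0.
have W0 : 0 < weight by apply: lt_le_trans W1.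
rewrite c_pd_expR -/N; set v := 2 / N * ln weight.
have v0 : 0 <= v by rewrite mulr_ge0// divr_ge0// ltW.
have vle : v <= 4 * Num.sqrt gap / N.
  have -> : 4 * Num.sqrt gap / N = 2 / N * (2 * Num.sqrt gap) by field; rewrite gt_eqF.
  rewrite ler_pM2l ?divr_gt0//; apply: le_trans (ltW (ln_sublinear W0)) _.
  by have /andP[_] := weight_bounds.
have v2 : v <= 1 / 2 by apply: le_trans vle _; rewrite ler_pdivrMr// -/N; move: gapN; rewrite -/N; lra.
have /andP[h1 h2] := expR_sub1_bounds v.
have h3 : expR v <= 2.
  have := expR_ge1Dx (- v); rewrite expRN => h; have e0 := expR_gt0 v.
  by rewrite -[2]invrK -(invrK (expR v)) lef_pV2 ?posrE ?invr_gt0//; lra.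
apply/andP; split; first by lra.
have : v * expR v <= v * 2 by rewrite ler_wpM2l.
lra.
Qed.

(** With q = [p_pow] and c = [c_pd], the difference is exactly q (2 c x - (d-1)(c-1))/gap, and the
    bounds on c apply. Thus the level is asymptotic to 1 - q as soon as [gap] diverges, even when
    both tend to 0. *)
Lemma a_pdDb_pd_gap (x : R) :
  `|(a_pd p d + b_pd p d * x) / (1 - p_pow) - 1| <= (8 * Num.sqrt gap + 4 * `|x|) / gap.
Proof.
have N0 : 0 < N by have := N2; lra.
have /andP[c1 c2] := c_pd_bounds.
have c3 : (c_pd p d : R) <= 2.
  apply: le_trans c2 _; rewrite -/N -lerBrDl ler_pdivrMr//; move: gapN; rewrite -/N; lra.
have /andP[q0 q1] := q01.
have g0 := gap_gt0.
rewrite /a_pd /b_pd p_powE -/q -/N.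
have -> : (1 - q * c_pd p d + 2 / N * q * c_pd p d * x) / (1 - q) - 1 =
  (q * (c_pd p d * (2 * x) - N * (c_pd p d - 1))) / gap.
  by rewrite /gap -/q -/N; field; rewrite !gt_eqF// subr_gt0.
rewrite normrM [`|gap^-1|]ger0_norm ?invr_ge0 ?(ltW g0)// ler_pM2r ?invr_gt0//.
rewrite normrM ger0_norm ?(ltW q0)//.
apply: (@le_trans _ _ `|c_pd p d * (2 * x) - N * (c_pd p d - 1)|).
  by rewrite ler_piMl// ltW.
rewrite [leRHS]addrC; apply: le_trans (ler_normB _ _) _; apply: lerD.
  rewrite normrM ger0_norm; last by lra.
  rewrite normrM ger0_norm//; have := normr_ge0 x; nra.
rewrite ger0_norm; last by apply: mulr_ge0; [exact: ltW|rewrite subr_ge0].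
rewrite -ler_pdivlMl// mulrC -/N; move: c2; rewrite -/N; lra.
Qed.

(* Here p (1 - t)^((d-1)/2) is computed exactly: c_pd is chosen for that. *)
Lemma cap_ratio_bounds (x : R) (t := a_pd p d + b_pd p d * x)
    (tau := Num.sqrt ((1 - p_pow) / t) * expR ((d%:R - 1) / 2 * ln (1 + - x / ((d%:R - 1) / 2)))) :
  0 < t -> 0 < 1 + - x / ((d%:R - 1) / 2) ->
  tau / (1 + ((d%:R - 1) * t)^-1) <= p%:R * cap_ratio d t <= tau.
Proof.
move=> t0 x0; have N0 : 0 < N by have := N2; lra.
have /andP[q0 q1] := q01.
have W0 : 0 < weight by apply: lt_le_trans W1.
set u := 1 + - x / ((d%:R - 1) / 2) in x0 tau *.
have tE : 1 - t = expR (- (2 / N * (l - ln weight))) * u.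
  rewrite /t b_pdE /u a_pdE -/N -/l; field; rewrite gt_eqF//.
have t1 : t < 1.
  by rewrite -subr_gt0 tE mulr_gt0// expR_gt0.
set s := Num.sqrt t; have s0 : 0 < s by rewrite sqrtr_gt0.
have s2 : s ^+ 2 = t by rewrite sqr_sqrtr// ltW.
have s01 : 0 < s < 1 by rewrite s0/=; nra.
have := Rintegral_rhoX_bounds (d - 3)%N s01; rewrite -NE.
have -> : rho s ^+ (d - 3).+2 = (p%:R)^-1 * weight * expR (N / 2 * ln u).
  have -> : rho s = expR (2^-1 * ln (1 - t)).
    rewrite /rho s2 -powR12_sqrt; last by lra.
    by rewrite /powR gt_eqF ?subr_gt0//.
  rewrite -expRM_natr -NE tE lnM ?posrE ?expR_gt0// expRK.
  rewrite -[(p%:R)^-1]lnK ?posrE ?invr_gt0// -{2}[weight]lnK ?posrE// lnV ?posrE//.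
  rewrite -!expRD -/l; congr expR; field; rewrite gt_eqF//.
set T := S (d - 3)%N s; set S0 := S (d - 3)%N 0.
have S00 : 0 < S0 by apply: Rintegral_rhoX_gt0; rewrite lexx ltr01.
set e := expR (N / 2 * ln u).
have tauE : tau = Num.sqrt (1 - q) / s * e.
  by rewrite /tau -/N -/e -/q sqrtrM ?sqrtrV//; [exact: ltW|lra].
have WE : weight = N * S0 * Num.sqrt (1 - q) by [].
have capE : p%:R * cap_ratio d t = p%:R / (N * S0) * (N * T).
  by rewrite /cap_ratio -/S0 -/s -/T; field; rewrite !gt_eqF.
have DE : p%:R^-1 * weight * e / s = (N * S0) / p%:R * tau.
  by rewrite tauE WE; field; rewrite !gt_eqF.
rewrite DE => /andP[h1 h2].
have pS : 0 < p%:R / (N * S0) by rewrite divr_gt0 ?mulr_gt0.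
have pSV : p%:R / (N * S0) * (N * S0 / p%:R * tau) = tau by field; rewrite !gt_eqF.
apply/andP; split; last first.
  by rewrite capE -[leRHS]pSV ler_pM2l.
have Nt : 0 < N * t by rewrite mulr_gt0.
rewrite ler_pdivrMr; last by rewrite ltr_wpDr ?invr_ge0 ?ltr01// ltW.
rewrite capE -[leLHS]pSV -[leRHS]mulrA ler_pM2l//.
(* The factor (d-1) + 1/t of the upper estimate, divided by d-1, is the denominator 1 + 1/((d-1)
   t). *)
apply: le_trans h2 _; rewrite s2 le_eqVlt; apply/orP; left; apply/eqP.
by rewrite -/N; field; rewrite !gt_eqF.
Qed.

End weight_large.
End constants.
End cap_asymptotics.

(** * Limits along an arbitrary joint sequence *)

Section extreme_limits.
Context {R : realType}.
Variables p d : nat -> nat.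
Hypotheses (poo : p n @[n --> \oo] --> \oo) (doo : d n @[n --> \oo] --> \oo).

Let N n : R := (d n)%:R - 1.
Let l n : R := ln (p n)%:R.
Let g n : R := gap (p n) (d n).
Let w n : R := weight (p n) (d n).
Let in_range n := [/\ (2 <= p n)%N, (3 <= d n)%N, 1 <= w n & 8 * Num.sqrt (g n) <= N n].

Let near_p2 : \forall n \near \oo, (2 <= p n)%N.
Proof. by have /cvgnyPge := poo; exact. Qed.

Let near_d3 : \forall n \near \oo, (3 <= d n)%N.
Proof. by have /cvgnyPge := doo; exact. Qed.

Let Noo : N n @[n --> \oo] --> +oo.
Proof.
have dR : ((d n)%:R : R) @[n --> \oo] --> +oo by apply/cvgrnyP.
apply/cvgryPge => A; near=> n.
by rewrite /N lerBrDr; near: n; exact: cvgry_ge.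
Unshelve. all: by end_near.
Qed.

Lemma cvg_ln_nat : l n @[n --> \oo] --> +oo.
Proof.
have pR : ((p n)%:R : R) @[n --> \oo] --> +oo by apply/cvgrnyP.
apply/cvgryPge => A; near=> n; rewrite -[A]expRK ler_ln ?posrE ?expR_gt0//.
  by near: n; exact: cvgry_ge.
by near: n; exact: cvgry_gt.
Unshelve. all: by end_near.
Qed.

Let cvgryV (f : nat -> R) : f n @[n --> \oo] --> +oo -> (f n)^-1 @[n --> \oo] --> 0.
Proof. by move=> foo; apply/gtr0_cvgV0 => //; exact: cvgry_gt. Qed.

(** The bound on the inverse of [gap] is a sum of two null sequences, whatever the relative speed of
    log p and d. *)
Let goo : g n @[n --> \oo] --> +oo.
Proof.
apply/gtr0_cvgV0; first by near=> n; apply: gap_gt0; near: n.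
apply: (@squeeze_cvgr _ _ _ _ (fun=> 0) (fun n => 2^-1 * (l n)^-1 + (N n)^-1)).
- near=> n; apply/andP; split; first by rewrite invr_ge0 ltW// gap_gt0//; near: n.
  rewrite -invfM; apply: gapV_le; near: n; [exact: near_p2|exact: near_d3].
- exact: cvg_cst.
- have -> : (0 : R) = 2^-1 * 0 + 0 by rewrite mulr0 addr0.
   apply: cvgD; last exact: cvgryV.
  by apply: cvgM; [exact: cvg_cst|apply: cvgryV; exact: cvg_ln_nat].
Unshelve. all: by end_near.
Qed.

Let near_extreme : \forall n \near \oo, in_range n.
Proof.
near=> n.
have p2 : (2 <= p n)%N by near: n.
have d3 : (3 <= d n)%N by near: n.
have g0 : 0 < g n by exact: gap_gt0.
rewrite /in_range; split => //.
  have /andP[h _] := @weight_bounds R (p n) _ d3; apply: le_trans h.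
  (* Then sqrt gap >= 3, and the lower bound (3/8) sqrt gap on [weight] exceeds 1. *)
  have : 9 <= g n by near: n; exact: cvgry_ge.
  rewrite -/(g n) => g9; have : 3 <= Num.sqrt (g n).
    by rewrite -[3]ger0_norm// -sqrtr_sqr ler_wsqrtr//; lra.
  lra.
have gN : g n <= N n by exact: gap_le.
(* As gap <= d-1, one has 8 sqrt gap <= 8 sqrt (d-1), which is at most d-1 once d-1 >= 64. *)
have N64 : 64 <= N n by near: n; exact: cvgry_ge.
have s8 : 8 <= Num.sqrt (N n).
  by rewrite -[8]ger0_norm// -sqrtr_sqr ler_wsqrtr//; lra.
have gs : Num.sqrt (g n) <= Num.sqrt (N n) by exact: ler_wsqrtr.
have : Num.sqrt (N n) ^+ 2 = N n by rewrite sqr_sqrtr//; lra.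
have := sqrtr_ge0 (g n); nra.
Unshelve. all: by end_near.
Qed.

Let t x n : R := a_pd (p n) (d n) + b_pd (p n) (d n) * x.

Let cvg_t_gap x : t x n / (1 - p_pow (p n) (d n)) @[n --> \oo] --> (1 : R).
Proof.
have gV := cvgryV goo.
have gsV : (Num.sqrt (g n))^-1 @[n --> \oo] --> 0.
  apply: cvgryV; apply/cvgryPge => A; near=> n.
  apply: le_trans (ler_norm A) _; rewrite -sqrtr_sqr ler_wsqrtr//.
  by near: n; exact: cvgry_ge.
rewrite -[X in _ --> X]addr0.
suff h : t x n / (1 - p_pow (p n) (d n)) - 1 @[n --> \oo] --> 0.
  rewrite [X in X @ _ --> _](_ : _ = fun n => 1 + (t x n / (1 - p_pow (p n) (d n)) - 1)).
    by apply: cvgD => //; exact: cvg_cst.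
  by apply/funext => n; rewrite addrCA subrr addr0.
apply/norm_cvg0P.
apply: (@squeeze_cvgr _ _ _ _ (fun=> 0) (fun n => 8 * (Num.sqrt (g n))^-1 + 4 * `|x| * (g n)^-1)).
- near=> n; have [p2 d3 W1 gN] : in_range n by near: n; exact: near_extreme.
  rewrite normr_ge0/=; apply: le_trans (a_pdDb_pd_gap p2 d3 W1 gN x) _.
  have g0 : 0 < g n by exact: gap_gt0.
  have s0 : 0 < Num.sqrt (g n) by rewrite sqrtr_gt0.
  rewrite -/(g n) mulrDl lerD2r -mulrA ler_pM2l// -{2}(sqr_sqrtr (ltW g0)).
  by rewrite expr2 invfM mulrA mulfV ?mul1r// gt_eqF.
- exact: cvg_cst.
- have -> : (0 : R) = 8 * 0 + 4 * `|x| * 0 by rewrite !mulr0 addr0.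
  by apply: cvgD; apply: cvgM => //; exact: cvg_cst.
Unshelve. all: by end_near.
Qed.

Let near_q1 : \forall n \near \oo, 0 < 1 - p_pow (p n) (d n) :> R.
Proof.
near=> n; have g0 : 0 < g n by apply: gap_gt0; near: n.
by move: g0; rewrite /g /gap pmulr_rgt0//; near: n; exact: cvgry_gt.
Unshelve. all: by end_near.
Qed.

Let near_u x : \forall n \near \oo, 0 < 1 + - x / (N n / 2).
Proof.
have h : - x / (N n / 2) @[n --> \oo] --> 0.
  rewrite -[0](mulr0 (- x)); apply: cvgM; first exact: cvg_cst.
  rewrite [X in X @ _ --> _](_ : _ = fun n => 2 * (N n)^-1).
    by rewrite -[0](mulr0 2); apply: cvgM; [exact: cvg_cst|exact: cvgryV].
  by apply/funext => n; rewrite invfM invrK mulrC.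
near=> n; have : -1 < - x / (N n / 2) by near: n; apply: (cvgr_gt 0) => //; lra.
lra.
Unshelve. all: by end_near.
Qed.

(** Positivity comes from the ratio to 1 - [p_pow], which tends to 1. For the upper bound, 1 - t
    factors exactly as (1 - a)(1 - 2x/(d-1)). *)
Lemma near_extreme_level x : \forall n \near \oo, 0 < t x n < 1.
Proof.
near=> n.
have [p2 d3 W1 gN] : in_range n by near: n; exact: near_extreme.
have q1 : 0 < 1 - p_pow (p n) (d n) :> R by near: n; exact: near_q1.
apply/andP; split.
  have q0 : 1 - p_pow (p n) (d n) != 0 :> R by rewrite gt_eqF.
  rewrite -(mulfVK q0 (t x n)) mulr_gt0//.
  by near: n; apply: (cvgr_gt _ (cvg_t_gap x)).
rewrite -subr_gt0 /t b_pdE//; have N0 : 0 < N n by near: n; exact: cvgry_gt.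
have -> : 1 - (a_pd (p n) (d n) + 2 / ((d n)%:R - 1) * (1 - a_pd (p n) (d n)) * x) =
  (1 - a_pd (p n) (d n)) * (1 + - x / (N n / 2)) by rewrite -/(N n); field; rewrite gt_eqF.
rewrite mulr_gt0 ?subr_gt0 ?a_pd_lt1//; near: n; exact: near_u.
Unshelve. all: by end_near.
Qed.

Lemma cvg_cap_ratio x : (p n)%:R * cap_ratio (d n) (t x n) @[n --> \oo] --> expR (- x).
Proof.
pose tau n : R := Num.sqrt ((1 - p_pow (p n) (d n)) / t x n) * expR (N n / 2 * ln (1 + - x / (N n / 2))).
have ctau : tau n @[n --> \oo] --> expR (- x).
  rewrite -[X in _ --> X]mul1r; apply: cvgM; last first.
    apply: cvg_expR_ln1D; last exact: cvg_cst.
    by apply/cvgryPge => A; near=> n; rewrite ler_pdivlMr//; near: n; exact: cvgry_ge.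
  rewrite -[X in _ --> X](@sqrtr1 R) -[X in _ --> Num.sqrt X]invr1.
  apply: cvg_sqrt_comp.
  rewrite [X in X @ _ --> _](_ : _ = fun n => (t x n / (1 - p_pow (p n) (d n)))^-1).
    by apply: cvgV => //; exact: oner_neq0.
  by apply/funext => n; rewrite invfM invrK mulrC.
(* The level may itself tend to 0, so this is not clear from d tending to infinity alone: (d-1) t
   equals [gap] times t/(1 - [p_pow]), where the second factor tends to 1. *)
have Nt : (N n * t x n)^-1 @[n --> \oo] --> 0.
  have -> : (0 : R) = 0 * 1^-1 by rewrite mul0r.
  apply: cvg_trans (cvgM (cvgryV goo) (cvgV (oner_neq0 R) (cvg_t_gap x))).
  apply: near_eq_cvg; near=> n.
  have q1 : 0 < 1 - p_pow (p n) (d n) :> R by near: n; exact: near_q1.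
  have N0 : 0 < N n by near: n; exact: cvgry_gt.
  have /andP[t0 _] : 0 < t x n < 1 by near: n; exact: near_extreme_level.
  by rewrite /= /g /gap -/(N n); field; rewrite !gt_eqF.
apply: (@squeeze_cvgr _ _ _ _ (fun n => tau n / (1 + (N n * t x n)^-1)) tau) => //.
- near=> n.
  have [p2 d3 W1 gN] : in_range n by near: n; exact: near_extreme.
  apply: cap_ratio_bounds => //; last by near: n; exact: near_u.
  suff /andP[] : 0 < t x n < 1 by [].
  by near: n; exact: near_extreme_level.
- have -> : expR (- x) = expR (- x) / (1 + 0) by rewrite addr0 divr1.
  apply: cvgM => //; apply: cvgV; first by rewrite addr0 oner_neq0.
  by apply: cvgD => //; exact: cvg_cst.
Unshelve. all: by end_near.
Qed.

Lemma cvg_max_cdf x :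
  (1 - cap_ratio (d n) (t x n)) ^+ p n @[n --> \oo] --> gumbel_cdf x.
Proof.
have h : - ((p n)%:R * cap_ratio (d n) (t x n)) @[n --> \oo] --> - expR (- x).
  by apply: cvgN; exact: cvg_cap_ratio.
rewrite /gumbel_cdf; apply: cvg_trans (cvg_1Ddiv_exprn poo h).
apply: near_eq_cvg; near=> n; congr (_ ^+ _); congr (1 + _).
have p0 : (p n)%:R != 0 :> R.
  by rewrite pnatr_eq0 -lt0n (leq_trans _ (near near_p2 n _)).
by field.
Unshelve. all: by end_near.
Qed.

Lemma near_a_pd_div_b_pd : \forall n \near \oo, l n / 2 <= a_pd (p n) (d n) / b_pd (p n) (d n).
Proof.
near=> n.
have [p2 d3 W1 gN] : in_range n by near: n; exact: near_extreme.
have /andP[h _] := a_pd_div_b_pd_bounds p2 d3 W1; apply: le_trans h.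
(* For s = sqrt (2 log p), the inequality log p - 2 s >= (log p)/2 means s >= 8, that is log p >=
   32. *)
have : 32 <= l n by near: n; apply: cvgry_ge; exact: cvg_ln_nat.
rewrite -/(l n) => l32; set s := Num.sqrt _.
have s2 : s ^+ 2 = 2 * l n by rewrite sqr_sqrtr//; lra.
have s0 : 0 <= s by exact: sqrtr_ge0.
have : 8 <= s by rewrite -[8]ger0_norm// -sqrtr_sqr ler_wsqrtr//; lra.
nra.
Unshelve. all: by end_near.
Qed.

Lemma near_a_pd_b_pd_gt0 : \forall n \near \oo,
  0 < (a_pd (p n) (d n) : R) /\ 0 < (b_pd (p n) (d n) : R).
Proof.
near=> n.
have [p2 d3 W1 gN] : in_range n by near: n; exact: near_extreme.
split; last exact: b_pd_gt0.
suff /andP[] : 0 < t 0 n < 1 by rewrite /t mulr0 addr0.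
by near: n; exact: near_extreme_level.
Unshelve. all: by end_near.
Qed.

Lemma cvg_b_pd_div_a_pd : (b_pd (p n) (d n) / a_pd (p n) (d n) : R) @[n --> \oo] --> 0.
Proof.
rewrite [X in X @ _ --> _](_ : _ = fun n => (a_pd (p n) (d n) / b_pd (p n) (d n))^-1).
  apply: cvgryV; apply/cvgryPge => A; near=> n.
  apply: (@le_trans _ _ (l n / 2)); last by near: n; exact: near_a_pd_div_b_pd.
  by rewrite ler_pdivlMr//; near: n; apply: cvgry_ge; exact: cvg_ln_nat.
by apply/funext => n; rewrite invfM invrK mulrC.
Unshelve. all: by end_near.
Qed.

(** The two finite bounds on a/b, divided by log p, become 1 - 4/sqrt (2 log p) and exp (2 log
    p/(d-1)); the hypothesis makes the second tend to 1. *)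
Lemma cvg_a_pd_div_b_pd_ln : (l n / (d n)%:R) @[n --> \oo] --> 0 ->
  (a_pd (p n) (d n) / b_pd (p n) (d n) / l n) @[n --> \oo] --> (1 : R).
Proof.
move=> ld.
have lN : 2 / N n * l n @[n --> \oo] --> 0.
  have dN : 2 / ((d n)%:R * (1 - (d n)%:R^-1)) * (d n)%:R @[n --> \oo] --> (2 / (1 - 0) : R).
    have dR : ((d n)%:R : R) @[n --> \oo] --> +oo by apply/cvgrnyP.
    have dV : (2 / (1 - (d n)%:R^-1) : R) @[n --> \oo] --> (2 / (1 - 0) : R).
      apply: cvgM; first exact: cvg_cst.
      apply: cvgV; first by rewrite subr0 oner_neq0.
      by apply: cvgB; [exact: cvg_cst|exact: cvgryV].
    apply: cvg_trans dV; apply: near_eq_cvg; near=> n.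
    have d0 : (d n)%:R != 0 :> R by rewrite pnatr_eq0 -lt0n (leq_trans _ (near near_d3 n _)).
    by rewrite invfM mulrA [_ / _ * (1 - _)^-1]mulrAC mulfVK.
  rewrite -[0](mulr0 (2 / (1 - 0))); apply: cvg_trans (cvgM dN ld).
  apply: near_eq_cvg; near=> n.
  have d0 : (d n)%:R != 0 :> R by rewrite pnatr_eq0 -lt0n (leq_trans _ (near near_d3 n _)).
  rewrite /=; have -> : (d n)%:R * (1 - (d n)%:R^-1) = N n :> R by rewrite mulrBr mulr1 mulfV.
  by move: (2 / N n) => z; field.
have lV := cvgryV cvg_ln_nat.
have sV : (Num.sqrt (2 * l n))^-1 @[n --> \oo] --> 0.
  apply: cvgryV; apply/cvgryPge => A; near=> n.
  apply: le_trans (ler_norm A) _; rewrite -sqrtr_sqr ler_wsqrtr//.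
  by rewrite -ler_pdivrMl//; near: n; apply: cvgry_ge; exact: cvg_ln_nat.
apply: (@squeeze_cvgr _ _ _ _ (fun n => 1 - 4 * (Num.sqrt (2 * l n))^-1) (fun n => expR (2 / N n * l n))).
- near=> n.
  have [p2 d3 W1 gN] : in_range n by near: n; exact: near_extreme.
  have l0 : 0 < l n by near: n; apply: cvgry_gt; exact: cvg_ln_nat.
  rewrite ler_pdivlMr// ler_pdivrMr// [expR _ * _]mulrC.
  have -> : (1 - 4 * (Num.sqrt (2 * l n))^-1) * l n = l n - 2 * Num.sqrt (2 * l n).
    have s0 : Num.sqrt (2 * l n) != 0 by rewrite gt_eqF// sqrtr_gt0 mulr_gt0.
    rewrite mulrBl mul1r; congr (_ - _).
    have : l n = Num.sqrt (2 * l n) ^+ 2 / 2 by rewrite sqr_sqrtr ?mulr_ge0 ?(ltW l0)//; field.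
    by move: s0; move: (Num.sqrt _) => s s0 ->; field.
  exact: a_pd_div_b_pd_bounds.
- rewrite [X in _ --> X](_ : _ = 1 - 4 * 0); last by rewrite mulr0 subr0.
  apply: cvgB; first exact: cvg_cst.
  by apply: cvgM; [exact: cvg_cst|exact: sV].
- rewrite -[X in _ --> X](@expR0 R).
  exact: cvg_expR_comp.
Unshelve. all: by end_near.
Qed.

End extreme_limits.

(** * Independence of the radius and the maximum *)

Section conditional_independence.
Context {R : realType} d d1 d2 (T : measurableType d) (T1 : measurableType d1)
  (T2 : measurableType d2) (P : probability T R).
Local Open Scope ereal_scope.

Lemma measurable_preimage_mfun d3 (T3 : measurableType d3) (X : {mfun T >-> T3}) (A : set T3) :
  measurable A -> measurable (X @^-1` A).
Proof. by move=> mA; rewrite -[X in measurable X]setTI; exact: measurable_funPT. Qed.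

(** By uniqueness of product measures, the law of [(X, Y)] restricted to [D] is [c] times the
    product of the two laws. Fubini then integrates the sections of [E], all of the same probability
    [g]. *)
Lemma independent_section (X : {mfun T >-> T1}) (Y : {mfun T >-> T2}) (D : set T) (c g : R)
    (B : set T1) (E : set (T1 * T2)) :
  (0 <= c)%R -> measurable D -> measurable B -> measurable E ->
  (forall A' B', measurable A' -> measurable B' ->
    P (D `&` (X @^-1` A' `&` Y @^-1` B')) = c%:E * (P (X @^-1` A') * P (Y @^-1` B'))) ->
  (forall x, P (Y @^-1` xsection E x) = g%:E) ->
  P (D `&` (X @^-1` B `&` [set w | E (X w, Y w)])) = (c * g)%:E * P (X @^-1` B).
Proof.
move=> c0 mD mB mE H gE.
have mXY : measurable_fun [set: T] (fun w => (X w, Y w)).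
  by apply: measurable_fun_pair; exact: measurable_funPT.
have mXYE : measurable [set w | E (X w, Y w)].
  by rewrite -[Z in measurable Z]setTI; apply: mXY.
have mXB := measurable_preimage_mfun X mB.
(* For [c = 0] the event [D] is null; otherwise the restriction to [D] is divided by [c] before it
   is compared with the product. *)
have [c1|c1] := eqVneq c 0%R.
  rewrite c1 mul0r mul0e; apply/eqP; rewrite eq_le measure_ge0 andbT.
  have := H _ _ (@measurableT _ T1) (@measurableT _ T2).
  rewrite c1 mul0e !preimage_setT !setIT => <-.
  by rewrite le_measure ?inE//; apply: measurableI => //; apply: measurableI.
have ic0 : (0 <= c^-1)%R by rewrite invr_ge0.
pose f w : T1 * T2 := (X w, Y w).
pose nu_ : {measure set (T1 * T2) -> \bar R} :=
  mscale (NngNum ic0) (pushforward (mrestr P mD) f).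
pose nu := nu_ mXY.
pose F := E `&` (B `*` setT).
have mF : measurable F by apply: measurableI => //; exact: measurableX.
have nuE G : nu G = (c^-1)%:E * P (f @^-1` G `&` D) by [].
have prodE : (distribution P X \x distribution P Y) F = nu F.
  apply: product_measure_unique => // A' B' mA' mB'; rewrite nuE setIC.
  rewrite (_ : f @^-1` _ = X @^-1` A' `&` Y @^-1` B')//.
  by rewrite H// muleA -EFinM mulVf// mul1e.
have -> : D `&` (X @^-1` B `&` [set w | E (X w, Y w)]) = f @^-1` F `&` D.
  by apply/seteqP; split => w; rewrite /F /f /=; [move=> [? [? ?]]|move=> [[? [? _]] ?]].
have -> : P (f @^-1` F `&` D) = c%:E * nu F.
  by rewrite nuE muleA -EFinM mulfV// mul1e.
rewrite -prodE EFinM -muleA; congr (_ * _).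
transitivity (\int[distribution P X]_(x in B) g%:E); last by rewrite integral_cst.
rewrite [RHS]integral_mkcond; apply: eq_integral => x _; rewrite patchE /=.
case: ifPn => [/set_mem xB|/negP].
  rewrite -(gE x); congr (P _); apply/seteqP; split => w; rewrite /= !xsectionE/F/=.
    by case.
  by move=> ?; split.
rewrite inE => xB; rewrite (_ : xsection F x = set0) ?measure0//.
by rewrite -subset0 => y; rewrite xsectionE /F /= => -[_ []].
Qed.

(** A replacement argument: the events on single variables [Y i] are exchanged one at a time for the
    joint events with [X], each exchange producing one factor [g]. No conditional law is
    constructed. *)
Lemma conditionally_independent_all p (X : {mfun T >-> T1}) (Y : 'I_p -> {mfun T >-> T2})
    (g : R) (B : set T1) (E : set (T1 * T2)) : (0 <= g)%R ->
  measurable B -> measurable E ->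
  (forall (A : 'I_p -> set T2) B', (forall i, measurable (A i)) -> measurable B' ->
    P (X @^-1` B' `&` [set w | forall i, A i (Y i w)]) =
    P (X @^-1` B') * \prod_(i < p) P (Y i @^-1` A i)) ->
  (forall i x, P (Y i @^-1` xsection E x) = g%:E) ->
  P (X @^-1` B `&` [set w | forall i, E (X w, Y i w)]) = (g ^+ p)%:E * P (X @^-1` B).
Proof.
move=> g0 mB mE indep gE.
have mYE i : measurable [set w | E (X w, Y i w)].
  rewrite -[Z in measurable Z]setTI.
  by apply: (measurable_fun_pair (measurable_funPT X) (measurable_funPT (Y i))).
(* The hybrid family: the first [k] indices already carry the joint event, the others still an
   arbitrary test set. Keeping the test sets arbitrary is what makes the induction work. *)
pose S k (A : 'I_p -> set T2) (i : 'I_p) : set T :=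
  if (i < k)%N then [set w | E (X w, Y i w)] else Y i @^-1` A i.
have mS k A i : (forall i, measurable (A i)) -> measurable (S k A i).
  by move=> mA; rewrite /S; case: ifP => _ //; exact: measurable_preimage_mfun.
have fin (k : nat) (A : 'I_p -> set T2) : (forall i, measurable (A i)) ->
    exists2 c : R, (0 <= c)%R & \prod_(i < p | (k <= i)%N) P (Y i @^-1` A i) = c%:E.
  move=> mA; apply: (big_ind (fun x => exists2 c : R, (0 <= c)%R & x = c%:E)).
  - by exists 1%R.
  - by move=> _ _ [x x0 ->] [y y0 ->]; exists (x * y)%R => //; exact: mulr_ge0.
  - move=> i _; exists (fine (P (Y i @^-1` A i))); first exact: fine_ge0.
    by rewrite fineK// fin_num_measure//; exact: measurable_preimage_mfun.
have main k (A : 'I_p -> set T2) B' : (k <= p)%N -> (forall i, measurable (A i)) -> measurable B' ->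
    P (X @^-1` B' `&` [set w | forall i, S k A i w]) =
    (g ^+ k)%:E * (P (X @^-1` B') * \prod_(i < p | (k <= i)%N) P (Y i @^-1` A i)).
  elim: k A B' => [|k IH] A B' kp mA mB'; first by rewrite expr0 mul1e -indep.
  pose i0 : 'I_p := Ordinal kp.
  pose A0 Ai i := if i == i0 then Ai else A i.
  have mA0 Ai : measurable Ai -> forall i, measurable (A0 Ai i).
    by move=> mAi i; rewrite /A0; case: ifP.
  (* All constraints except that of index [k]. The induction hypothesis, with every test set in that
     position, is the product rule that [independent_section] requires. *)
  pose D := \bigcap_(i in [set i | i != i0]) S k A i.
  have mD : measurable D.
    by apply: fin_bigcap_measurable => [|i _]; [exact: finite_finset|exact: mS].
  have [c c0 cE] := fin k.+1 A mA.
  have prodE Ai : \prod_(i < p | (k <= i)%N) P (Y i @^-1` A0 Ai i) = P (Y i0 @^-1` Ai) * c%:E.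
    rewrite (bigD1 i0)//= {1}/A0 eqxx -cE; congr (_ * _).
    apply: eq_big => i; first by rewrite ltn_neqAle andbC eq_sym.
    by rewrite /A0 => /andP[_ /negbTE ->].
  have SE Ai : [set w | forall i, S k (A0 Ai) i w] = D `&` Y i0 @^-1` Ai.
    apply/seteqP; split => w.
      move=> h; split.
        by move=> i /= ii0; move: (h i); rewrite /S /A0 (negbTE ii0).
      by move: (h i0); rewrite /S /A0 eqxx/= ltnn.
    move=> [h1 h2] i; have [->|ii0] := eqVneq i i0.
      by rewrite /S /A0 eqxx/= ltnn.
    by move: (h1 i ii0); rewrite /S /A0 (negbTE ii0).
  have SE' : [set w | forall i, S k.+1 A i w] = D `&` [set w | E (X w, Y i0 w)].
    apply/seteqP; split => w.
      move=> h; split.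
        move=> i /= ii0; move: (h i); rewrite /S ltnS leq_eqVlt.
        by rewrite (_ : (nat_of_ord i == k) = false)//; exact/negbTE.
      by move: (h i0); rewrite /S /= ltnSn.
    move=> [h1 h2] i; have [->|ii0] := eqVneq i i0; first by rewrite /S /= ltnSn.
    move: (h1 i ii0); rewrite /S ltnS [(i <= k)%N]leq_eqVlt.
    by rewrite (_ : (nat_of_ord i == k) = false)//; exact/negbTE.
  have cg0 : (0 <= g ^+ k * c)%R by rewrite mulr_ge0// exprn_ge0.
  rewrite SE' setICA (@independent_section X (Y i0) D _ g _ _ cg0)//; last first.
    move=> Bx Ay mBx mAy.
    have := IH (A0 Ay) Bx (ltnW kp) (mA0 _ mAy) mBx.
    rewrite SE prodE setICA => ->; rewrite EFinM -muleA; congr (_ * _).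
    by rewrite [_ * c%:E]muleC muleCA.
  rewrite cE exprSr !EFinM -!muleA; congr (_ * _).
  by rewrite muleCA; congr (_ * _); rewrite muleC.
have := main p (fun=> setT) B (leqnn p) (fun=> measurableT) mB.
rewrite big_pred0; last by move=> i; rewrite leqNgt ltn_ord.
rewrite mule1 => <-; congr (P (_ `&` _)).
by apply/funext => w; apply/propext; split => h i; move: (h i); rewrite /S ltn_ord.
Qed.

End conditional_independence.

Lemma measurable_inv (R : realType) : measurable_fun [set: R] (fun x : R => x^-1).
Proof.
have -> : [set: R] = [set 0] `|` ~` [set 0] by rewrite setUv.
apply/measurable_funU => //; first exact: measurableC.
split; first exact: measurable_fun_set1.
apply: open_continuous_measurable_fun; first exact: closed_openC.
by move=> x; rewrite inE /= => /eqP x0; apply: cvgV.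
Qed.

Lemma measurable_bigmax (R : realType) dT (T : measurableType dT) p (f : 'I_p -> T -> R) :
  (forall j, measurable_fun [set: T] (f j)) ->
  measurable_fun [set: T] (fun w => \big[Num.max/0]_(j < p) f j w).
Proof.
move=> mf; elim: (index_enum _) => [|j s IH].
  by under eq_fun do rewrite big_nil; exact: measurable_cst.
by under eq_fun do rewrite big_cons; exact: measurable_maxr.
Qed.

(** * The direction of Z and the maximum over directions *)

Section direction.
Context {R : realType} {n : nat}.
Notation lam := (tuple_measure (@lebesgue_measure R)).
Implicit Types z u : n.+1.-tuple R.

Definition pole : n.+1.-tuple R := [tuple (i == ord0)%:R | i < n.+1].

(** The default [pole] at the origin makes [dir z] a unit vector for every [z]; hence the
    factorisation of K holds everywhere and every section below has the same cap probability. *)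
Definition dir z := if dotp z z == 0 then pole else scalet (enorm z)^-1 z.

Lemma dotp_dir z : dotp (dir z) (dir z) = 1.
Proof.
rewrite /dir; case: eqVneq => [z0|z0].
  rewrite /dotp (bigD1 ord0)//= big1 ?addr0 ?tnth_mktuple ?eqxx ?mulr1// => i i0.
  by rewrite tnth_mktuple (negbTE i0) mulr0.
have e0 : enorm z != 0 by move: z0; rewrite -sqr_enorm sqrf_eq0.
by rewrite !dotpE -sqr_enorm; field.
Qed.

Lemma sqr_dotp_dir u z : dotp u z ^+ 2 = enorm z ^+ 2 * dotp u (dir z) ^+ 2.
Proof.
rewrite /dir; case: eqVneq => [z0|z0].
  by rewrite sqr_enorm z0 dotpC (dotp0_eq _ z0) expr0n mul0r.
have e0 : enorm z != 0 by move: z0; rewrite -sqr_enorm sqrf_eq0.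
by rewrite !dotpE; field.
Qed.

Lemma measurable_dir : measurable_fun [set: n.+1.-tuple R] dir.
Proof.
have mz : measurable [set z : n.+1.-tuple R | dotp z z == 0].
  rewrite (_ : [set z | _] = [set z | dotp z z <= 0]).
    by apply: measurable_set_le => //; exact: measurable_dotp.
  by apply/seteqP; split => z /=; [move=> /eqP ->|rewrite eq_le dotp_ge0 andbT].
apply: measurable_fun_ifT => //.
  apply: (measurable_fun_bool true); rewrite setTI.
  by rewrite (_ : _ @^-1` _ = [set z | dotp z z == 0]).
apply: measurable_mktuple => i; apply: measurable_funM; last exact: measurable_tnth.
apply: (measurableT_comp (f := fun x : R => x^-1)); first exact: measurable_inv.
exact: measurable_enorm.
Qed.

Definition maxdir p (l : 'I_p -> n.+1.-tuple R) z : R := \big[Num.max/0]_(j < p) dotp (l j) (dir z) ^+ 2.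

Lemma K_pdE p (l : 'I_p -> n.+1.-tuple R) z : K_pd l z = enorm z ^+ 2 * maxdir l z.
Proof.
rewrite /K_pd /maxdir; apply: (big_ind2 (fun x y => x = enorm z ^+ 2 * y)).
- by rewrite mulr0.
- move=> _ x _ y -> ->; by rewrite maxr_pMr// sqr_ge0.
- move=> j _; rewrite real_normK ?num_real//; exact: sqr_dotp_dir.
Qed.

Lemma maxdir_le p (l : 'I_p -> n.+1.-tuple R) z t : 0 <= t ->
  (maxdir l z <= t) <-> (forall j, dotp (l j) (dir z) ^+ 2 <= t).
Proof.
move=> t0; rewrite /maxdir; split => [h j|h].
  by apply: le_trans h; exact: (le_bigmax _ (fun j => dotp (l j) (dir z) ^+ 2)).
by apply/bigmax_leP; split.
Qed.

Lemma maxdir_ge0 p (l : 'I_p -> n.+1.-tuple R) z : 0 <= maxdir l z.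
Proof. by apply: bigmax_ge_id. Qed.

(** The cap probability as a ratio of volumes, available in every positive dimension, including
    dimension 2, where [cap_ratio] does not apply. *)
Definition cap_prob (t : R) : R := fine (lam n.+1 (@cone R n t)) / fine (lam n.+1 (tball 1)).

End direction.

Section max_direction.
Context {R : realType} dT (T : measurableType dT) (P : probability T R) (p n : nat).
Variables (L : 'I_p -> {RV P >-> n.+1.-tuple R}) (Z : {RV P >-> n.+1.-tuple R}).
Hypothesis LZ : uniform_sample L Z.

Definition maxdir_rv (w : T) : R := maxdir (fun j => L j w) (Z w).

Lemma measurable_maxdir_rv : measurable_fun [set: T] maxdir_rv.
Proof.
apply: measurable_bigmax => j; apply: measurable_funX; apply: measurable_dotp => //.
exact: (measurableT_comp measurable_dir).
Qed.

Lemma uniform_sample_indep (A : 'I_p -> set (n.+1.-tuple R)) B :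
  (forall i, measurable (A i)) -> measurable B ->
  P (Z @^-1` B `&` [set w | forall i, A i (L i w)]) =
  (P (Z @^-1` B) * \prod_(i < p) P (L i @^-1` A i))%E.
Proof.
move=> mA mB; have [_] := LZ.
move=> /(_ (fun o : option 'I_p => if o is Some j then A j else B)) H.
have <- : P (\bigcap_(i in [set: option 'I_p]) ((if i is Some j then L j : T -> _ else Z) @^-1`
    (if i is Some j then A j else B))) = P (Z @^-1` B `&` [set w | forall i, A i (L i w)]).
  congr (P _); apply/seteqP; split => w.
    move=> h; split; first exact: (h None I).
    by move=> i; exact: (h (Some i) I).
  by move=> [h1 h2] [i|] _ //; exact: h2.
rewrite H; last by case.
rewrite (bigD1 None)//=; congr (_ * _)%E.
rewrite (reindex_omap Some id)/=; last by case.
by apply: eq_bigl => i; rewrite eqxx.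
Qed.

(** The replacement argument with [X := Z] and [Y i := L i]: for each fixed [z] the section is the
    complement of a pair of caps around [dir z], whose probability does not depend on [z]. *)
Lemma max_direction_law (t : R) (B : set R) : 0 <= t -> measurable B ->
  P ([set w | maxdir_rv w <= t] `&` [set w | B (enorm (Z w))]) =
  (((1 - @cap_prob R n t) ^+ p)%:E * P [set w | B (enorm (Z w))])%E.
Proof.
(* Below, nonnegativity of 1 - [cap_prob] is read off a section of some [L i], which needs an index.
   For [p = 0] the maximum is its initial value 0. *)
have [p0|p0] := posnP p.
  move=> t0 mB; have -> : [set w | maxdir_rv w <= t] = setT.
    apply/seteqP; split => w //= _; apply/(maxdir_le _ _ t0) => j.
    by have := ltn_ord j; rewrite {2}p0.
  by rewrite setTI p0 expr0 mul1e.
move=> t0 mB; pose C : set (n.+1.-tuple R) := @enorm R n.+1 @^-1` B.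
have mC : measurable C.
  by rewrite -[X in measurable X]setTI; exact: (measurable_enorm (@measurable_id _ _ _)).
pose E := [set zu : n.+1.-tuple R * n.+1.-tuple R | dotp zu.2 (dir zu.1) ^+ 2 <= t].
have mdot : measurable_fun [set: n.+1.-tuple R * n.+1.-tuple R]
    (fun zu => dotp zu.2 (dir zu.1) ^+ 2).
  apply: measurable_funX; apply: measurable_dotp => //.
  by apply: (measurableT_comp measurable_dir).
have mE : measurable E by apply: measurable_set_le.
have secE i z : P (L i @^-1` xsection E z) = (1 - @cap_prob R n t)%:E.
  have mdz : measurable_fun [set: n.+1.-tuple R] (fun u => dotp u (dir z) ^+ 2).
    by apply: measurable_funX; apply: measurable_dotp.
  have mlt : measurable [set u : n.+1.-tuple R | t < dotp u (dir z) ^+ 2].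
    exact: measurable_set_lt.
  have -> : xsection E z = ~` [set u | t < dotp u (dir z) ^+ 2].
    apply/seteqP; split => u; rewrite xsectionE /E /= leNgt => /negP //.
  rewrite preimage_setC probability_setC; last exact: (measurable_preimage_mfun (L i) mlt).
  have [LU _] := LZ; have := LU i _ mlt; rewrite /distribution /pushforward => ->.
  by rewrite (sphere_law_cap _ (dotp_dir z)) EFinB.
have g0 : 0 <= 1 - @cap_prob R n t.
  by rewrite -lee_fin -(secE (Ordinal p0) pole) measure_ge0.
have := @conditionally_independent_all _ _ _ _ _ _ _ P p Z L _ C E g0 mC mE
  (@uniform_sample_indep) secE.
rewrite setIC => <-; congr (P (_ `&` _)); apply/funext => w; apply/propext.
by rewrite /= maxdir_le.
Qed.

End max_direction.

Section cap_prob.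
Context {R : realType}.
Notation mu := (@lebesgue_measure R).

Lemma cap_prob1 n : @cap_prob R n 1 = 0.
Proof.
rewrite /cap_prob (_ : cone 1 = set0) ?measure0 ?mul0r//.
rewrite -subset0 => z [_]; rewrite mul1r ltNge => /negP; apply.
by rewrite /dotp big_ord_recl -expr2 lerDl sumr_ge0// => i _; rewrite -expr2 sqr_ge0.
Qed.

Lemma cap_prob_ratio d (t : R) : 0 < t < 1 -> (3 <= d.+1)%N -> @cap_prob R d t = cap_ratio d.+1 t.
Proof.
move=> t01; case: d => [//|[//|k]] _.
have := sphere_law_cap_ratio t01 (dotp_dir (@pole R k.+2)).
rewrite (sphere_law_cap _ (dotp_dir _)) => -[]; rewrite /cap_prob => ->.
by rewrite /cap_ratio !subSS subn0.
Qed.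

(** Obtained from the slices directly, so that dimension 2 is included; the fixed-dimension case
    rests on it. *)
Lemma cap_prob_gt0 n (t : R) : 0 < t < 1 -> 0 < @cap_prob R n.+1 t.
Proof.
move=> t01; rewrite /cap_prob lebesgue_tuple_cone//.
have /andP[B0 By] := @lebesgue_tuple_tball1 R n.+1.
have /andP[B0' By'] := @lebesgue_tuple_tball1 R n.+2.
have /andP[t0 t1] := t01.
have m1 : measurable_fun [set: R] (EFin \o cap_profile n.+1 t).
  by apply/measurable_EFinP; exact: measurable_cap_profile.
have cap0 x : 0 <= cap_profile n.+1 t x by rewrite exprn_ge0.
have u0 : 0 < (1 - t) / (16 * t) by rewrite divr_gt0 ?subr_gt0 ?mulr_gt0.
(* A lower bound for both squared radii on [[1 / 4, 1 / 2]]: there x^2 >= 1/16 and 1 - x^2 >=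
   3/4. *)
pose v := Num.min ((1 - t) / (16 * t)) (1 / 2).
have v0 : 0 < v by rewrite lt_min u0; lra.
have Ige : (((Num.sqrt v ^+ n.+1) * (1 / 2 - 1 / 4))%:E <=
    \int[mu]_(x in `[(-1)%R, 1%R]) (cap_profile n.+1 t x)%:E)%E.
  apply: (@le_trans _ _ (\int[mu]_(x in `[(1 / 4)%R, (1 / 2)%R]) (cap_profile n.+1 t x)%:E)%E).
    apply: (@le_trans _ _ (\int[mu]_(x in `[(1 / 4)%R, (1 / 2)%R]) (Num.sqrt v ^+ n.+1)%:E)%E).
      rewrite integral_cst//= lebesgue_measure_itv/= lte_fin ifT; last by lra.
      by rewrite -EFinB -EFinM.
    apply: ge0_le_integral => //.
    - exact: measurable_funTS.
    - move=> x /=; rewrite in_itv/= => /andP[x1 x2]; rewrite lee_fin.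
      rewrite lerXn2r ?nnegrE ?sqrtr_ge0// ler_wsqrtr// le_min; apply/andP; split.
        rewrite ge_min; apply/orP; left; rewrite ler_pdivrMr ?mulr_gt0//.
        have -> : x ^+ 2 * (1 - t) / t * (16 * t) = (16 * x ^+ 2) * (1 - t).
          by field; rewrite gt_eqF.
        rewrite ler_peMl ?subr_ge0 ?(ltW t1)//; nra.
      by rewrite ge_min; apply/orP; right; nra.
  apply: ge0_subset_integral => //=; first exact: measurable_funTS.
    by move=> x _; rewrite lee_fin.
  by move=> x /=; rewrite !in_itv/=; lra.
have Ilt : (\int[mu]_(x in `[(-1)%R, 1%R]) (cap_profile n.+1 t x)%:E < +oo)%E.
  apply: le_lt_trans (integral_sqrt_pow_lty n.+1).
  apply: ge0_le_integral => //.
  - by move=> x _; rewrite lee_fin cap0.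
  - exact: measurable_funTS.
  - by apply/measurable_EFinP/measurable_funTS; apply: measurable_sqrt_pow; exact: measurable_1Bsqr.
  - move=> x _; rewrite lee_fin lerXn2r ?nnegrE ?sqrtr_ge0// ler_wsqrtr//.
    by rewrite ge_min lexx orbT.
have Ipos : (0 < \int[mu]_(x in `[(-1)%R, 1%R]) (cap_profile n.+1 t x)%:E)%E.
  apply: lt_le_trans Ige; rewrite lte_fin mulr_gt0 ?exprn_gt0 ?sqrtr_gt0//; lra.
rewrite divr_gt0//; last by rewrite fine_gt0// B0'.
rewrite fine_gt0//; apply/andP; split; first exact: mule_gt0.
by rewrite lte_mul_pinfty// ?ge0_fin_numE ?ltW.
Qed.

End cap_prob.

(** * Weak convergence *)

Section monotone_continuity.
Context {R : realType}.

(** The discontinuities of a monotone function are countable, hence null, and cannot fill []a, b[].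
    With right continuity, the absence of a jump is continuity. *)
Lemma nondecreasing_continuity_point (F : R -> R) (a b : R) : a < b ->
  {homo F : x y / x <= y} -> (forall x, F y @[y --> x^'+] --> F x) ->
  exists2 x, a < x < b & {for x, continuous F}.
Proof.
move=> ab ndF rF.
have ndab : {in `[a, b]%R &, {homo F : x y / x <= y}} by move=> x y _ _; exact: ndF.
have [x [xab xF]] : exists x : R, a < x < b /\ ~ discontinuity F x.
  apply: contrapT => h.
  have D0 := countable_lebesgue_measure0 (discontinuity_countable ndab).
  have : lebesgue_measure `]a, b[%classic = 0%E :> \bar R.
    rewrite -[RHS]D0; congr lebesgue_measure; apply/seteqP; split => x /=; rewrite in_itv/=; last by case.
    by move=> xab; split => //; apply: contrapT => ?; apply: h; exists x.
  by rewrite lebesgue_measure_itv/= lte_fin ab -EFinB => -[]; lra.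
exists x => //.
apply/left_right_continuousP; split => //.
have cl : cvg (F y @[y --> x^'-]).
  apply: nondecreasing_at_left_is_cvgr; near=> z; first by move=> u v _ _; exact: ndF.
  exists (F x); move=> _ [y /= + <-]; rewrite in_itv/= => /andP[_ /ltW]; exact: ndF.
have cr : cvg (F y @[y --> x^'+]) by apply/cvg_ex; exists (F x).
have -> : F x = lim (F y @[y --> x^'-]); last exact: cl.
apply: contrapT => /eqP ne; apply: xF; split => //.
by rewrite [X in _ != X](cvg_lim _ (rF x))// eq_sym.
Unshelve. all: by end_near.
Qed.

End monotone_continuity.

(** * Distribution functions and the sandwich form *)

Section weak_convergence.
Context {R : realType}.

Section cdfr.
Context dT (T : measurableType dT) (P : probability T R).
Implicit Types X Y : T -> R.

Definition cdfr X (x : R) : R := fine (P [set w | X w <= x]).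

Lemma measurable_cdf_set X x : measurable_fun [set: T] X -> measurable [set w | X w <= x].
Proof. by move=> mX; apply: measurable_set_le. Qed.

Lemma fineP_le (A B : set T) : measurable A -> measurable B -> A `<=` B ->
  fine (P A) <= fine (P B).
Proof.
by move=> mA mB AB; rewrite fine_le ?fin_num_measure// le_measure ?inE.
Qed.

Lemma fineP_U_le (A B : set T) : measurable A -> measurable B ->
  fine (P (A `|` B)) <= fine (P A) + fine (P B).
Proof.
move=> mA mB; rewrite -fineD ?fin_num_measure// fine_le ?fin_num_measure//.
- exact: measurableU.
- by rewrite fin_numD !fin_num_measure.
- exact: measureU2.
Qed.

Lemma fineP_setC (A : set T) : measurable A -> fine (P (~` A)) = 1 - fine (P A).
Proof. by move=> mA; rewrite probability_setC// fineB ?fin_num_measure. Qed.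

Lemma EFin_cdfr X x : measurable_fun [set: T] X -> (cdfr X x)%:E = P [set w | X w <= x].
Proof. by move=> mX; rewrite fineK// fin_num_measure//; exact: measurable_cdf_set. Qed.

Lemma nondecreasing_cdfr X : measurable_fun [set: T] X -> {homo cdfr X : x y / x <= y}.
Proof.
move=> mX x y xy; apply: fineP_le; [exact: measurable_cdf_set..|].
by move=> w /= /le_trans; apply.
Qed.

Lemma cdfr_limits X : measurable_fun [set: T] X ->
  [/\ forall x, cdfr X y @[y --> x^'+] --> cdfr X x,
      cdfr X y @[y --> +oo] --> (1 : R) &
      cdfr X y @[y --> -oo] --> (0 : R)].
Proof.
move=> mX; pose X' : {RV P >-> R} := HB.pack X (isMeasurableFun.Build _ _ _ _ X mX).
have XE y : cdf X' y = (cdfr X y)%:E.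
  by rewrite EFin_cdfr.
have h (G : set_system R) (l : R) : Filter G -> cdf X' y @[y --> G] --> l%:E -> cdfr X y @[y --> G] --> l.
  move=> FG; have -> : cdf X' = EFin \o cdfr X by apply/funext => y; exact: XE.
  by move=> /fine_cvg.
split.
- by move=> x; apply: h; rewrite -XE; exact: cdf_right_continuous.
- by apply: h; exact: cvg_cdfy1.
- by apply: h; exact: cvg_cdfNy0.
Qed.

End cdfr.

(* Sandwich form of weak convergence to the distribution function G; unlike convergence
   at continuity points it is stable under small perturbations. *)
Definition wcvg (F : nat -> R -> R) (G : R -> R) := forall x e : R, 0 < e ->
  \forall n \near \oo, G (x - e) - e <= F n x <= G (x + e) + e.

(** At a continuity point a small shift of the argument changes [G] little. Conversely, continuity
    points exist on both sides of [x] within distance [e], and monotonicity transfers the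
    convergence there to [x]. *)
Lemma wcvgP (F : nat -> R -> R) (G : R -> R) :
  (forall n, {homo F n : x y / x <= y}) -> {homo G : x y / x <= y} ->
  (forall x, G y @[y --> x^'+] --> G x) ->
  wcvg F G <-> (forall x, {for x, continuous G} -> F n x @[n --> \oo] --> G x).
Proof.
move=> ndF ndG rG; split => [FG x cG|FG x e e0].
  apply/cvgrPdist_le => e e0.
  have /cvgrPdist_le/(_ (e / 2)) := cG; rewrite divr_gt0// => /(_ isT).
  move=> /nbhs_ballP[r /= r0 rP].
  pose s := Num.min (r / 2) (e / 2).
  have s0 : 0 < s by rewrite lt_min !divr_gt0.
  have sr : s < r.
    by rewrite gt_min; apply/orP; left; rewrite ltr_pdivrMr// ltr_pMr// ltr1n.
  have se : s <= e / 2 by rewrite ge_min lexx orbT.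
  have h1 : `|G x - G (x + s)| <= e / 2.
    by apply: rP; rewrite /ball/= opprD addNKr normrN gtr0_norm.
  have h2 : `|G x - G (x - s)| <= e / 2.
    by apply: rP; rewrite /ball/= opprD opprK addNKr gtr0_norm.
  near=> n; have : G (x - s) - s <= F n x <= G (x + s) + s by near: n; exact: FG.
  move: h1 h2; rewrite !ler_distl => /andP[h1 h2] /andP[h3 h4] /andP[h5 h6].
  by apply/andP; split; lra.
have [y /andP[xy ye] cy] : exists2 y, x < y < x + e & {for y, continuous G}.
  by apply: nondecreasing_continuity_point => //; rewrite ltrDl.
have [z /andP[xz ze] cz] : exists2 z, x - e < z < x & {for z, continuous G}.
  by apply: nondecreasing_continuity_point => //; rewrite gtrBl.
near=> n.
have h1 : `|G y - F n y| <= e by near: n; have /cvgrPdist_le := FG y cy; exact.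
have h2 : `|G z - F n z| <= e by near: n; have /cvgrPdist_le := FG z cz; exact.
move: h1 h2; rewrite !ler_distl => /andP[h1 h2] /andP[h3 h4].
have h5 := ndF n _ _ (ltW xy); have h6 := ndF n _ _ (ltW ze).
have h7 := ndG _ _ (ltW ye); have h8 := ndG _ _ (ltW xz).
by apply/andP; split; lra.
Unshelve. all: by end_near.
Qed.

Section cvg_law.
Context (dT : nat -> measure_display) (T : forall n, measurableType (dT n))
  (P : forall n, probability (T n) R) dQ (TQ : measurableType dQ) (Q : probability TQ R).
Implicit Types (X : forall n, T n -> R) (Y : TQ -> R).

Lemma cvg_lawP X Y : (forall n, measurable_fun [set: T n] (X n)) ->
  measurable_fun [set: TQ] Y ->
  cvg_law (fun n => pushforward (P n) (X n)) (pushforward Q Y) <->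
  wcvg (fun n => cdfr (P n) (X n)) (cdfr Q Y).
Proof.
move=> mX mY; have [rY _ _] := cdfr_limits Q mY.
have E dT' (T' : measurableType dT') (P' : probability T' R) (X' : T' -> R) x :
    measurable_fun [set: T'] X' -> pushforward P' X' `]-oo, x]%classic = (cdfr P' X' x)%:E.
  by move=> mX'; rewrite EFin_cdfr.
rewrite wcvgP//; [|by move=> n; exact: nondecreasing_cdfr|exact: nondecreasing_cdfr].
have EY : (fun x => pushforward Q Y `]-oo, x]%classic) = (fun x => (cdfr Q Y x)%:E).
  by apply/funext => x; rewrite E.
split=> H x cx.
  have cE : {for x, continuous (fun y => pushforward Q Y `]-oo, y]%classic)}.
    by rewrite EY; apply: cvg_EFin => //; near=> y.
  have := H x cE; rewrite E// (_ : (fun n => _) = (fun n => (cdfr (P n) (X n) x)%:E)).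
    by move=> /fine_cvg.
  by apply/funext => n; rewrite E.
rewrite E// (_ : (fun n => _) = (fun n => (cdfr (P n) (X n) x)%:E)); last first.
  by apply/funext => n; rewrite E.
apply: cvg_EFin; first by near=> n.
apply: H; move: cx; rewrite EY => /fine_cvg; exact.
Unshelve. all: by end_near.
Qed.

End cvg_law.
End weak_convergence.

(** * Discretised convolution *)

Section independent_sum.
Context {R : realType} dT (T : measurableType dT) (P : probability T R).
Variables X Y : T -> R.
Hypotheses (mX : measurable_fun [set: T] X) (mY : measurable_fun [set: T] Y).
Hypothesis XY : forall x y,
  fine (P ([set w | X w <= x] `&` [set w | Y w <= y])) = cdfr P X x * cdfr P Y y.

Let strip s t := [set w | s < X w <= t].

Let mstrip s t : measurable (strip s t).
Proof.
rewrite (_ : strip s t = [set w | s < X w] `&` [set w | X w <= t]).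
  by apply: measurableI; [exact: measurable_set_lt|exact: measurable_cdf_set].
by apply/seteqP; split => w /=; rewrite /strip/=; [move=> /andP[]|move=> [-> ->]].
Qed.

Lemma cdfr_strip s t y : s <= t ->
  fine (P (strip s t `&` [set w | Y w <= y])) = (cdfr P X t - cdfr P X s) * cdfr P Y y.
Proof.
move=> st; rewrite mulrBl -!XY.
have mA r : measurable ([set w | X w <= r] `&` [set w | Y w <= y]).
  by apply: measurableI; exact: measurable_cdf_set.
have mB : measurable (strip s t `&` [set w | Y w <= y]).
  by apply: measurableI => //; exact: measurable_cdf_set.
apply/eqP; rewrite eq_sym subr_eq -fineD ?fin_num_measure//; apply/eqP; congr fine.
rewrite -measureU//.
  congr (P _); apply/seteqP; split => w /=; rewrite /strip/=.
    by move=> [Xt Yy]; case: (leP (X w) s); [right|left; rewrite Xt].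
  by move=> [[/andP[_ ?] ?]|[Xs ?]]//; split => //; exact: le_trans st.
rewrite -subset0 => w /= [] [] /andP[h _] _ [h' _].
by rewrite leNgt h in h'.
Qed.

(** On the strip where X lies in ]t_i, t_(i+1)], the event Y <= x - t_(i+1) implies X + Y <= x,
    which implies Y <= x - t_i. The upper bound also pays for the two tails of X. Finite sums
    replace the convolution integral, so convergence can be checked term by term. *)
Lemma cdfr_sum_partition (t : nat -> R) m x :
  (forall i, t i <= t i.+1) ->
  \sum_(i < m) (cdfr P X (t i.+1) - cdfr P X (t i)) * cdfr P Y (x - t i.+1) <=
  cdfr P (X \+ Y) x <=
  cdfr P X (t 0%N) + (1 - cdfr P X (t m)) +
  \sum_(i < m) (cdfr P X (t i.+1) - cdfr P X (t i)) * cdfr P Y (x - t i).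
Proof.
move=> ndt; pose E := [set w | X w + Y w <= x].
have mE : measurable E by apply: (@measurable_cdf_set _ _ _ (X \+ Y)); exact: measurable_funD.
have mEs s r : measurable (strip s r `&` E) by apply: measurableI.
have mYx y : measurable [set w | Y w <= y] by exact: measurable_cdf_set.
have t0m k : t 0%N <= t k by elim: k => // k; move/le_trans; apply.
have main k : \sum_(i < k) (cdfr P X (t i.+1) - cdfr P X (t i)) * cdfr P Y (x - t i.+1) <=
    fine (P (strip (t 0%N) (t k) `&` E)) <=
    \sum_(i < k) (cdfr P X (t i.+1) - cdfr P X (t i)) * cdfr P Y (x - t i).
  elim: k => [|k /andP[IH1 IH2]].
    rewrite !big_ord0 (_ : strip _ _ `&` _ = set0) ?measure0 ?lexx//.
    by rewrite -subset0 => w [] /andP[/lt_le_trans h /h]; rewrite ltxx.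
  have -> : strip (t 0%N) (t k.+1) `&` E =
      (strip (t 0%N) (t k) `&` E) `|` (strip (t k) (t k.+1) `&` E).
    rewrite -setIUl; congr (_ `&` _); apply/seteqP; split => w; rewrite /strip/=.
      by move=> /andP[h1 h2]; case: (leP (X w) (t k)); [left; rewrite h1|right; rewrite h2].
    move=> [/andP[h1 h2]|/andP[h1 h2]].
      by rewrite h1 (le_trans h2).
    by rewrite h2 (le_lt_trans _ h1).
  rewrite measureU//; last first.
    rewrite -subset0 => w /= [] [/andP[_ h] _] [/andP[h' _] _].
    by rewrite leNgt h' in h.
  rewrite fineD ?fin_num_measure// !big_ord_recr/=.
  apply/andP; split; apply: lerD => //; rewrite -cdfr_strip//; apply: fineP_le => //.
  - exact: measurableI.
  - by move=> w /= [/andP[h1 h2] h3]; split; [rewrite /strip/= h1|rewrite /E/=; lra].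
  - exact: measurableI.
  - by move=> w /= [/andP[h1 h2]]; rewrite /E/= => h3; split; [rewrite /strip/= h1|rewrite /=; lra].
have /andP[h1 h2] := main m; apply/andP; split.
  by apply: le_trans h1 _; apply: fineP_le => // w [].
apply: (@le_trans _ _ (cdfr P X (t 0%N) + (1 - cdfr P X (t m)) + fine (P (strip (t 0%N) (t m) `&` E)))); last first.
  by rewrite lerD2l.
have mc r : measurable [set w | X w <= r] by exact: measurable_cdf_set.
rewrite -fineP_setC//.
have mU : measurable ([set w | X w <= t 0%N] `|` ~` [set w | X w <= t m]).
  by apply: measurableU => //; exact: measurableC.
apply: (@le_trans _ _ (fine (P (([set w | X w <= t 0%N] `|` ~` [set w | X w <= t m]) `|` (strip (t 0%N) (t m) `&` E))))).
  apply: fineP_le => //; first exact: measurableU.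
  move=> w Ew; case: (leP (X w) (t 0%N)) => [?|h]; first by left; left.
  case: (leP (X w) (t m)) => h'; first by right; split => //; rewrite /strip/= h h'.
  by left; right; rewrite /= => h''; rewrite leNgt h' in h''.
apply: le_trans (fineP_U_le _ _ _) _ => //; rewrite lerD2r.
by apply: fineP_U_le => //; exact: measurableC.
Qed.

End independent_sum.

(** * Tightness and Slutsky's lemma *)

Section slutsky.
Context {R : realType}.
Context (dT : nat -> measure_display) (T : forall n, measurableType (dT n))
  (P : forall n, probability (T n) R).
Implicit Types (X Y W : forall n, T n -> R).

Definition mfamily X := forall n, measurable_fun [set: T n] (X n).

Definition exceed X n (M : R) : R := fine (P n [set w | M < `|X n w|]).

Definition cvg_prob0 X := forall e, 0 < e -> exceed X n e @[n --> \oo] --> (0 : R).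

Definition tight X := forall e, 0 < e ->
  exists2 M, 0 < M & \forall n \near \oo, exceed X n M <= e.

Lemma measurable_exceed X n M : mfamily X -> measurable [set w | M < `|X n w|].
Proof. by move=> mX; apply: measurable_set_lt => //; exact: measurableT_comp. Qed.

Lemma exceed_ge0 X n M : 0 <= exceed X n M. Proof. exact: fine_ge0. Qed.

(** If W <= x then X <= x + e/2 unless |W - X| > e/2, and symmetrically; half of [e] goes to the
    perturbation and half to the sandwich for [X]. *)
Lemma wcvg_perturb X W (G : R -> R) : mfamily X -> mfamily W ->
  {homo G : x y / x <= y} ->
  wcvg (fun n => cdfr (P n) (X n)) G ->
  cvg_prob0 (fun n => W n \- X n) ->
  wcvg (fun n => cdfr (P n) (W n)) G.
Proof.
move=> mX mW ndG XG WX x e e0.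
have e20 : 0 < e / 2 by rewrite divr_gt0.
have mWX : mfamily (fun n => W n \- X n) by move=> n; exact: measurable_funB.
have mWX' n r := @measurable_exceed _ n r mWX.
near=> n.
have h1 : exceed (fun n => W n \- X n) n (e / 2) <= e / 2.
  by near: n; apply: (cvgr_le _ (WX _ e20)).
have /andP[h2 _] : G (x - e / 2 - e / 2) - e / 2 <= cdfr (P n) (X n) (x - e / 2) <= G (x - e / 2 + e / 2) + e / 2.
  by near: n; exact: XG.
have /andP[_ h3] : G (x + e / 2 - e / 2) - e / 2 <= cdfr (P n) (X n) (x + e / 2) <= G (x + e / 2 + e / 2) + e / 2.
  by near: n; exact: XG.
have h4 : cdfr (P n) (W n) x <= cdfr (P n) (X n) (x + e / 2) + exceed (fun n => W n \- X n) n (e / 2).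
  apply: le_trans (fineP_U_le (P n) (measurable_cdf_set _ (mX n)) (mWX' _ _)).
  apply: fineP_le; [exact: measurable_cdf_set|apply: measurableU => //; exact: measurable_cdf_set|].
  move=> w /= Wx; case: (leP (X n w) (x + e / 2)); [by left|move=> Xx; right].
  by rewrite distrC (lt_le_trans _ (ler_norm _))//; lra.
have h5 : cdfr (P n) (X n) (x - e / 2) <= cdfr (P n) (W n) x + exceed (fun n => W n \- X n) n (e / 2).
  apply: le_trans (fineP_U_le (P n) (measurable_cdf_set _ (mW n)) (mWX' _ _)).
  apply: fineP_le; [exact: measurable_cdf_set|apply: measurableU => //; exact: measurable_cdf_set|].
  move=> w /= Xx; case: (leP (W n w) x); [by left|move=> Wx; right].
  by rewrite (lt_le_trans _ (ler_norm _))//; lra.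
have e2 : x - e / 2 - e / 2 = x - e by field.
have e2' : x + e / 2 + e / 2 = x + e by field.
rewrite e2 in h2; rewrite e2' in h3; apply/andP; split; lra.
Unshelve. all: by end_near.
Qed.

Lemma wcvg_tight X (G : R -> R) : mfamily X ->
  wcvg (fun n => cdfr (P n) (X n)) G ->
  G y @[y --> +oo] --> (1 : R) -> G y @[y --> -oo] --> (0 : R) -> tight X.
Proof.
move=> mX XG G1 G0 e e0.
have e40 : 0 < e / 4 by rewrite divr_gt0.
have [A [_ hA]] : \forall y \near +oo, 1 - e / 4 <= G y.
  by apply: (cvgr_ge _ G1); lra.
have [B [_ hB]] : \forall y \near -oo, G y <= e / 4 by apply: (cvgr_le _ G0).
(* Large enough that, after a shift by e/4, the points [M] and [- M] are still beyond [A] and below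
   [B]; each tail is then at most e/2. *)
pose M := `|A| + `|B| + e + 1.
have A0 := normr_ge0 A; have B0 := normr_ge0 B.
have AA := ler_norm A; have BB := ler_norm (- B); rewrite normrN in BB.
exists (M + 1); first by rewrite /M; lra.
near=> n.
have /andP[h1 _] : G (M - e / 4) - e / 4 <= cdfr (P n) (X n) M <= G (M + e / 4) + e / 4.
  by near: n; exact: XG.
have /andP[_ h2] : G (- M - e / 4) - e / 4 <= cdfr (P n) (X n) (- M) <= G (- M + e / 4) + e / 4.
  by near: n; exact: XG.
have h3 : 1 - e / 4 <= G (M - e / 4) by apply: hA; rewrite /M; lra.
have h4 : G (- M + e / 4) <= e / 4 by apply: hB; rewrite /M; lra.
have mc r : measurable [set w | X n w <= r] by exact: measurable_cdf_set.
have h5 : exceed X n (M + 1) <= cdfr (P n) (X n) (- M) + (1 - cdfr (P n) (X n) M).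
  rewrite -fineP_setC//; apply: le_trans (fineP_U_le _ (mc _) (measurableC (mc _))).
  apply: fineP_le; [exact: measurable_exceed|apply: measurableU => //; exact: measurableC|].
  move=> w /=; case: (leP (X n w) (- M)); [by left|move=> h MX; right => h'].
  move: MX; rewrite ltNge => /negP; apply; rewrite ler_norml; apply/andP; split; lra.
lra.
Unshelve. all: by end_near.
Qed.

Lemma tightM X Y : mfamily X -> mfamily Y -> tight X -> tight Y -> tight (fun n => X n \* Y n).
Proof.
move=> mX mY tX tY e e0; have e20 : 0 < e / 2 by rewrite divr_gt0.
have [M M0 hM] := tX _ e20; have [N N0 hN] := tY _ e20.
exists (M * N); first exact: mulr_gt0.
near=> n.
have h1 : exceed X n M <= e / 2 by near: n.
have h2 : exceed Y n N <= e / 2 by near: n.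
have mXY : mfamily (fun n => X n \* Y n) by move=> k; exact: measurable_funM.
have : exceed (fun n => X n \* Y n) n (M * N) <= exceed X n M + exceed Y n N; last by lra.
apply: le_trans (fineP_U_le _ (measurable_exceed _ _ mX) (measurable_exceed _ _ mY)).
apply: fineP_le; [exact: (@measurable_exceed _ n _ mXY)|by apply: measurableU; exact: measurable_exceed|].
move=> w /=; rewrite normrM => h; case: (ltP M `|X n w|); [by left|move=> XM; right].
rewrite ltNge; apply/negP => YN; move: h; rewrite ltNge => /negP; apply.
exact: ler_pM.
Unshelve. all: by end_near.
Qed.

Lemma cvg_prob0M (c : nat -> R) X : c n @[n --> \oo] --> 0 -> mfamily X -> tight X ->
  cvg_prob0 (fun n => (fun w => c n * X n w)).
Proof.
move=> c0 mX tX e e0; apply/cvgrPdist_le => d d0.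
have [M M0 hM] := tX _ d0.
near=> n; rewrite sub0r normrN ger0_norm ?exceed_ge0//.
apply: (@le_trans _ _ (exceed X n M)); last by near: n.
have mcX : mfamily (fun n => (fun w => c n * X n w)) by move=> k; exact: measurable_funM.
apply: fineP_le; [exact: (@measurable_exceed _ n e mcX)|exact: measurable_exceed|].
move=> w /=; rewrite normrM => h; rewrite ltNge; apply/negP => XM.
move: h; rewrite ltNge => /negP; apply.
have cn : `|c n| <= e / M.
  by near: n; have /cvgr0Pnorm_le := c0; apply; rewrite divr_gt0.
by rewrite -(mulfVK (lt0r_neq0 M0) e) ler_pM.
Unshelve. all: by end_near.
Qed.

Lemma cvg_prob0D X Y : mfamily X -> mfamily Y -> cvg_prob0 X -> cvg_prob0 Y ->
  cvg_prob0 (fun n => X n \+ Y n).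
Proof.
move=> mX mY X0 Y0 e e0; have e20 : 0 < e / 2 by rewrite divr_gt0.
have mXY : mfamily (fun n => X n \+ Y n) by move=> k; exact: measurable_funD.
apply: (@squeeze_cvgr _ _ _ _ (fun=> 0) (fun n => exceed X n (e / 2) + exceed Y n (e / 2))).
- near=> n; rewrite exceed_ge0/=.
  apply: le_trans (fineP_U_le _ (measurable_exceed _ _ mX) (measurable_exceed _ _ mY)).
  apply: fineP_le; [exact: (@measurable_exceed _ n _ mXY)|by apply: measurableU; exact: measurable_exceed|].
  move=> w /= h; case: (ltP (e / 2) `|X n w|); [by left|move=> Xe; right].
  rewrite ltNge; apply/negP => Ye; move: h; rewrite ltNge => /negP; apply.
  by apply: le_trans (ler_normD _ _) _; lra.
- exact: cvg_cst.
- by rewrite -[X in _ --> X](addr0 (0:R)); apply: cvgD; [exact: X0|exact: Y0].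
Unshelve. all: by end_near.
Qed.

(** Tailored to the expansion of K: a main term plus two tight terms, one of them a product, with
    vanishing coefficients. *)
Lemma wcvg_add_negligible X Y W (G : R -> R) (r s : nat -> R) :
  mfamily X -> mfamily Y -> mfamily W -> {homo G : x y / x <= y} ->
  wcvg (fun n => cdfr (P n) (X n)) G -> r n @[n --> \oo] --> 0 -> s n @[n --> \oo] --> 0 ->
  tight Y -> tight W ->
  wcvg (fun n => cdfr (P n) (fun w => X n w + (r n * Y n w + s n * W n w))) G.
Proof.
move=> mX mY mW ndG XG r0 s0 tY tW.
have mrY : mfamily (fun n w => r n * Y n w) by move=> n; exact: measurable_funM.
have msW : mfamily (fun n w => s n * W n w) by move=> n; exact: measurable_funM.
apply: (wcvg_perturb mX _ ndG XG).
  by move=> n; apply: measurable_funD => //; apply: measurable_funD.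
rewrite (_ : (fun n => _) = (fun n (w : T n) => r n * Y n w + s n * W n w)).
  by apply: (cvg_prob0D mrY msW); apply: cvg_prob0M.
by apply: functional_extensionality_dep => n; apply/funext => w; rewrite /= addrC addKr.
Qed.

End slutsky.

(** * Convergence of sums of independent variables *)

Section cvg_independent_sum.
Context {R : realType}.
Context (dT : nat -> measure_display) (T : forall n, measurableType (dT n))
  (P : forall n, probability (T n) R) dQ (TQ : measurableType dQ) (Q : probability TQ R).
Variables (X Y : forall n, T n -> R) (X' Y' : TQ -> R).
Arguments X : clear implicits.
Arguments Y : clear implicits.
Hypotheses (mX : mfamily X) (mY : mfamily Y).
Hypotheses (mX' : measurable_fun [set: TQ] X') (mY' : measurable_fun [set: TQ] Y').
Hypothesis XY : \forall n \near \oo, forall x y,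
  fine (P n ([set w | X n w <= x] `&` [set w | Y n w <= y])) =
  cdfr (P n) (X n) x * cdfr (P n) (Y n) y.
Hypothesis XY' : forall x y,
  fine (Q ([set w | X' w <= x] `&` [set w | Y' w <= y])) = cdfr Q X' x * cdfr Q Y' y.
Hypothesis cvgX : wcvg (fun n => cdfr (P n) (X n)) (cdfr Q X').
Hypothesis cvgY : forall y, cdfr (P n) (Y n) y @[n --> \oo] --> cdfr Q Y' y.

(** Convergence of the laws of [X] is known only at continuity points of the limit, so one such
    point is picked in each cell of a regular grid of step e/2, far enough to leave tails below
    [e]. *)
Let continuity_grid (e : R) : 0 < e -> exists (t : nat -> R) (m : nat),
  [/\ forall i, t i <= t i.+1 <= t i + e, forall i, {for t i, continuous (cdfr Q X')},
      cdfr Q X' (t 0%N) <= e & 1 - e <= cdfr Q X' (t m)].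
Proof.
move=> e0; have [rF F1 F0] := cdfr_limits Q mX'; have ndF := nondecreasing_cdfr Q mX'.
have [A [_ hA]] : \forall y \near +oo, 1 - e <= cdfr Q X' y.
  by apply: (cvgr_ge _ F1); lra.
have [B [_ hB]] : \forall y \near -oo, cdfr Q X' y <= e by apply: (cvgr_le _ F0).
pose s i : R := B - e + i%:R * (e / 2).
have sS i : s i.+1 = s i + e / 2 by rewrite /s -natr1; ring.
have ss i : s i < s i.+1 by rewrite sS ltrDl divr_gt0.
have ex i := nondecreasing_continuity_point (ss i) ndF rF.
pose t i := projT1 (cid2 (ex i)).
have tP i : s i < t i < s i.+1 by rewrite /t; case: (cid2 (ex i)).
pose m := (Num.truncn ((A - B + e) / (e / 2))).+1.
exists t, m; split.
- move=> i; have := tP i; have := tP i.+1; rewrite !sS => /andP[h1 h2] /andP[h3 h4].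
  by apply/andP; split; lra.
- by move=> i; rewrite /t; case: (cid2 (ex i)).
- apply: hB; have := tP 0%N; rewrite sS /s mul0r addr0 => /andP[_ h].
  lra.
- apply: hA; have /andP[h _] := tP m; apply: le_lt_trans h.
  have := truncnS_gt ((A - B + e) / (e / 2)); rewrite -/m ltr_pdivrMr ?divr_gt0//.
  by rewrite /s; lra.
Qed.

(** The partition bounds are applied to the approximants at [x] and to the limit at [x - e] and
    [x + e]. The mesh being below [e], this shift turns left endpoints into right ones, so the two
    bounds on the limit close the sandwich. *)
Lemma wcvg_independent_sum :
  wcvg (fun n => cdfr (P n) (X n \+ Y n)) (cdfr Q (X' \+ Y')).
Proof.
move=> x e e0; have e80 : 0 < e / 8 by rewrite divr_gt0.
have [t [m [ht ct t0 tm]]] := continuity_grid e80.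
have [rF _ _] := cdfr_limits Q mX'; have ndF := nondecreasing_cdfr Q mX'.
have cF i : cdfr (P n) (X n) (t i) @[n --> \oo] --> cdfr Q X' (t i).
  have /wcvgP h := cvgX; apply: h => //.
  by move=> n; exact: nondecreasing_cdfr.
have ndt i : t i <= t i.+1 by have /andP[] := ht i.
(* Offset [j = 0] takes left endpoints and gives the upper sum, [j = 1] takes right endpoints and
   gives the lower sum. *)
pose S (f g : R -> R) (j : nat) := \sum_(i < m) (f (t i.+1) - f (t i)) * g (x - t (i + j)%N).
have cS j : S (cdfr (P n) (X n)) (cdfr (P n) (Y n)) j @[n --> \oo] --> S (cdfr Q X') (cdfr Q Y') j.
  apply: cvg_big => [|i _]; first exact: add_continuous.
  apply: cvgM; last exact: cvgY.
  by apply: cvgB; exact: cF.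
have U : cdfr (P n) (X n) (t 0%N) + (1 - cdfr (P n) (X n) (t m)) +
    S (cdfr (P n) (X n)) (cdfr (P n) (Y n)) 0%N @[n --> \oo] -->
    cdfr Q X' (t 0%N) + (1 - cdfr Q X' (t m)) + S (cdfr Q X') (cdfr Q Y') 0%N.
  by apply: cvgD => //; apply: cvgD => //; apply: cvgB => //; exact: cvg_cst.
have e40 : 0 < e / 4 by rewrite divr_gt0.
have dF i : 0 <= cdfr Q X' (t i.+1) - cdfr Q X' (t i) by rewrite subr_ge0; exact: ndF.
have ndH := nondecreasing_cdfr Q mY'.
have /andP[h1 _] := cdfr_sum_partition mX' mY' XY' m (x + e) ndt.
have /andP[_ h2] := cdfr_sum_partition mX' mY' XY' m (x - e) ndt.
have h3 : S (cdfr Q X') (cdfr Q Y') 0%N <= cdfr Q (X' \+ Y') (x + e).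
  apply: le_trans h1; apply: ler_sum => i _; rewrite addn0 ler_wpM2l//.
  by apply: ndH; have /andP[_] := ht i; lra.
have h4 : cdfr Q (X' \+ Y') (x - e) <= e / 4 + S (cdfr Q X') (cdfr Q Y') 1%N.
  apply: le_trans h2 _; apply: lerD; first lra.
  apply: ler_sum => i _; rewrite addn1 ler_wpM2l//.
  by apply: ndH; have /andP[_] := ht i; lra.
near=> n.
have XYn : forall x y, fine (P n ([set w | X n w <= x] `&` [set w | Y n w <= y])) =
  cdfr (P n) (X n) x * cdfr (P n) (Y n) y by near: n.
have /andP[h5 h6] := cdfr_sum_partition (@mX n) (@mY n) XYn m x ndt.
have h7 : S (cdfr Q X') (cdfr Q Y') 1%N - e / 4 <= S (cdfr (P n) (X n)) (cdfr (P n) (Y n)) 1%N.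
  by near: n; apply: (cvgr_ge _ (cS 1%N)); rewrite gtrBl.
have h8 : cdfr (P n) (X n) (t 0%N) + (1 - cdfr (P n) (X n) (t m)) +
    S (cdfr (P n) (X n)) (cdfr (P n) (Y n)) 0%N <=
    cdfr Q X' (t 0%N) + (1 - cdfr Q X' (t m)) + S (cdfr Q X') (cdfr Q Y') 0%N + e / 4.
  by near: n; apply: (cvgr_le _ U); rewrite ltrDl.
have h9 : S (cdfr (P n) (X n)) (cdfr (P n) (Y n)) 1%N <= cdfr (P n) (X n \+ Y n) x.
  by apply: le_trans h5; rewrite /S; under eq_bigr do rewrite addn1.
have h10 : cdfr (P n) (X n \+ Y n) x <= cdfr (P n) (X n) (t 0%N) + (1 - cdfr (P n) (X n) (t m)) +
    S (cdfr (P n) (X n)) (cdfr (P n) (Y n)) 0%N.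
  by apply: le_trans h6 _; rewrite lerD2l /S; under [leRHS]eq_bigr do rewrite addn0.
apply/andP; split; lra.
Unshelve. all: by end_near.
Qed.

End cvg_independent_sum.

(** * The central limit theorem for chi-squared laws *)

Section std_normal_layers.
Context {R : realType}.
Notation mu := (@lebesgue_measure R).
Notation lam := (tuple_measure (@lebesgue_measure R)).
Notation gam := (tuple_measure (@normal_prob R 0 1)).
Local Open Scope ereal_scope.

Let normal_setT : @normal_prob R 0 1 [set: R] = 1.
Proof. exact: (@probability_setT _ _ _ (@normal_prob R 0 1)). Qed.

Lemma integral_std_normal_prob (f : R -> \bar R) : measurable_fun [set: R] f ->
  (forall x, 0 <= f x <= 1) ->
  \int[@normal_prob R 0 1]_x f x = \int[mu]_x (f x * (normal_pdf 0 1 x)%:E).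
Proof.
move=> mf f01; have dom := @normal_prob_dominates R 0 1.
have intf : (@normal_prob R 0 1).-integrable [set: R] f.
  apply/integrableP; split => //.
  apply: (@le_lt_trans _ _ (\int[@normal_prob R 0 1]_x 1)).
    apply: ge0_le_integral => //; first exact: measurableT_comp.
    by move=> x _; rewrite gee0_abs; case/andP: (f01 x).
  by rewrite integral_cst// mul1e [X in X < _](_ : _ = 1) ?ltry//; exact: normal_setT.
rewrite -(Radon_Nikodym_change_of_variables dom)//=.
apply: ae_eq_integral => //.
- by apply: emeasurable_funM => //; apply: (measurable_int mu); exact: Radon_Nikodym_integrable.
- by apply: emeasurable_funM => //=; apply/measurableT_comp => //; exact: measurable_normal_pdf.
- apply: ae_eqe_mul2l => /=.
  rewrite Radon_NikodymE//=; case: cid => /= h [h1 h2 h3].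
  apply: integral_ae_eq => //=.
  + by apply/measurableT_comp => //; exact: measurable_normal_pdf.
  + by move=> E E01 mE; rewrite -h3.
Qed.

Lemma std_normal_tuple_setT n : gam n setT = 1.
Proof.
elim: n => [|n IH]; first exact: diracT.
rewrite tuple_measureS (eq_integral (cst 1)); last by move=> x _ /=; rewrite -IH.
by rewrite integral_cst// mul1e; exact: normal_setT.
Qed.

Lemma std_normal_tuple_le1 n A : measurable A -> gam n A <= 1.
Proof. by move=> mA; rewrite -(std_normal_tuple_setT n) le_measure ?inE. Qed.

Definition half_exp (s : R) : R := (expR (- (s / 2)) / 2)%R.

Lemma measurable_half_exp : measurable_fun [set: R] half_exp.
Proof.
apply: measurable_funM => //; apply: measurableT_comp => //.
by apply: measurable_funN; exact: measurable_funM.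
Qed.

Lemma measurable_ball_section n (B : set (n.-tuple R)) : measurable B ->
  measurable_fun [set: measurableTypeR R] (fun s => lam n (B `&` tball s)).
Proof.
move=> mB; have mE : measurable [set sy : measurableTypeR R * n.-tuple R |
    B sy.2 /\ (dotp sy.2 sy.2 <= sy.1)%R].
  apply: measurableI; last by apply: measurable_set_le => //; exact: measurable_dotp.
  by rewrite -[X in measurable X]setTI; exact: measurable_snd.
apply: eq_measurable_fun (measurable_fun_xsection (lam n) mE) => s _ /=.
by rewrite xsectionE.
Qed.

(* Layer cake for exp (- |z|^2 / 2), which is the integral of half_exp over [|z|^2, +oo[ *)
Lemma std_normal_tuple_layers n (A : set (n.-tuple R)) : measurable A ->
  gam n A = ((@normal_peak R 1) ^+ n)%:E *
    \int[mu]_s ((half_exp s)%:E * lam n (A `&` tball s)).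
Proof.
have h0 s : (0 <= half_exp s)%R by rewrite /half_exp divr_ge0 ?expR_ge0.
elim: n A => [|n IH] A mA.
  rewrite expr0 mul1e.
  have lam0 B : lam 0 B = \d_([tuple] : 0.-tuple R) B by [].
  have -> : gam 0 A = \d_([tuple] : 0.-tuple R) A by [].
  (* The only 0-tuple has norm 0, so the layers are all [s >= 0]; on them [half_exp] is the
     exponential density of rate 1/2, of total mass 1. *)
  transitivity (\int[mu]_s (\d_([tuple] : 0.-tuple R) A * (exponential_pdf (1 / 2) s)%:E)).
    rewrite ge0_integralZl//.
    - by rewrite integral_exponential_pdf ?mule1//; lra.
    - by apply/measurable_EFinP; exact: measurable_exponential_pdf.
    - by move=> x _; rewrite lee_fin exponential_pdf_ge0//; lra.
  apply: eq_integral => s _; rewrite lam0 !diracE in_setI muleC /exponential_pdf patchE.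
  have -> : ([tuple] \in tball s) = (s \in (`[0%R, +oo[%classic : set R)).
    by apply/idP/idP; rewrite !inE /tball/= in_itv/= andbT /dotp big_ord0.
  case: ifPn => sE; rewrite ?andbT ?andbF ?mule0 ?mul0e//; congr (_ * _).
  congr EFin; rewrite /half_exp; have -> : (- (1 / 2) * s = - (s / 2))%R by field.
  by field.
pose c := (@normal_peak R 1 ^+ n)%R.
have c0 : (0 <= c)%R by rewrite exprn_ge0 ?normal_peak_ge0.
rewrite tuple_measureS.
have mAx x : measurable [set y | A (tuple_cons (x, y))] by exact: measurable_tuple_section.
rewrite integral_std_normal_prob; last 2 first.
  exact: measurable_tuple_measure_section.
  by move=> x; apply/andP; split; [exact: measure_ge0|exact: (std_normal_tuple_le1 (mAx x))].
(* Translating the layer variable by [x ^+ 2] absorbs the factor [expR (- (x ^+ 2 / 2))] of the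
   first coordinate and makes the condition |y|^2 <= s - x^2; Tonelli then reassembles the slices
   into a ball of one more dimension. *)
pose V (x s : R) := [set y | A (tuple_cons (x, y))] `&` @tball R n (s - x ^+ 2).
pose phi (x s : R) := (half_exp s)%:E * lam n (V x s).
have phi0 x s : 0 <= phi x s by rewrite mule_ge0 ?lee_fin ?h0 ?measure_ge0.
have mV : measurable [set xsy : (measurableTypeR R * measurableTypeR R) * n.-tuple R |
    V xsy.1.1 xsy.1.2 xsy.2].
  apply: measurableI.
    rewrite -[X in measurable X]setTI.
    apply: (measurableT_comp (@measurable_tuple_cons _ (measurableTypeR R) n)
      (f := _) (g := fun xsy : (measurableTypeR R * measurableTypeR R) * n.-tuple R => (xsy.1.1, xsy.2))) => //.
    apply: measurable_fun_pair => //.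
    exact: measurableT_comp.
  apply: measurable_set_le; first exact: measurable_dotp.
  apply: measurable_funB; first exact: measurableT_comp.
  by apply: measurable_funX; exact: measurableT_comp.
have measurable_shifted s : measurable [set xy : measurableTypeR R * n.-tuple R | V xy.1 s xy.2].
  have mg : measurable_fun [set: measurableTypeR R * n.-tuple R]
      (fun xy => ((xy.1, s : measurableTypeR R), xy.2)).
    apply: measurable_fun_pair => //.
    by apply: (measurableT_comp (pair2_measurable _)); exact: measurable_fst.
  by rewrite -[X in measurable X]setTI; exact: (mg measurableT _ mV).
have mphi : measurable_fun [set: measurableTypeR R * measurableTypeR R] (fun xs => phi xs.1 xs.2).
  apply: emeasurable_funM.
    by apply/measurable_EFinP; exact: (measurableT_comp measurable_half_exp).
  apply: eq_measurable_fun (measurable_fun_xsection (lam n) mV) => -[x s] _ /=.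
  by rewrite xsectionE.
transitivity (\int[mu]_x ((c * @normal_peak R 1)%:E * \int[mu]_s phi x s)).
  apply: eq_integral => x _; rewrite (IH _ (mAx x)) -/c.
  pose f s := (half_exp s)%:E * lam n ([set y | A (tuple_cons (x, y))] `&` tball s).
  have mf : measurable_fun [set: R] f.
    apply: emeasurable_funM; first by apply/measurable_EFinP; exact: measurable_half_exp.
    exact: (measurable_ball_section (mAx x)).
  have f0 s : 0 <= f s by rewrite mule_ge0 ?lee_fin ?h0 ?measure_ge0.
  have mf' : measurable_fun [set: R] (fun s => f (1 * s + - x ^+ 2)%R).
    by apply: (measurableT_comp mf); exact: measurable_affine.
  have -> : \int[mu]_s phi x s = (expR (- (x ^+ 2 / 2)))%:E * \int[mu]_s f s.
    have := ge0_integral_affine (- x ^+ 2)%R ltr01 mf f0; rewrite invr1 mul1e => <-.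
    rewrite -ge0_integralZl_EFin ?expR_ge0//.
    apply: eq_integral => s _; rewrite /phi /f muleA -EFinM mul1r; congr (_%:E * lam n (_ `&` _)).
    by rewrite /half_exp mulrA -expRD; congr (expR _ / 2)%R; field.
  rewrite normal_pdfE ?oner_neq0// /normal_fun /= [RHS]muleA [LHS]muleAC -!EFinM.
  congr (_%:E * _); rewrite -[RHS]mulrA; congr (_ * (_ * expR _))%R; by field.
have C0 : (0 <= c * @normal_peak R 1)%R by rewrite mulr_ge0// normal_peak_ge0.
rewrite ge0_integralZl_EFin//; last 2 first.
  by move=> x _; exact: integral_ge0.
  have := measurable_fun_fubini_tonelli_F (m2 := mu) (fun xs => phi xs.1 xs.2) mphi; apply.
  by move=> xs; exact: phi0.
rewrite (exprSr _ n) -/c; congr (_ * _).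
transitivity (\int[mu]_s \int[mu]_x phi x s).
  exact: (fubini_tonelli (m1 := mu) (m2 := mu) (fun xs => phi xs.1 xs.2) mphi (fun=> phi0 _ _)).
apply: eq_integral => s _ /=; rewrite ge0_integralZl_EFin//; last first.
  apply: eq_measurable_fun (measurable_fun_xsection (lam n) (measurable_shifted s)) => x _ /=.
  by rewrite xsectionE.
congr (_ * _); rewrite tuple_measureS; apply: eq_integral => x _; congr (lam n _).
apply/funext => y; rewrite /V /tball /= dotp_tuple_cons; congr (_ /\ is_true _).
by rewrite lerBrDl.
Qed.

End std_normal_layers.

(** * Pointwise limits and domination for the layer integrand *)

Section chi2_profile.
Context {R : realType}.
Notation mu := (@lebesgue_measure R).
Notation lam := (tuple_measure (@lebesgue_measure R)).
Notation gam := (tuple_measure (@normal_prob R 0 1)).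

(** The error term has derivative c^2/(1+c), at most 2 w^2 in absolute value for |c| <= |w| <= 1/2;
    the mean value theorem adds the third factor |w|. *)
Lemma ln1D_taylor2 (w : R) : `|w| <= 1 / 2 -> `|ln (1 + w) - w + w ^+ 2 / 2| <= 2 * `|w| ^+ 3.
Proof.
pose g (w : R) := ln (1 + w) - w + w ^+ 2 / 2.
have dg (c : R) : -1 < c -> is_derive c 1 g (c ^+ 2 / (1 + c)).
  move=> c1; have c0 : 0 < 1 + c by lra.
  have d1 : is_derive c (1:R) (fun w : R => 1 + w) 1.
    by apply: (is_derive_eq (is_deriveD (is_derive_cst (1:R) c (1:R)) (is_derive_id c (1:R)))); rewrite add0r.
  have d2 : is_derive c (1:R) (fun w : R => ln (1 + w)) (1 + c)^-1.
    apply: (is_derive_eq (@is_derive1_comp R (@ln R) (fun w => 1 + w) c _ _ (is_derive1_ln c0) d1)).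
    by rewrite mulr1.
  have d3 := is_deriveX 2 (is_derive_id c (1:R)).
  have d4 := is_deriveM d3 (is_derive_cst ((2:R)^-1) c (1:R)).
  apply: (is_derive_eq (is_deriveD (is_deriveB d2 (is_derive_id c (1:R))) d4)).
  rewrite -![_ *: _]/(_ * _) /= expr1 mulr0 add0r mulr1.
  by field; rewrite gt_eqF.
have cg (a b : R) : -1 < a -> {within `[a, b], continuous g}.
  move=> a1; apply: derivable_within_continuous => x; rewrite in_itv/= => /andP[ax _].
  by have [] := dg x (lt_le_trans a1 ax).
have g0 : g 0 = 0 by rewrite /g addr0 ln1 subr0 add0r expr0n mul0r.
rewrite ler_norml => /andP[w1 w2]; rewrite -/(g w).
have bnd (c : R) : `|c| <= `|w| -> `|c ^+ 2 / (1 + c)| <= 2 * `|w| ^+ 2.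
  move=> cw; have c2 : - (1 / 2) <= c.
    have : `|w| <= 1 / 2 by rewrite ler_norml w1 w2.
    by move=> /(le_trans cw); rewrite ler_norml => /andP[].
  have c0 : 0 < 1 + c by lra.
  rewrite normrM normrX [`|_^-1|]gtr0_norm ?invr_gt0// mulrC ler_pM//.
  - by rewrite invr_ge0 ltW.
  - by rewrite invf_ple ?posrE//; lra.
  - by rewrite ?normrX lerXn2r ?nnegrE.
have [w0|w0] := leP 0 w.
  have w1' : -1 < 0 :> R by lra.
  have dI x : x \in `]0, w[ -> is_derive x 1 g (x ^+ 2 / (1 + x)).
    by rewrite in_itv/= => /andP[x0 _]; apply: dg; lra.
  have [c /= cI] := MVT_segment w0 dI (cg 0 w w1').
  rewrite g0 !subr0 => ->; rewrite normrM (exprSr _ 2) [leRHS]mulrA ler_wpM2r//.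
  apply: bnd; move: cI; rewrite in_itv/= => /andP[c0 cw].
  by rewrite !ger0_norm.
have w1' : -1 < w by lra.
have dI x : x \in `]w, 0[ -> is_derive x 1 g (x ^+ 2 / (1 + x)).
  by rewrite in_itv/= => /andP[x0 _]; apply: dg; lra.
have [c /= cI] := MVT_segment (ltW w0) dI (cg w 0 w1').
rewrite g0 !sub0r -normrN => ->; rewrite normrM normrN (exprSr _ 2) [leRHS]mulrA ler_wpM2r//.
apply: bnd; move: cI; rewrite in_itv/= => /andP[c0 cw].
by rewrite !ler0_norm ?lerN2// ltW.
Qed.

(* The density of (chi^2_d - d) / sqrt (2 d), up to a constant factor; r stands for sqrt (2 / d). *)
Definition chi2_profile n (y : R) : R :=
  let r := Num.sqrt (2 / n%:R) in expR (- (y / r)) * Num.sqrt (1 + y * r) ^+ n.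

(** The layer integrand for the event that the standardised square norm is at most [x]: the layer
    [y] meets a ball concentric with it, hence the minimum. Layers with [y > x] still contribute at
    finite [n]. *)
Definition chi2_cut_profile n (x y : R) : R :=
  let r := Num.sqrt (2 / n%:R) in
  expR (- (y / r)) * Num.sqrt (1 + Num.min x y * r) ^+ n.

(** With p = sqrt (1 + y r) and n = 2/r^2, the bound ln p <= p - 1 completes a square: the exponent
    is at most - (p-1)^2/r^2. Since |y| = |p-1| (p+1)/r, this beats linear decay as soon as r <= 1,
    that is n >= 2. *)
Lemma chi2_profile_le n (y : R) : (2 <= n)%N -> chi2_profile n y <= expR (1 - `|y| / 2).
Proof.
move=> n2; rewrite /chi2_profile; set r := Num.sqrt _.
have n0 : 0 < n%:R :> R by rewrite ltr0n (leq_trans _ n2).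
have r0 : 0 < r by rewrite sqrtr_gt0 divr_gt0.
have r2 : r ^+ 2 = 2 / n%:R by rewrite sqr_sqrtr// ltW// divr_gt0.
have nr : n%:R = 2 / r ^+ 2 by rewrite r2 invfM invrK mulrA mulfV ?mul1r.
have r1 : r <= 1.
  by rewrite -[leRHS]sqrtr1 ler_wsqrtr// ler_pdivrMr// mul1r ler_nat.
set p := Num.sqrt (1 + y * r).
have [w0|w0] := leP (1 + y * r) 0.
  rewrite /p (ler0_sqrtr w0) expr0n gtn_eqF ?(leq_trans _ n2)// mulr0; exact: expR_ge0.
have p0 : 0 < p by rewrite sqrtr_gt0.
have p2 : p ^+ 2 = 1 + y * r by rewrite sqr_sqrtr// ltW.
rewrite -{1}[p]lnK ?posrE// -expRM_natr -expRD ler_expR.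
have h1 : ln p * n%:R <= (p - 1) * n%:R.
  rewrite ler_pM2r//; have : -1 < p - 1 by lra.
  by move=> /le_ln1Dx; rewrite addrC subrK.
have yE : y = (p ^+ 2 - 1) / r by rewrite p2 addrAC subrr add0r mulfK// gt_eqF.
suff : - (y / r) + (p - 1) * n%:R <= 1 - `|y| / 2 by lra.
rewrite nr {1}yE -(ler_pM2r (exprn_gt0 2 r0)).
have -> : (- ((p ^+ 2 - 1) / r / r) + (p - 1) * (2 / r ^+ 2)) * r ^+ 2 = - (p - 1) ^+ 2.
  by field; rewrite gt_eqF.
have -> : (1 - `|y| / 2) * r ^+ 2 = r ^+ 2 - `|p - 1| * (p + 1) * r / 2.
  have -> : `|y| = `|p - 1| * (p + 1) / r.
    rewrite yE normrM normfV (gtr0_norm r0); congr (_ / _).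
    rewrite (_ : p ^+ 2 - 1 = (p - 1) * (p + 1)); last by ring.
    by rewrite normrM [X in _ * X]gtr0_norm//; lra.
  by field; rewrite gt_eqF.
have -> : (p - 1) ^+ 2 = `|p - 1| ^+ 2 by rewrite real_normK ?num_real.
have := ler_norm (p - 1); have := normr_ge0 (p - 1); move: `|p - 1| => a a0 pa.
have h2 : a * (p + 1) * r <= a * (a + 2) * r by rewrite ler_pM2r// ler_wpM2l//; lra.
have h3 : a * a * r <= a * a by rewrite ler_piMr// mulr_ge0.
have h4 := sqr_ge0 (a - r).
nra.
Qed.

Lemma chi2_cut_profile_le n (x y : R) : chi2_cut_profile n x y <= chi2_profile n y.
Proof.
rewrite /chi2_cut_profile /chi2_profile ler_pM2l ?expR_gt0//.
rewrite lerXn2r ?nnegrE ?sqrtr_ge0// ler_wsqrtr// lerD2l ler_wpM2r ?sqrtr_ge0//.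
by rewrite ge_min lexx orbT.
Qed.

Lemma chi2_profile_ge0 n y : 0 <= chi2_profile n y.
Proof. by rewrite mulr_ge0 ?expR_ge0 ?exprn_ge0 ?sqrtr_ge0. Qed.

Lemma chi2_cut_profile_ge0 n x y : 0 <= chi2_cut_profile n x y.
Proof. by rewrite mulr_ge0 ?expR_ge0 ?exprn_ge0 ?sqrtr_ge0. Qed.

Let cvg_r : (Num.sqrt (2 / n%:R) : R) @[n --> \oo] --> 0.
Proof.
suff : Num.sqrt (2 / n%:R) @[n --> \oo] --> Num.sqrt (0 : R) by rewrite sqrtr0.
apply: cvg_sqrt_comp.
suff : 2 / n%:R @[n --> \oo] --> (2 * 0 : R) by rewrite mulr0.
apply: cvgM; first exact: cvg_cst.
by apply/gtr0_cvgV0; [near=> n; rewrite ltr0n; near: n; exact: nbhs_infty_gt|exact: cvgr_idn].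
Unshelve. all: by end_near.
Qed.

(** As n/2 = 1/r^2, the logarithm of the profile is (ln (1 + y r) - y r)/r^2; the second-order
    expansion leaves - y^2/2 with an error of order r. *)
Lemma cvg_chi2_profile (y : R) :
  chi2_profile n y @[n --> \oo] --> expR (- (y ^+ 2 / 2)).
Proof.
pose r n : R := Num.sqrt (2 / n%:R).
have cr : r n @[n --> \oo] --> 0 := cvg_r.
pose e n : R := (ln (1 + y * r n) - y * r n) / r n ^+ 2.
have yr : y * r n @[n --> \oo] --> 0.
  suff : y * r n @[n --> \oo] --> y * 0 by rewrite mulr0.
  by apply: cvgM => //; exact: cvg_cst.
have ce : e n @[n --> \oo] --> - (y ^+ 2 / 2).
  apply: (@squeeze_cvgr _ _ _ _ (fun n => - (y ^+ 2 / 2) - 2 * `|y| ^+ 3 * r n)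
    (fun n => - (y ^+ 2 / 2) + 2 * `|y| ^+ 3 * r n)).
  - near=> n.
    have r0 : 0 < r n by rewrite sqrtr_gt0 divr_gt0// ltr0n; near: n; exact: nbhs_infty_gt.
    have w1 : `|y * r n| <= 1 / 2.
      by near: n; have /cvgr0Pnorm_le := yr; apply; lra.
    have h := ln1D_taylor2 w1; rewrite -ler_distl opprK.
    have -> : e n + y ^+ 2 / 2 = (ln (1 + y * r n) - y * r n + (y * r n) ^+ 2 / 2) / r n ^+ 2.
      by rewrite /e; field; rewrite gt_eqF.
    rewrite normrM normfV (gtr0_norm (exprn_gt0 2 r0)) ler_pdivrMr ?exprn_gt0//.
    apply: le_trans h _; rewrite normrM (gtr0_norm r0) le_eqVlt; apply/orP; left; apply/eqP; ring.
  - rewrite -[X in _ --> X]subr0 -[X in _ --> _ - X](mulr0 (2 * `|y| ^+ 3)).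
    apply: cvgB; first exact: cvg_cst.
    by apply: cvgM => //; exact: cvg_cst.
  - rewrite -[X in _ --> X]addr0 -[X in _ --> _ + X](mulr0 (2 * `|y| ^+ 3)).
    apply: cvgD; first exact: cvg_cst.
    by apply: cvgM => //; exact: cvg_cst.
have ee : expR (e n) @[n --> \oo] --> expR (- (y ^+ 2 / 2)).
  exact: cvg_expR_comp.
apply: cvg_trans ee; apply: near_eq_cvg; near=> n.
have n0 : 0 < n%:R :> R by rewrite ltr0n; near: n; exact: nbhs_infty_gt.
have r0 : 0 < r n by rewrite sqrtr_gt0 divr_gt0.
have r2 : r n ^+ 2 = 2 / n%:R by rewrite sqr_sqrtr// ltW// divr_gt0.
have w0 : 0 < 1 + y * r n.
  by rewrite -ltrBlDl sub0r; near: n; apply: (cvgr_gt _ yr); lra.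
have p0 : 0 < Num.sqrt (1 + y * r n) by rewrite sqrtr_gt0.
have lnE : ln (1 + y * r n) = ln (Num.sqrt (1 + y * r n)) *+ 2.
  by rewrite -lnXn// sqr_sqrtr// ltW.
rewrite /chi2_profile -/(r n) -{1}[Num.sqrt (1 + _)]lnK ?posrE// -expRM_natr -expRD.
congr expR; rewrite /e lnE; have -> : n%:R = 2 / r n ^+ 2.
  by rewrite r2 invfM invrK mulrA mulfV ?mul1r.
by rewrite -mulr_natr; field; rewrite gt_eqF.
Unshelve. all: by end_near.
Qed.

(** For y > x the integrand is exp (- (y-x)/r) times the profile at x, and r tends to 0: the layers
    beyond x disappear in the limit. *)
Lemma cvg_chi2_cut_profile (x y : R) :
  chi2_cut_profile n x y @[n --> \oo] --> (if y <= x then expR (- (y ^+ 2 / 2)) else 0).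
Proof.
have [yx|xy] := leP y x.
  rewrite (_ : (fun n => _) = chi2_profile^~ y); first exact: cvg_chi2_profile.
  by apply/funext => n; rewrite /chi2_cut_profile min_r.
rewrite (_ : (fun n => _) =
    (fun n => expR (- ((y - x) / Num.sqrt (2 / n%:R))) * chi2_profile n x)); last first.
  apply/funext => n; rewrite /chi2_cut_profile min_l ?ltW// /chi2_profile mulrA -expRD.
  by congr (expR _ * _); rewrite mulrBl; ring.
rewrite -[X in _ --> X](mul0r (expR (- (x ^+ 2 / 2)))).
apply: cvgM; last exact: cvg_chi2_profile.
have voo : (y - x) / Num.sqrt (2 / n%:R) @[n --> \oo] --> +oo.
  apply/cvgryPge => A; near=> n.
  have r0 : 0 < Num.sqrt (2 / n%:R) :> R.
    by rewrite sqrtr_gt0 divr_gt0// ltr0n; near: n; exact: nbhs_infty_gt.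
  rewrite ler_pdivlMr//; apply: le_trans (ler_norm _) _; rewrite normrM (gtr0_norm r0).
  have A1 : 0 < `|A| + 1 by rewrite ltr_wpDl.
  apply: (@le_trans _ _ ((`|A| + 1) * Num.sqrt (2 / n%:R))); first by rewrite ler_wpM2r ?(ltW r0)// lerDl.
  rewrite -ler_pdivlMl//.
  by near: n; apply: (cvgr_le _ cvg_r); rewrite mulr_gt0 ?invr_gt0 ?subr_gt0.
apply/cvgrPdist_le => e e0; near=> n; rewrite sub0r normrN ger0_norm ?expR_ge0//.
rewrite -[e]lnK ?posrE// ler_expR lerNl; near: n; exact: cvgry_ge.
Unshelve. all: by end_near.
Qed.

End chi2_profile.

(** * Dominated convergence and the central limit theorem *)

Section chi2_clt.
Context {R : realType}.
Notation mu := (@lebesgue_measure R).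
Notation lam := (tuple_measure (@lebesgue_measure R)).
Notation gam := (tuple_measure (@normal_prob R 0 1)).

Let env (y : R) : R := expR (1 - `|y| / 2).

Let env_integrable : mu.-integrable [set: R] (EFin \o env).
Proof.
have cenv : continuous env.
  move=> x; apply: cvg_expR_comp.
  apply: cvgB; first exact: cvg_cst.
  by apply: cvgM; [exact: norm_continuous|exact: cvg_cst].
apply/integrableP; split.
  by apply/measurable_EFinP; exact: continuous_measurable_fun.
under eq_integral do rewrite /= ger0_norm ?expR_ge0//.
rewrite ge0_symfun_integralT//; last 2 first.
  by move=> x; exact: expR_ge0.
  by move=> x; rewrite /env /= normrN.
rewrite (_ : [set x | 0 <= x] = `[0, +oo[%classic); last first.
  by apply/seteqP; split => x; rewrite /= in_itv/= andbT.
rewrite lte_mul_pinfty ?ltry//.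
apply: (@le_lt_trans _ _ (\int[mu]_x ((2 * expR 1)%:E * (exponential_pdf (1 / 2) x)%:E))%E); last first.
  rewrite ge0_integralZl_EFin//.
  - by rewrite integral_exponential_pdf ?mule1 ?ltry//; lra.
  - by move=> x _; rewrite lee_fin exponential_pdf_ge0//; lra.
  - by apply/measurable_EFinP; exact: measurable_exponential_pdf.
rewrite integral_mkcond le_eqVlt; apply/orP; left; apply/eqP.
apply: eq_integral => x _; rewrite patchE /exponential_pdf patchE.
case: ifPn => [|_]; last by rewrite mule0.
rewrite inE/= in_itv/= andbT => x0; rewrite -EFinM; congr EFin.
rewrite /env ger0_norm// expRD; have -> : - (1 / 2) * x = - (x / 2) by field.
by field.
Qed.

Let mcut n x : measurable_fun [set: R] (chi2_cut_profile n x).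
Proof.
apply: measurable_funM.
  by apply: measurableT_comp => //; apply: measurable_funN; exact: measurable_funM.
apply: measurable_sqrt_pow; apply: measurable_funD => //; apply: measurable_funM => //.
exact: measurable_minr.
Qed.

Let mprof n : measurable_fun [set: R] (@chi2_profile R n).
Proof.
apply: measurable_funM.
  by apply: measurableT_comp => //; apply: measurable_funN; exact: measurable_funM.
by apply: measurable_sqrt_pow; apply: measurable_funD => //; exact: measurable_funM.
Qed.

Let cvg_integral (f : nat -> R -> R) (g : R -> R) :
  (forall n, measurable_fun [set: R] (f n)) ->
  (forall y, f n y @[n --> \oo] --> g y) ->
  (forall n y, (2 <= n)%N -> 0 <= f n y <= env y) ->
  (\int[mu]_y (f n y)%:E @[n --> \oo] --> \int[mu]_y (g y)%:E)%E.
Proof.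
(* The envelope dominates only from index 2 on, so the sequence is shifted. *)
move=> mf fg fe; rewrite -(cvg_shiftn 2).
apply: (@dominated_cvg _ _ _ mu setT measurableT (fun n => EFin \o f (n + 2)%N) (EFin \o g) (EFin \o env)) => //.
- by move=> n; apply/measurable_EFinP; exact: mf.
- move=> y _; apply: cvg_EFin; first by near=> n.
  by have := fg y; rewrite -(cvg_shiftn 2).
- move=> n y _; have n2 : (2 <= n + 2)%N by rewrite leq_addl.
  have /andP[h1 h2] := fe (n + 2)%N y n2.
  by rewrite /= lee_fin ger0_norm.
Unshelve. all: by end_near.
Qed.

Let cut_lim (x y : R) : R := if y <= x then expR (- (y ^+ 2 / 2)) else 0.

Lemma cvg_integral_chi2_cut_profile x :
  (\int[mu]_y (chi2_cut_profile n x y)%:E @[n --> \oo] --> \int[mu]_y (cut_lim x y)%:E)%E.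
Proof.
apply: cvg_integral => [n|y|n y n2]; [exact: mcut|exact: cvg_chi2_cut_profile|].
rewrite chi2_cut_profile_ge0/=; apply: le_trans (chi2_cut_profile_le n x y) _.
exact: chi2_profile_le.
Qed.

Lemma cvg_integral_chi2_profile :
  (\int[mu]_y (chi2_profile n y)%:E @[n --> \oo] --> \int[mu]_y (expR (- (y ^+ 2 / 2)))%:E)%E.
Proof.
apply: cvg_integral => [n|y|n y n2]; [exact: mprof|exact: cvg_chi2_profile|].
by rewrite chi2_profile_ge0/=; exact: chi2_profile_le.
Qed.

Lemma lebesgue_tuple_tball_real n (s : R) :
  lam n.+1 (tball s) = ((Num.sqrt s ^+ n.+1)%:E * lam n.+1 (tball 1))%E.
Proof.
have [s0|s0] := leP 0 s; first exact: lebesgue_tuple_tball.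
rewrite ler0_sqrtr ?ltW// expr0n mul0e (_ : tball s = set0) ?measure0//.
by rewrite -subset0 => y; rewrite /tball/= => /(le_trans (dotp_ge0 y)); rewrite leNgt s0.
Qed.

(* Substitute s = n + sqrt (2 n) y in the layer formula. *)
Lemma std_normal_tuple_profile n : exists c : R, [/\ 0 <= c,
  (c%:E * \int[mu]_y (chi2_profile n.+1 y)%:E = 1)%E &
  forall x, gam n.+1 (tball (n.+1%:R + x * Num.sqrt (2 * n.+1%:R))) =
    (c%:E * \int[mu]_y (chi2_cut_profile n.+1 x y)%:E)%E].
Proof.
set N : R := n.+1%:R; have N0 : 0 < N by rewrite ltr0n.
pose r := Num.sqrt (2 / N); have r0 : 0 < r by rewrite sqrtr_gt0 divr_gt0.
have r2 : r ^+ 2 = 2 / N by rewrite sqr_sqrtr// ltW// divr_gt0.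
pose sg := Num.sqrt (2 * N); have sg0 : 0 < sg by rewrite sqrtr_gt0 mulr_gt0.
have sgr : sg = N * r.
  rewrite -[RHS]ger0_norm ?mulr_ge0 ?ltW// -sqrtr_sqr exprMn r2.
  by congr Num.sqrt; field; rewrite gt_eqF.
have sgV : sg / 2 = r^-1.
  have : sg * r = 2 by rewrite sgr -mulrA -expr2 r2; field; rewrite gt_eqF.
  by move=> <-; field; rewrite !gt_eqF.
have /andP[w0 wy] := @lebesgue_tuple_tball1 R n.+1.
have wE : lam n.+1 (tball 1) = (fine (lam n.+1 (tball 1)))%:E by rewrite fineK// ge0_fin_numE// ltW.
set w := fine (lam n.+1 (tball 1)) in wE.
have w0' : 0 <= w by rewrite fine_ge0// ltW.
pose k := expR (- (N / 2)) / 2 * Num.sqrt N ^+ n.+1.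
have k0 : 0 <= k by rewrite mulr_ge0 ?divr_ge0 ?expR_ge0 ?exprn_ge0 ?sqrtr_ge0.
pose c := @normal_peak R 1 ^+ n.+1 * (sg * (k * w)).
have c0 : 0 <= c by rewrite !mulr_ge0 ?exprn_ge0 ?normal_peak_ge0// ltW.
have h0 s : 0 <= half_exp s :> R by rewrite divr_ge0 ?expR_ge0.
(* One computation with one constant for both events: the whole space, which fixes the constant by
   total mass 1, and the ball. *)
have key (A : set (n.+1.-tuple R)) (f : R -> R) : measurable A -> measurable_fun [set: R] f ->
    (forall y, 0 <= f y) ->
    (forall y, ((half_exp (sg * y + N))%:E * lam n.+1 (A `&` tball (sg * y + N)) = (k * w * f y)%:E)%E) ->
    (gam n.+1 A = c%:E * \int[mu]_y (f y)%:E)%E.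
  move=> mA mf f0 H; rewrite std_normal_tuple_layers//.
  rewrite /c EFinM -muleA; congr (_ * _)%E.
  pose g s := ((half_exp s)%:E * lam n.+1 (A `&` tball s))%E.
  have mg : measurable_fun [set: R] g.
    apply: emeasurable_funM; first by apply/measurable_EFinP; exact: measurable_half_exp.
    exact: measurable_ball_section.
  have g0 s : (0 <= g s)%E by rewrite mule_ge0 ?lee_fin ?h0 ?measure_ge0.
  have aff := ge0_integral_affine N sg0 mg g0.
  have -> : (\int[mu]_s g s = sg%:E * \int[mu]_y g (sg * y + N)%R)%E.
    by rewrite aff muleA -EFinM mulfV ?mul1e// gt_eqF.
  rewrite EFinM -muleA; congr (_ * _)%E.
  rewrite -ge0_integralZl_EFin//.
  - by apply: eq_integral => y _; rewrite /g H EFinM.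
  - by move=> y _; rewrite lee_fin.
  - by apply/measurable_EFinP.
  - by rewrite mulr_ge0.
have hE y : half_exp (sg * y + N) = expR (- (N / 2)) / 2 * expR (- (y / r)).
  rewrite /half_exp mulrAC -expRD; congr (expR _ / 2).
  have -> : y / r = y * (sg / 2) by rewrite sgV.
  by field.
have sE z : Num.sqrt (sg * z + N) = Num.sqrt N * Num.sqrt (1 + z * r).
  rewrite -sqrtrM ?ltW//; congr Num.sqrt.
  by rewrite sgr; ring.
exists c; split => //.
- rewrite -(key setT)//.
  + exact: std_normal_tuple_setT.
  + by move=> y; exact: chi2_profile_ge0.
  + move=> y; rewrite setTI lebesgue_tuple_tball_real wE -!EFinM hE sE; congr EFin.
    by rewrite /chi2_profile -/N -/r /k exprMn; ring.
- move=> x; apply: key.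
  + exact: measurable_tball.
  + exact: mcut.
  + by move=> y; exact: chi2_cut_profile_ge0.
  + move=> y; have -> : tball (N + x * Num.sqrt (2 * N)) `&` tball (sg * y + N) =
        @tball R n.+1 (sg * Num.min x y + N).
      apply/seteqP; split => z; rewrite /tball/= -/sg -[x * sg]mulrC [N + _]addrC.
        by move=> [h1 h2]; case: (leP x y).
      have : sg * Num.min x y <= sg * x by rewrite ler_pM2l// ge_min lexx.
      have : sg * Num.min x y <= sg * y by rewrite ler_pM2l// ge_min lexx orbT.
      by move=> h1 h2 h3; split; lra.
    rewrite lebesgue_tuple_tball_real wE -!EFinM hE sE; congr EFin.
    by rewrite /chi2_cut_profile -/N -/r /k exprMn; ring.
Qed.

(** From c A = 1 the integral A is finite and nonzero and c B = B/A, which eliminates the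
    constant. *)
Let fine_ratio (c : R) (A B : \bar R) : 0 <= c -> (0 <= B <= A)%E -> (c%:E * A = 1)%E ->
  [/\ A \is a fin_num, B \is a fin_num, fine A != 0 & fine (c%:E * B)%E = fine B / fine A].
Proof.
move=> c0 /andP[B0 BA] cA.
have A0 : (0 <= A)%E by exact: le_trans BA.
have Afin : A \is a fin_num.
  rewrite ge0_fin_numE// ltNge leye_eq; apply/eqP => Aoo.
  move: cA; rewrite Aoo; have [->|c1] := eqVneq c 0; first by rewrite mul0e => -[] /eqP; rewrite eq_sym oner_eq0.
  by rewrite gt0_muley// lte_fin lt_neqAle eq_sym c1.
have Bfin : B \is a fin_num by rewrite ge0_fin_numE// (le_lt_trans BA)// ltey_eq Afin.
have cA' : c * fine A = 1 by move: cA; rewrite -(fineK Afin) -EFinM => -[].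
have A1 : fine A != 0 by apply/eqP => A1; move: cA'; rewrite A1 mulr0 => /eqP; rewrite eq_sym oner_eq0.
split => //; rewrite -{1}(fineK Bfin) -EFinM /= mulrC; congr (_ * _).
by rewrite -[RHS]mul1r -cA' mulfK.
Qed.

(** Both the chi-squared and the normal probability are the cut integral over the full integral, so
    the convergence of numerator and denominator suffices. *)
Lemma cvg_std_normal_tball x :
  fine (gam n (tball (n%:R + x * Num.sqrt (2 * n%:R)))) @[n --> \oo] -->
  fine (@normal_prob R 0 1 `]-oo, x]%classic).
Proof.
have pk0 : 0 <= @normal_peak R 1 by exact: normal_peak_ge0.
have me : measurable_fun [set: R] (fun y : R => expR (- (y ^+ 2 / 2))).
  apply: measurableT_comp => //; apply: measurable_funN; apply: measurable_funM => //.
have mc : measurable_fun [set: R] (cut_lim x).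
  apply: measurable_fun_ifT => //; apply: (measurable_fun_bool true); rewrite setTI.
  by rewrite (_ : _ @^-1` _ = [set y | y <= x])//; exact: measurable_set_le.
have pdfE y : normal_pdf 0 1 y = @normal_peak R 1 * expR (- (y ^+ 2 / 2)).
  by rewrite normal_pdfE ?oner_neq0// /normal_fun; congr (_ * expR _); field.
pose A := (\int[mu]_y (expR (- (y ^+ 2 / 2)))%:E)%E.
pose B := (\int[mu]_y (cut_lim x y)%:E)%E.
have cA : ((@normal_peak R 1)%:E * A = 1)%E.
  rewrite -(@integral_normal_pdf R 0 1) /A -ge0_integralZl_EFin//.
  - by apply: eq_integral => y _; rewrite pdfE.
  - by apply/measurable_EFinP.
have cut0 y : 0 <= cut_lim x y by rewrite /cut_lim; case: ifP => // _; exact: expR_ge0.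
have cB : ((@normal_peak R 1)%:E * B = @normal_prob R 0 1 `]-oo, x]%classic)%E.
  rewrite /normal_prob [RHS]integral_mkcond /B -ge0_integralZl_EFin//.
  - apply: eq_integral => y _; rewrite patchE mem_setE in_itv/= /cut_lim; case: ifP => _.
      by rewrite pdfE.
    by rewrite mule0.
  - by move=> y _; rewrite lee_fin.
  - by apply/measurable_EFinP.
have BA : (0 <= B <= A)%E.
  apply/andP; split; first by apply: integral_ge0 => y _; rewrite lee_fin.
  apply: ge0_le_integral => //.
  - by move=> y _; rewrite lee_fin.
  - by apply/measurable_EFinP.
  - by apply/measurable_EFinP.
  - by move=> y _; rewrite lee_fin /cut_lim; case: ifP => // _; exact: expR_ge0.
have [Afin Bfin A1 ABE] := fine_ratio pk0 BA cA.
rewrite -cB ABE -(cvg_shiftS).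
have cvA : fine (\int[mu]_y (chi2_profile n y)%:E)%E @[n --> \oo] --> fine A.
  by apply: fine_cvg; rewrite fineK//; exact: cvg_integral_chi2_profile.
have cvB : fine (\int[mu]_y (chi2_cut_profile n x y)%:E)%E @[n --> \oo] --> fine B.
  by apply: fine_cvg; rewrite fineK//; exact: cvg_integral_chi2_cut_profile.
rewrite -(cvg_shiftS) in cvA; rewrite -(cvg_shiftS) in cvB.
apply: cvg_trans (cvgM cvB (cvgV A1 cvA)); apply: near_eq_cvg; near=> n.
have [c [c0 c1 c2]] := std_normal_tuple_profile n.
have BAn : (0 <= \int[mu]_y (chi2_cut_profile n.+1 x y)%:E <= \int[mu]_y (chi2_profile n.+1 y)%:E)%E.
  apply/andP; split; first by apply: integral_ge0 => y _; rewrite lee_fin chi2_cut_profile_ge0.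
  apply: ge0_le_integral => //.
  - by move=> y _; rewrite lee_fin chi2_cut_profile_ge0.
  - by apply/measurable_EFinP; exact: mcut.
  - by apply/measurable_EFinP; exact: mprof.
  - by move=> y _; rewrite lee_fin chi2_cut_profile_le.
by have [_ _ _ E] := fine_ratio c0 BAn c1; rewrite /= c2 E.
Unshelve. all: by end_near.
Qed.

End chi2_clt.

(** * The three regimes *)

Section gumbel_cdf.
Context {R : realType}.

Lemma gumbel_cdf_limits :
  [/\ {homo @gumbel_cdf R : x y / x <= y}, continuous (@gumbel_cdf R),
      @gumbel_cdf R y @[y --> +oo] --> (1 : R) & @gumbel_cdf R y @[y --> -oo] --> (0 : R)].
Proof.
split.
- by move=> x y xy; rewrite /gumbel_cdf ler_expR lerN2 ler_expR lerN2.
- move=> x; apply: cvg_expR_comp.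
  apply: cvgN; apply: cvg_expR_comp.
  by apply: cvgN; exact: cvg_id.
- rewrite -[X in _ --> X](@expR0 R) -[X in _ --> expR X]oppr0.
  apply: cvg_expR_comp.
  by apply: cvgN; exact: cvgr_expR.
- apply/cvgrPdist_le => e e0; near=> y; rewrite sub0r normrN ger0_norm ?expR_ge0//.
  rewrite /gumbel_cdf -[e]lnK ?posrE// ler_expR lerNl.
  have A0 : 0 < `|ln e| + 1 by rewrite ltr_wpDl.
  apply: le_trans (ler_norm _) _; rewrite normrN; apply: (@le_trans _ _ (`|ln e| + 1)); first by rewrite lerDl.
  rewrite -[leLHS]lnK ?posrE// ler_expR lerNr.
  by near: y; apply: nbhs_ninfty_le; rewrite num_real.
Unshelve. all: by end_near.
Qed.

Lemma cdfr_gumbel dQ (TQ : measurableType dQ) (Q : probability TQ R) (H : {RV Q >-> R}) :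
  gumbel H -> cdfr Q H = gumbel_cdf.
Proof.
move=> gH; apply/funext => x; rewrite /cdfr -[RHS]/(fine (gumbel_cdf x)%:E) -gH.
by congr fine.
Qed.

End gumbel_cdf.

(* The law of (E, M) for E = |Z| and M = max_j <L_j, U>^2. *)
Definition radial_max_law {R : realType} dT (T : measurableType dT) (P : probability T R)
    (p d : nat) (E M : T -> R) := (forall w, 0 <= M w) /\
  forall t B, 0 <= t -> measurable B ->
    P ([set w | M w <= t] `&` [set w | B (E w)]) =
    (((1 - @cap_prob R d.-1 t) ^+ p)%:E * P [set w | B (E w)])%E.

Lemma cdfr_radial_max {R : realType} dT (T : measurableType dT) (P : probability T R)
    p d (E M : T -> R) t : radial_max_law P p d E M -> 0 <= t ->
  cdfr P M t = (1 - @cap_prob R d.-1 t) ^+ p.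
Proof.
move=> [_ law] t0; rewrite /cdfr -[[set w | M w <= t]]setIT.
have -> : setT = [set w | [set: R] (E w)] by [].
by rewrite law// (_ : [set w | [set: R] (E w)] = setT)// probability_setT mule1.
Qed.

(** * Radius and maximum as both p and d grow *)

Section radial_extremes.
Context {R : realType}.
Variables (p d : nat -> nat).
Hypotheses (poo : p n @[n --> \oo] --> \oo) (doo : d n @[n --> \oo] --> \oo).
Context (dT : nat -> measure_display) (T : forall n, measurableType (dT n))
  (P : forall n, probability (T n) R).
Variables (E M : forall n, T n -> R) (u v : nat -> R).
Arguments E : clear implicits.
Arguments M : clear implicits.
Hypotheses (mE : mfamily E) (mM : mfamily M).
Hypothesis uv0 : \forall n \near \oo, 0 < u n /\ 0 < v n.
Let law_at n := radial_max_law (P n) (p n) (d n) (E n) (M n).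
Hypothesis law : \forall n \near \oo, law_at n.

Context dF (TF : measurableType dF) (PF : probability TF R) (F : TF -> R).
Hypothesis mF : measurable_fun [set: TF] F.

Let Fn n (w : T n) : R := (E n w ^+ 2 - u n) / v n.
Arguments Fn : clear implicits.
Hypothesis cvgF : wcvg (fun n => cdfr (P n) (Fn n)) (cdfr PF F).

Let a n : R := a_pd (p n) (d n).
Let b n : R := b_pd (p n) (d n).
Let Gn n (w : T n) : R := (M n w - a n) / b n.
Arguments Gn : clear implicits.

Let mFn : mfamily Fn.
Proof.
move=> n; apply: measurable_funM => //; apply: measurable_funB => //.
by apply: measurable_funX; exact: mE.
Qed.

Let mGn : mfamily Gn.
Proof. by move=> n; apply: measurable_funM => //; apply: measurable_funB => //; exact: mM. Qed.

Let ab0 : \forall n \near \oo, 0 < a n /\ 0 < b n := near_a_pd_b_pd_gt0 poo doo.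

Let indep : \forall n \near \oo, forall x y,
  fine (P n ([set w | Fn n w <= x] `&` [set w | Gn n w <= y])) =
  cdfr (P n) (Fn n) x * cdfr (P n) (Gn n) y.
Proof.
near=> n => x y.
have [a0 b0] : 0 < a n /\ 0 < b n by near: n.
have [M0 lawn] : law_at n by near: n.
have GE : [set w | Gn n w <= y] = [set w | M n w <= a n + b n * y].
  apply/seteqP; split => w; rewrite /= /Gn ler_pdivrMr//; lra.
(* The joint law is known for nonnegative levels only; at a negative level both sides vanish, as the
   maximum is nonnegative. *)
rewrite {2}/cdfr GE; have [t0|t0] := leP 0 (a n + b n * y); last first.
  have -> : [set w | M n w <= a n + b n * y] = set0.
    rewrite -subset0 => w /= h; have := le_trans (M0 w) h.
    by rewrite leNgt t0.
  by rewrite setI0 measure0 mulr0.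
pose B := [set r : R | (r ^+ 2 - u n) / v n <= x].
have mB : measurable B.
  have mB' : measurable_fun [set: R] (fun r : R => (r ^+ 2 - u n) / v n).
    by apply: measurable_funM => //; apply: measurable_funB => //; exact: measurable_sqr.
  by apply: (measurable_set_le mB'); exact: measurable_cst.
have FE : [set w | Fn n w <= x] = [set w | B (E n w)] by [].
rewrite -/(cdfr (P n) (M n) _) (cdfr_radial_max (conj M0 lawn) t0) /cdfr FE setIC lawn//.
have mFx : measurable [set w | B (E n w)] by rewrite -FE; exact: measurable_cdf_set.
by rewrite -[X in (_ * X)%E]fineK ?fin_num_measure//= mulrC.
Unshelve. all: by end_near.
Qed.

Let cvgG x : cdfr (P n) (Gn n) x @[n --> \oo] --> gumbel_cdf x.
Proof.
have h := @cvg_max_cdf R p d poo doo x; apply: cvg_trans h; apply: near_eq_cvg; near=> n.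
have [a0 b0] : 0 < a n /\ 0 < b n by near: n.
have lawn : law_at n by near: n.
have t01 : 0 < a n + b n * x < 1 by near: n; exact: near_extreme_level.
have d3 : (3 <= d n)%N by near: n; have /cvgnyPge := doo; exact.
rewrite /cdfr; have -> : [set w | Gn n w <= x] = [set w | M n w <= a n + b n * x].
  apply/seteqP; split => w; rewrite /= /Gn ler_pdivrMr//; lra.
have [t0 _] := andP t01.
rewrite -/(cdfr (P n) (M n) _) (cdfr_radial_max lawn (ltW t0)).
have dE : d n = (d n).-1.+1 by rewrite prednK// (leq_trans _ d3).
by rewrite cap_prob_ratio// -?dE.
Unshelve. all: by end_near.
Qed.

Let wcvgG : wcvg (fun n => cdfr (P n) (Gn n)) gumbel_cdf.
Proof.
have [nd cg _ _] := @gumbel_cdf_limits R.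
have ndn n : {homo cdfr (P n) (Gn n) : x y / x <= y}.
  by apply: nondecreasing_cdfr; exact: mGn.
have rG x : @gumbel_cdf R y @[y --> x^'+] --> gumbel_cdf x.
  by apply: cvg_at_right_filter; exact: cg.
by apply/(wcvgP ndn nd rG) => x _; exact: cvgG.
Qed.

Let tightG : tight P Gn.
Proof. by have [_ _ h1 h0] := @gumbel_cdf_limits R; exact: wcvg_tight wcvgG h1 h0. Qed.

Let tightF : tight P Fn.
Proof. by have [_ h1 h0] := cdfr_limits PF mF; exact: wcvg_tight cvgF h1 h0. Qed.

Let tau n := b n / a n.
Let rho n := (u n * b n) / (v n * a n).

Let cvg_tau : tau n @[n --> \oo] --> 0 := cvg_b_pd_div_a_pd poo doo.

Lemma wcvg_near_eq (f g : nat -> R -> R) (G : R -> R) :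
  (\forall n \near \oo, f n = g n) -> wcvg f G -> wcvg g G.
Proof.
move=> fg fG x e e0; near=> n.
have <- : f n = g n by near: n.
by near: n; exact: fG.
Unshelve. all: by end_near.
Qed.

Let FG n (w : T n) := Fn n w * Gn n w.

Let mFG : mfamily FG.
Proof. by move=> n; apply: measurable_funM; [exact: mFn|exact: mGn]. Qed.

Let tightFG : tight P FG.
Proof. exact: (tightM mFn mGn tightF tightG). Qed.

Let Kn n (w : T n) : R := E n w ^+ 2 * M n w.

Let radial_expansion : \forall n \near \oo,
  (fun w => (Kn w - u n * a n) / (v n * a n)) =
  (fun w => Fn n w + (rho n * Gn n w + tau n * FG w)).
Proof.
near=> n.
have [a0 b0] : 0 < a n /\ 0 < b n by near: n.
have [u0 v0] : 0 < u n /\ 0 < v n by near: n.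
apply/funext => w; rewrite /Kn /FG /Fn /Gn /rho /tau.
by field; rewrite !gt_eqF.
Unshelve. all: by end_near.
Qed.

Lemma wcvg_radial_dominant : (v n * a n) / (u n * b n) @[n --> \oo] --> +oo ->
  wcvg (fun n => cdfr (P n) (fun w => (Kn w - u n * a n) / (v n * a n))) (cdfr PF F).
Proof.
move=> roo; have r0 : rho n @[n --> \oo] --> 0.
  rewrite (_ : rho = fun n => ((v n * a n) / (u n * b n))^-1); last first.
    by apply/funext => n; rewrite invf_div.
  by apply/gtr0_cvgV0 => //; exact: cvgry_gt.
apply: (@wcvg_near_eq (fun n => cdfr (P n) (fun w => Fn n w + (rho n * Gn n w + tau n * FG w)))).
  by near=> n; congr cdfr; apply/esym; near: n; exact: radial_expansion.
exact: (wcvg_add_negligible mFn mGn mFG (nondecreasing_cdfr PF mF) cvgF).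
Unshelve. all: by end_near.
Qed.

Lemma wcvg_radial_balanced (c : R) dQ (TQ : measurableType dQ) (Q : probability TQ R)
    (F' H : {RV Q >-> R}) : 0 < c ->
  (v n * a n) / (u n * b n) @[n --> \oo] --> c ->
  cdfr Q F' = cdfr PF F -> gumbel H -> independent2 Q F' H ->
  wcvg (fun n => cdfr (P n) (fun w => (Kn w - u n * a n) / (v n * a n)))
    (cdfr Q (fun w => F' w + 1 / c * H w)).
Proof.
move=> c0 rc F'F gH F'H.
have r0 : rho n @[n --> \oo] --> 1 / c.
  rewrite (_ : rho = fun n => ((v n * a n) / (u n * b n))^-1); last first.
    by apply/funext => n; rewrite invf_div.
  by rewrite div1r; apply: cvgV => //; rewrite gt_eqF.
have r0' : rho n - 1 / c @[n --> \oo] --> 0.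
  by rewrite -[X in _ --> X](subrr (1 / c)); apply: cvgB => //; exact: cvg_cst.
pose Y n (w : T n) := 1 / c * Gn n w.
have cdfZ dT' (T' : measurableType dT') (P' : probability T' R) (X : T' -> R) y :
    cdfr P' (fun w => 1 / c * X w) y = cdfr P' X (c * y).
  by rewrite /cdfr; congr (fine (P' _)); apply/seteqP; split => w;
    rewrite /= div1r ler_pdivrMl.
have mY : mfamily Y by move=> n; apply: measurable_funM => //; exact: mGn.
have mH : measurable_fun [set: TQ] (fun w => 1 / c * H w) by exact: measurable_funM.
have sumFY : wcvg (fun n => cdfr (P n) (Fn n \+ @Y n)) (cdfr Q (F' \+ (fun w => 1 / c * H w))).
  apply: (wcvg_independent_sum mFn mY) => //.
  - near=> n => x y; rewrite cdfZ.
    have <- : [set w | Gn n w <= c * y] = [set w | Y n w <= y].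
      by apply/seteqP; split => w; rewrite /= /Y div1r ler_pdivrMl.
    by move: x (c * y); near: n; exact: indep.
  - move=> x y; rewrite cdfZ /cdfr -fineM ?fin_num_measure//; [|exact: measurable_cdf_set..].
    have mle z : measurable [set r : R | r <= z] by exact: measurable_set_le.
    rewrite -(F'H _ _ (mle x) (mle (c * y))); congr (fine (Q (_ `&` _))).
    by apply/seteqP; split => w; rewrite /= div1r ler_pdivrMl.
  - by rewrite F'F.
  - move=> y; rewrite cdfZ (cdfr_gumbel gH); under eq_fun do rewrite cdfZ; exact: cvgG.
have mFY : mfamily (fun n => Fn n \+ @Y n).
  by move=> n; apply: measurable_funD; [exact: mFn|exact: mY].
apply: (@wcvg_near_eq (fun n => cdfr (P n)
    (fun w => Fn n w + Y n w + ((rho n - 1 / c) * Gn n w + tau n * FG w)))).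
  near=> n; congr cdfr; apply/esym; transitivity (fun w => Fn n w + (rho n * Gn n w + tau n * FG w)).
    by near: n; exact: radial_expansion.
  by apply/funext => w; rewrite /Y; ring.
apply: (wcvg_add_negligible mFY mGn mFG _ sumFY) => //.
by apply: nondecreasing_cdfr; exact: measurable_funD.
Unshelve. all: by end_near.
Qed.

(** Normalised by u b, the expansion is G + (v a)/(u b) F + (v/u) F G; the last coefficient is the
    vanishing ratio times b/a. *)
Lemma wcvg_radial_negligible dQ (TQ : measurableType dQ) (Q : probability TQ R)
    (H : {RV Q >-> R}) :
  (v n * a n) / (u n * b n) @[n --> \oo] --> 0 -> gumbel H ->
  wcvg (fun n => cdfr (P n) (fun w => (Kn w - u n * a n) / (u n * b n))) (cdfr Q H).
Proof.
move=> r0 gH; rewrite (cdfr_gumbel gH).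
pose r n := (v n * a n) / (u n * b n).
pose k n := r n * tau n.
have k0 : k n @[n --> \oo] --> 0 by rewrite -[0](mulr0 0); exact: cvgM.
apply: (@wcvg_near_eq (fun n => cdfr (P n) (fun w => Gn n w + (r n * Fn n w + k n * FG w)))).
  near=> n; congr cdfr; apply/funext => w.
  have [a0 b0] : 0 < a n /\ 0 < b n by near: n.
  have [u0 v0] : 0 < u n /\ 0 < v n by near: n.
  rewrite /k /r /tau /Kn /FG /Fn /Gn.
  by field; rewrite !gt_eqF.
have [nd _ _ _] := @gumbel_cdf_limits R.
exact: (wcvg_add_negligible mGn mFn mFG nd wcvgG).
Unshelve. all: by end_near.
Qed.

End radial_extremes.

Lemma cap_prob_le1 (R : realType) n (t : R) : @cap_prob R n t <= 1.
Proof.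
have /andP[w0 wy] := @lebesgue_tuple_tball1 R n.+1.
rewrite /cap_prob ler_pdivrMr ?fine_gt0 ?w0// mul1r fine_le//.
- rewrite ge0_fin_numE//; apply: le_lt_trans wy; rewrite le_measure ?inE//.
  + exact: measurable_cone.
  + exact: measurable_tball.
  + by move=> z [/andP[]].
- by rewrite ge0_fin_numE// ltW.
- rewrite le_measure ?inE//; [exact: measurable_cone|exact: measurable_tball|].
  by move=> z [/andP[]].
Qed.

(** * Fixed dimension *)

Section fixed_dimension.
Context {R : realType}.
Context (dT : nat -> measure_display) (T : forall n, measurableType (dT n))
  (P : forall n, probability (T n) R).

Lemma cvg_prob0_tight (X Y : forall n, T n -> R) : mfamily X -> mfamily Y ->
  tight P X -> cvg_prob0 P Y -> cvg_prob0 P (fun n => X n \* Y n).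
Proof.
move=> mX mY tX Y0 e e0; apply/cvgrPdist_le => f f0; have f20 : 0 < f / 2 by rewrite divr_gt0.
have mXY : mfamily (fun n => X n \* Y n) by move=> k; exact: measurable_funM.
have [N N0 hN] := tX _ f20.
have eN : 0 < e / N by rewrite divr_gt0.
near=> n; rewrite sub0r normrN ger0_norm ?exceed_ge0//.
have h1 : exceed P X n N <= f / 2 by near: n.
have h2 : exceed P Y n (e / N) <= f / 2 by near: n; apply: (cvgr_le _ (Y0 _ eN)).
suff : exceed P (fun n => X n \* Y n) n e <= exceed P X n N + exceed P Y n (e / N) by lra.
apply: le_trans (fineP_U_le _ (measurable_exceed _ _ mX) (measurable_exceed _ _ mY)).
apply: fineP_le; [exact: (@measurable_exceed _ _ _ _ n _ mXY)|by apply: measurableU; exact: measurable_exceed|].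
move=> w /=; rewrite normrM => h; case: (ltP N `|X n w|); [by left|move=> XN; right].
rewrite ltNge; apply/negP => YN; move: h; rewrite ltNge => /negP; apply.
by rewrite -(mulfVK (lt0r_neq0 N0) e) mulrC ler_pM.
Unshelve. all: by end_near.
Qed.

(** Every cap has positive probability g, so the maximum stays below 1 - f with probability (1-g)^p,
    which tends to 0. Hence M tends to 1 in probability and K = E^2 + E^2 (M - 1) is a small
    perturbation of E^2. *)
Lemma wcvg_radial_fixed m (p : nat -> nat) (E M : forall n, T n -> R) (G : R -> R) :
  p n @[n --> \oo] --> \oo -> mfamily E -> mfamily M ->
  {homo G : x y / x <= y} -> G y @[y --> +oo] --> (1 : R) -> G y @[y --> -oo] --> (0 : R) ->
  (\forall n \near \oo, radial_max_law (P n) (p n) m.+2 (E n) (M n)) ->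
  (\forall n \near \oo, cdfr (P n) (fun w => E n w ^+ 2) = G) ->
  wcvg (fun n => cdfr (P n) (fun w => E n w ^+ 2 * M n w)) G.
Proof.
move=> poo mE mM ndG G1 G0 law EG.
have mE2 : mfamily (fun n (w : T n) => E n w ^+ 2) by move=> n; apply: measurable_funX; exact: mE.
have mM1 : mfamily (fun n (w : T n) => M n w - 1) by move=> n; apply: measurable_funB.
have EE : wcvg (fun n => cdfr (P n) (fun w => E n w ^+ 2)) G.
  move=> x e e0; near=> n; have -> : cdfr (P n) (fun w => E n w ^+ 2) = G by near: n.
  by apply/andP; split; [have : G (x - e) <= G x by apply: ndG; lra|
    have : G x <= G (x + e) by apply: ndG; lra]; lra.
have tE := wcvg_tight mE2 EE G1 G0.
have capM : \forall n \near \oo, forall t, 0 <= t ->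
    cdfr (P n) (M n) t = (1 - @cap_prob R m.+1 t) ^+ p n.
  near=> n => t t0; apply: (@cdfr_radial_max _ _ _ _ _ m.+2 (E n)) => //.
  by near: n.
have M0 : cvg_prob0 P (fun n (w : T n) => M n w - 1).
  (* Capping at 1/2 keeps the level [1 - f] inside ]0, 1[, where caps have positive probability. *)
  move=> e e0; pose f := Num.min e (1 / 2).
  have f0 : 0 < f by rewrite lt_min e0; lra.
  have fe : f <= e by rewrite ge_min lexx.
  have f2 : f <= 1 / 2 by rewrite ge_min lexx orbT.
  have f01 : 0 < 1 - f < 1 by apply/andP; split; lra.
  have g0 := cap_prob_gt0 m f01; set g := cap_prob (1 - f) in g0.
  apply: (@squeeze_cvgr _ _ _ _ (fun=> 0) (fun n => (1 - g) ^+ p n)).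
  - near=> n; rewrite exceed_ge0/=.
    have cM : forall t, 0 <= t -> cdfr (P n) (M n) t = (1 - @cap_prob R m.+1 t) ^+ p n by near: n.
    have mc r : measurable [set w | M n w <= r] by exact: measurable_cdf_set.
    have M1 : fine (P n (~` [set w | M n w <= 1])) = 0.
      by rewrite fineP_setC// -/(cdfr (P n) (M n) 1) cM// cap_prob1 subr0 expr1n subrr.
    rewrite -cM; last by lra.
    rewrite -[leRHS]addr0 -M1; apply: le_trans (fineP_U_le _ (mc _) (measurableC (mc _))).
    apply: fineP_le; [exact: (@measurable_exceed _ _ _ _ n _ mM1)|by apply: measurableU => //; exact: measurableC|].
    move=> w /= h; case: (leP (M n w) (1 - f)) => h1; first by left.
    right => h2; move: h; rewrite ltNge => /negP; apply.
    by rewrite ler_norml; apply/andP; split; lra.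
  - exact: cvg_cst.
  - have g1 : g <= 1 by exact: cap_prob_le1.
    have h : `|1 - g| < 1 by rewrite ltr_norml; apply/andP; split; lra.
    exact: (cvg_comp p (fun k => (1 - g) ^+ k) poo (cvg_expr h)).
have -> : (fun n => cdfr (P n) (fun w => E n w ^+ 2 * M n w)) =
  (fun n => cdfr (P n) (fun w => E n w ^+ 2 + E n w ^+ 2 * (M n w - 1))).
  by apply/funext => n; congr cdfr; apply/funext => w; ring.
apply: (wcvg_perturb mE2 _ ndG EE).
  by move=> n; apply: measurable_funD; [exact: mE2|apply: measurable_funM; [exact: mE2|exact: mM1]].
rewrite (_ : (fun n => _) = (fun n => (fun w : T n => E n w ^+ 2) \* (fun w => M n w - 1))).
  exact: cvg_prob0_tight.
by apply: functional_extensionality_dep => n; apply/funext => w; rewrite /= addrC addKr.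
Unshelve. all: by end_near.
Qed.

End fixed_dimension.

(** * The factorisation of K and its transfer to the array of models *)

Section radial_decomposition.
Context {R : realType} dT (T : measurableType dT) (P : probability T R) (p d : nat).
Variables (L : 'I_p -> {RV P >-> d.-tuple R}) (Z : {RV P >-> d.-tuple R}).

Lemma measurable_K_pd : measurable_fun [set: T] (fun w => K_pd (fun j => L j w) (Z w)).
Proof.
apply: measurable_bigmax => j; apply: measurable_funX; apply: measurableT_comp => //.
exact: measurable_dotp.
Qed.

Lemma measurable_enorm_rv : measurable_fun [set: T] (fun w => enorm (Z w)).
Proof. by apply: measurable_enorm; exact: measurable_funPT. Qed.

(** The existential form hides that [maxdir_rv] is typed in a successor dimension. Measurability is
    required for all [d], so that the maximum can be chosen as a total family; the rest only where
    the sample is uniform. *)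
Lemma radial_decomposition : exists M : T -> R, measurable_fun [set: T] M /\
  ((2 <= d)%N -> uniform_sample L Z ->
   (forall w, K_pd (fun j => L j w) (Z w) = enorm (Z w) ^+ 2 * M w) /\
   radial_max_law P p d (fun w => enorm (Z w)) M).
Proof.
case: d L Z => [|n] L' Z'; first by exists (fun=> 0).
exists (maxdir_rv L' Z'); split; first exact: measurable_maxdir_rv.
move=> _ LZ; split; first by move=> w; rewrite K_pdE.
by split=> [w|t B t0 mB]; [exact: maxdir_ge0|exact: max_direction_law].
Qed.

End radial_decomposition.

Section radial_laws.
Context {R : realType} (disp : nat -> nat -> measure_display)
  (T : forall p d : nat, measurableType (disp p d))
  (P : forall p d : nat, probability (T p d) R).
Variables (Z : forall p d : nat, {RV (P p d) >-> d.-tuple R})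
  (L : forall p d : nat, 'I_p -> {RV (P p d) >-> d.-tuple R}).
Arguments Z : clear implicits.
Arguments L : clear implicits.
Hypothesis LZ : forall p d, (2 <= p)%N -> (2 <= d)%N -> uniform_sample (L p d) (Z p d).

Let K p d (w : T p d) : R := K_pd (fun j => L p d j w) (Z p d w).
Let E p d (w : T p d) : R := enorm (Z p d w).

Let M p d : T p d -> R := projT1 (cid (radial_decomposition (L p d) (Z p d))).
Arguments K : clear implicits.
Arguments E : clear implicits.
Arguments M : clear implicits.

Let mM p d : measurable_fun [set: T p d] (M p d).
Proof. by rewrite /M; case: cid => /= ? []. Qed.

Let MP p d : (2 <= p)%N -> (2 <= d)%N ->
  (forall w, K p d w = E p d w ^+ 2 * M p d w) /\ radial_max_law (P p d) p d (E p d) (M p d).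
Proof. by move=> p2 d2; rewrite /M; case: cid => /= ? [_]; apply => //; exact: LZ. Qed.

Let mE p d : measurable_fun [set: T p d] (E p d) := measurable_enorm_rv (Z p d).
Let mK p d : measurable_fun [set: T p d] (K p d) := measurable_K_pd (L p d) (Z p d).

Lemma cvg_law_fixed_dimension d dQ (TQ : measurableType dQ) (Q : probability TQ R)
    (Y : TQ -> R) : (2 <= d)%N -> measurable_fun [set: TQ] Y ->
  (forall p, (2 <= p)%N -> cdfr (P p d) (fun w => E p d w ^+ 2) = cdfr Q Y) ->
  cvg_law (fun p => pushforward (P p d) (K p d)) (pushforward Q Y).
Proof.
move=> d2 mY EY; apply/(@cvg_lawP R (disp^~ d) (T^~ d) (P^~ d)) => //.
have [_ Y1 Y0] := cdfr_limits Q mY.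
have near2 : \forall n \near \oo, (2 <= n)%N by exact: nbhs_infty_ge.
apply: (@wcvg_near_eq R (fun p => cdfr (P p d) (fun w => E p d w ^+ 2 * M p d w))).
  near=> p; congr cdfr; apply/funext => w.
  have p2 : (2 <= p)%N by near: p.
  by have [->] := MP p2 d2.
have dE : d = (d - 2).+2 by rewrite -addn2 subnK.
apply: (@wcvg_radial_fixed R (disp^~ d) (T^~ d) (P^~ d) (d - 2)%N id (fun p => E p d) (fun p => M p d)) => //.
- exact: nondecreasing_cdfr.
- by near=> p; rewrite -dE; have [] // := @MP p d _ d2; near: p.
- by near=> p; apply: EY; near: p.
Unshelve. all: by end_near.
Qed.

Section high_dimension.
Variables (p d : nat -> nat).
Hypotheses (poo : p n @[n --> \oo] --> \oo) (doo : d n @[n --> \oo] --> \oo).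
Variables (u v : nat -> R).
Hypothesis uv0 : forall d, (2 <= d)%N -> 0 < u d /\ 0 < v d.
Context dF (TF : measurableType dF) (PF : probability TF R) (F : {RV PF >-> R}).
Hypothesis cvgF : wcvg (fun n => cdfr (P (p n) (d n))
  (fun w => (E (p n) (d n) w ^+ 2 - u (d n)) / v (d n))) (cdfr PF F).

Let a n : R := a_pd (p n) (d n).
Let b n : R := b_pd (p n) (d n).
Let ratio n := (v (d n) * a n) / (u (d n) * b n).

Let near_p2 : \forall n \near \oo, (2 <= p n)%N.
Proof. by have /cvgnyPge := poo; exact. Qed.

Let near_d2 : \forall n \near \oo, (2 <= d n)%N.
Proof. by have /cvgnyPge := doo; exact. Qed.

Let uvd : \forall n \near \oo, 0 < (u \o d) n /\ 0 < (v \o d) n.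
Proof. by near=> n; apply: uv0; near: n. Unshelve. all: by end_near. Qed.

Let law : \forall n \near \oo,
  radial_max_law (P (p n) (d n)) (p n) (d n) (E (p n) (d n)) (M (p n) (d n)).
Proof.
near=> n; have p2 : (2 <= p n)%N by near: n.
have d2 : (2 <= d n)%N by near: n.
by have [] := MP p2 d2.
Unshelve. all: by end_near.
Qed.

Let KE (f : forall n, R -> R) : \forall n \near \oo,
  cdfr (P (p n) (d n)) (fun w => f n (E (p n) (d n) w ^+ 2 * M (p n) (d n) w)) =
  cdfr (P (p n) (d n)) (fun w => f n (K (p n) (d n) w)).
Proof.
near=> n; have p2 : (2 <= p n)%N by near: n.
have d2 : (2 <= d n)%N by near: n.
by congr cdfr; apply/funext => w; have [->] := MP p2 d2.
Unshelve. all: by end_near.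
Qed.

Let mstd n (r s : R) : measurable_fun [set: T (p n) (d n)]
  (fun w => (K (p n) (d n) w - r) / s).
Proof. by apply: measurable_funM => //; apply: measurable_funB. Qed.

Let dispn n := disp (p n) (d n).
Let Tn n := T (p n) (d n).
Let Pn n := P (p n) (d n).

Lemma cvg_law_high_dimension :
  [/\ ratio n @[n --> \oo] --> +oo ->
      cvg_law (fun n => pushforward (P (p n) (d n))
        (fun w => (K (p n) (d n) w - u (d n) * a n) / (v (d n) * a n)))
        (distribution PF F),
      forall c : R, 0 < c -> ratio n @[n --> \oo] --> c ->
      forall (dQ : measure_display) (TQ : measurableType dQ)
          (Q : probability TQ R) (F' H : {RV Q >-> R}),
        same_law (distribution Q F') (distribution PF F) ->
        gumbel H -> independent2 Q F' H ->
        cvg_law (fun n => pushforward (P (p n) (d n))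
          (fun w => (K (p n) (d n) w - u (d n) * a n) / (v (d n) * a n)))
          (pushforward Q (fun w => F' w + 1 / c * H w)) &
      ratio n @[n --> \oo] --> (0 : R) ->
      forall (dQ : measure_display) (TQ : measurableType dQ)
          (Q : probability TQ R) (H : {RV Q >-> R}),
        gumbel H ->
        cvg_law (fun n => pushforward (P (p n) (d n))
          (fun w => (K (p n) (d n) w - u (d n) * a n) / (u (d n) * b n)))
          (distribution Q H)].
Proof.
have mEn : @mfamily R dispn Tn (fun n => E (p n) (d n)) by move=> n; exact: mE.
have mMn : @mfamily R dispn Tn (fun n => M (p n) (d n)) by move=> n; exact: mM.
have mF : measurable_fun [set: TF] F by exact: measurable_funPT.
split.
- move=> roo; apply/(@cvg_lawP R dispn Tn Pn) => //; first by move=> n; exact: mstd.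
  have k := KE (fun n x => (x - u (d n) * a n) / (v (d n) * a n)); apply: (wcvg_near_eq k).
  exact: (wcvg_radial_dominant poo doo mEn mMn uvd law mF cvgF roo).
- move=> c c0 rc dQ TQ Q F' H F'F gH F'H; apply/(@cvg_lawP R dispn Tn Pn) => //.
  + by move=> n; exact: mstd.
  + by apply: measurable_funD => //; exact: measurable_funM.
  have k := KE (fun n x => (x - u (d n) * a n) / (v (d n) * a n)); apply: (wcvg_near_eq k).
  apply: (wcvg_radial_balanced poo doo mEn mMn uvd law mF cvgF c0 rc _ gH F'H).
  apply/funext => x; have mx : measurable [set r : R | r <= x] by exact: measurable_set_le.
  by have := F'F _ mx; rewrite /cdfr /distribution /pushforward /= => ->.
- move=> r0 dQ TQ Q H gH; apply/(@cvg_lawP R dispn Tn Pn) => //; first by move=> n; exact: mstd.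
  have k := KE (fun n x => (x - u (d n) * a n) / (u (d n) * b n)); apply: (wcvg_near_eq k).
  exact: (wcvg_radial_negligible poo doo mEn mMn uvd law mF cvgF r0 gH).
Qed.

End high_dimension.
End radial_laws.

(** * The ratio of scales for normal vectors *)

Section gaussian_ratio.
Context {R : realType}.
Variables (p d : nat -> nat).
Hypotheses (poo : p n @[n --> \oo] --> \oo) (doo : d n @[n --> \oo] --> \oo).

Let l n : R := ln (p n)%:R.
Let D n : R := (d n)%:R.
Let a n : R := a_pd (p n) (d n).
Let b n : R := b_pd (p n) (d n).
Let r n := (Num.sqrt (2 * D n) * a n) / (D n * b n).

Let D0 : \forall n \near \oo, 0 < D n.
Proof. by near=> n; rewrite /D ltr0n; near: n; have /cvgnyPge := doo; exact. Unshelve. all: by end_near. Qed.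

Let l0 : \forall n \near \oo, 0 < l n.
Proof. by apply: cvgry_gt; exact: cvg_ln_nat. Qed.

(** Separates the factor controlled by the hypothesis on (log p)^2/d from the comparison of a/b with
    log p. *)
Let rE : \forall n \near \oo, r n = Num.sqrt (2 * (l n ^+ 2 / D n)) * (a n / b n / l n).
Proof.
near=> n; have Dn : 0 < D n by near: n.
have ln0 : 0 < l n by near: n.
have sE : Num.sqrt (2 * (l n ^+ 2 / D n)) = Num.sqrt (2 * D n) * (l n / D n).
  rewrite -[l n / D n]ger0_norm ?divr_ge0 ?(ltW ln0) ?(ltW Dn)// -sqrtr_sqr -sqrtrM ?mulr_ge0 ?(ltW Dn)//.
  by congr Num.sqrt; field; rewrite gt_eqF.
have [a0 b0] : 0 < a n /\ 0 < b n by near: n; exact: near_a_pd_b_pd_gt0.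
by rewrite sE /r; field; rewrite !gt_eqF.
Unshelve. all: by end_near.
Qed.

(** Here log p/d need not tend to 0, so the equivalence of a/b with log p is not at hand; a/b >=
    (log p)/2 is enough for divergence. *)
Lemma cvg_gaussian_ratio_pinfty : l n ^+ 2 / D n @[n --> \oo] --> +oo -> r n @[n --> \oo] --> +oo.
Proof.
move=> roo; apply/cvgryPge => A; near=> n.
have -> : r n = Num.sqrt (2 * (l n ^+ 2 / D n)) * (a n / b n / l n) by near: n.
have ln0 : 0 < l n by near: n.
have h1 : 1 / 2 <= a n / b n / l n.
  by rewrite ler_pdivlMr// mulrC mulrA mulr1; near: n; exact: near_a_pd_div_b_pd.
apply: (@le_trans _ _ (Num.sqrt (2 * (l n ^+ 2 / D n)) * (1 / 2))); last by rewrite ler_wpM2l ?sqrtr_ge0.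
have h2 : 2 * (A ^+ 2) <= l n ^+ 2 / D n by near: n; exact: cvgry_ge.
apply: le_trans (ler_norm A) _; rewrite -sqrtr_sqr mulrC div1r ler_pdivlMl//.
rewrite -[X in X * _](ger0_norm (ler0n _ 2)) -sqrtr_sqr -sqrtrM ?sqr_ge0// ler_wsqrtr//; lra.
Unshelve. all: by end_near.
Qed.

(** A finite limit of (log p)^2/d forces log p/d = sqrt ((log p)^2/d * 1/d) to tend to 0, hence a/b
    is equivalent to log p. Allowing [c = 0] covers two regimes at once. *)
Lemma cvg_gaussian_ratio (c : R) : 0 <= c -> l n ^+ 2 / D n @[n --> \oo] --> c ->
  r n @[n --> \oo] --> Num.sqrt (2 * c).
Proof.
move=> c0 rc.
have DV : (D n)^-1 @[n --> \oo] --> 0.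
  apply/gtr0_cvgV0 => //; have : ((d n)%:R : R) @[n --> \oo] --> +oo by apply/cvgrnyP.
  exact.
have ld : l n / (d n)%:R @[n --> \oo] --> 0.
  have h : Num.sqrt (l n ^+ 2 / D n * (D n)^-1) @[n --> \oo] --> Num.sqrt (c * 0).
    apply: cvg_sqrt_comp.
    exact: cvgM.
  rewrite mulr0 sqrtr0 in h; apply: cvg_trans h; apply: near_eq_cvg; near=> n.
  have Dn : 0 < D n by near: n.
  have ln0 : 0 < l n by near: n.
  rewrite /= -/(D n) -[RHS]ger0_norm ?divr_ge0 ?(ltW ln0) ?(ltW Dn)// -sqrtr_sqr.
  by congr Num.sqrt; field; rewrite gt_eqF.
have h1 := cvg_a_pd_div_b_pd_ln poo doo ld.
have h2 : Num.sqrt (2 * (l n ^+ 2 / D n)) @[n --> \oo] --> Num.sqrt (2 * c).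
  apply: cvg_sqrt_comp.
  by apply: cvgM => //; exact: cvg_cst.
rewrite -[X in _ --> X]mulr1; apply: cvg_trans (cvgM h2 h1).
by apply: near_eq_cvg; near=> n; apply/esym; near: n; exact: rE.
Unshelve. all: by end_near.
Qed.

End gaussian_ratio.

(** * Transfer between equal laws *)

Section law_transfer.
Context {R : realType}.

Lemma wcvg_comp (F : nat -> R -> R) (G : R -> R) (d : nat -> nat) :
  d n @[n --> \oo] --> \oo -> wcvg F G -> wcvg (fun n => F (d n)) G.
Proof. by move=> doo FG x e e0; have := FG x e e0; exact: doo. Qed.

Lemma same_law_cdfr dT dT' dE (T : measurableType dT) (T' : measurableType dT')
    (E : measurableType dE) (P : probability T R) (P' : probability T' R)
    (X : T -> E) (X' : T' -> E) (g : E -> R) :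
  measurable_fun [set: E] g -> same_law (pushforward P X) (pushforward P' X') ->
  cdfr P (fun w => g (X w)) = cdfr P' (fun w => g (X' w)).
Proof.
move=> mg PP'; apply/funext => x.
have mx : measurable [set e | g e <= x] by apply: measurable_set_le.
by have := PP' _ mx; rewrite /cdfr /pushforward /= => ->.
Qed.

Lemma cvg_law_congr (mu : nat -> set R -> \bar R) (nu nu' : set R -> \bar R) :
  (forall x, nu `]-oo, x]%classic = nu' `]-oo, x]%classic) -> cvg_law mu nu -> cvg_law mu nu'.
Proof.
move=> nn h x cx; rewrite -nn; apply: h.
by rewrite (_ : (fun y => nu _) = (fun y => nu' `]-oo, y]%classic))//; exact/funext.
Qed.

Lemma measurable_standardized_sqr (r s : R) :
  measurable_fun [set: R] (fun x : R => (x ^+ 2 - r) / s).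
Proof. by apply: measurable_funM => //; apply: measurable_funB => //; exact: measurable_sqr. Qed.

Lemma cdfr_std_normal dQ (TQ : measurableType dQ) (Q : probability TQ R) (G : {RV Q >-> R}) x :
  std_normal G -> cdfr Q G x = fine (@normal_prob R 0 1 `]-oo, x]%classic).
Proof.
move=> nG; rewrite -nG//; rewrite /cdfr; congr fine.
Qed.

End law_transfer.
Theorem theorem6 (R : realType)
    (disp : nat -> nat -> measure_display)
    (T : forall p d : nat, measurableType (disp p d))
    (P : forall p d : nat, probability (T p d) R)
    (Z : forall p d : nat, {RV (P p d) >-> d.-tuple R})
    (L : forall p d : nat, 'I_p -> {RV (P p d) >-> d.-tuple R})
    (K := fun p d : nat => (fun w : T p d => K_pd (fun j => L p d j w) (Z p d w)))
    (a := fun p d : nat => a_pd p d : R)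
    (b := fun p d : nat => b_pd p d : R) :
  (forall p d : nat, (2 <= p)%N -> (2 <= d)%N -> uniform_sample (L p d) (Z p d)) ->
  (forall (u v : nat -> R)
      (dF : measure_display) (TF : measurableType dF) (PF : probability TF R)
      (F : {RV PF >-> R}),
    (forall p d : nat, (2 <= p)%N -> (2 <= d)%N ->
      spherical_law (distribution (P p d) (Z p d))) ->
    (forall p p' d : nat, (2 <= p)%N -> (2 <= p')%N -> (2 <= d)%N ->
      same_law (pushforward (P p d) (fun w => enorm (Z p d w)))
               (pushforward (P p' d) (fun w => enorm (Z p' d w)))) ->
    (forall d : nat, (2 <= d)%N -> 0 < u d /\ 0 < v d) ->
    (forall p : nat, (2 <= p)%N ->
      cvg_law (fun d => pushforward (P p d)
                 (fun w => (enorm (Z p d w) ^+ 2 - u d) / v d))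
              (distribution PF F)) ->
    (forall d p0 : nat, (2 <= d)%N -> (2 <= p0)%N ->
      cvg_law (fun p => pushforward (P p d) (K p d))
              (pushforward (P p0 d) (fun w => enorm (Z p0 d w) ^+ 2))) /\
    (forall p d : nat -> nat, p n @[n --> \oo] --> \oo -> d n @[n --> \oo] --> \oo ->
      let ratio := fun n => (v (d n) * a (p n) (d n)) / (u (d n) * b (p n) (d n)) in
      [/\ ratio n @[n --> \oo] --> +oo ->
          cvg_law (fun n => pushforward (P (p n) (d n))
                     (fun w => (K (p n) (d n) w - u (d n) * a (p n) (d n)) /
                               (v (d n) * a (p n) (d n))))
                  (distribution PF F),
          forall c : R, 0 < c -> ratio n @[n --> \oo] --> c ->
          forall (dQ : measure_display) (TQ : measurableType dQ)
              (Q : probability TQ R) (F' H : {RV Q >-> R}),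
            same_law (distribution Q F') (distribution PF F) ->
            gumbel H -> independent2 Q F' H ->
            cvg_law (fun n => pushforward (P (p n) (d n))
                       (fun w => (K (p n) (d n) w - u (d n) * a (p n) (d n)) /
                                 (v (d n) * a (p n) (d n))))
                    (pushforward Q (fun w => F' w + 1 / c * H w)) &
          ratio n @[n --> \oo] --> 0 ->
          forall (dQ : measure_display) (TQ : measurableType dQ)
              (Q : probability TQ R) (H : {RV Q >-> R}),
            gumbel H ->
            cvg_law (fun n => pushforward (P (p n) (d n))
                       (fun w => (K (p n) (d n) w - u (d n) * a (p n) (d n)) /
                                 (u (d n) * b (p n) (d n))))
                    (distribution Q H)])) /\
  ((forall p d : nat, (2 <= p)%N -> (2 <= d)%N ->
      same_law (distribution (P p d) (Z p d)) (@std_normal_tuple R d)) ->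
    (forall d : nat, (2 <= d)%N ->
      cvg_law (fun p => pushforward (P p d) (K p d)) (@chi2_law R d)) /\
    (forall p d : nat -> nat, p n @[n --> \oo] --> \oo -> d n @[n --> \oo] --> \oo ->
      let ratio := fun n => ln (p n)%:R ^+ 2 / (d n)%:R : R in
      [/\ ratio n @[n --> \oo] --> +oo ->
          forall (dQ : measure_display) (TQ : measurableType dQ)
              (Q : probability TQ R) (G : {RV Q >-> R}),
            std_normal G ->
            cvg_law (fun n => pushforward (P (p n) (d n))
                       (fun w => (K (p n) (d n) w - (d n)%:R * a (p n) (d n)) /
                                 (Num.sqrt (2 * (d n)%:R) * a (p n) (d n))))
                    (distribution Q G),
          forall c : R, 0 < c -> ratio n @[n --> \oo] --> c ->
          forall (dQ : measure_display) (TQ : measurableType dQ)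
              (Q : probability TQ R) (G H : {RV Q >-> R}),
            std_normal G -> gumbel H -> independent2 Q G H ->
            cvg_law (fun n => pushforward (P (p n) (d n))
                       (fun w => (K (p n) (d n) w - (d n)%:R * a (p n) (d n)) /
                                 (Num.sqrt (2 * (d n)%:R) * a (p n) (d n))))
                    (pushforward Q (fun w => G w + 1 / Num.sqrt (2 * c) * H w)) &
          ratio n @[n --> \oo] --> 0 ->
          forall (dQ : measure_display) (TQ : measurableType dQ)
              (Q : probability TQ R) (H : {RV Q >-> R}),
            gumbel H ->
            cvg_law (fun n => pushforward (P (p n) (d n))
                       (fun w => (K (p n) (d n) w - (d n)%:R * a (p n) (d n)) /
                                 ((d n)%:R * b (p n) (d n))))
                    (distribution Q H)])).
Proof.
move=> LZ.
have mK p d : measurable_fun [set: T p d] (K p d) := measurable_K_pd (@L p d) (Z p d).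
have msq (r s : R) := @measurable_standardized_sqr R r s.
split=> [u v dF TF PF F _ EE uv cvgF|ZN]; split.
- move=> d p0 d2 p02; apply: (cvg_law_fixed_dimension LZ d2).
    by apply: measurable_funX; exact: measurable_enorm_rv.
  move=> p p2; apply: (@same_law_cdfr _ _ _ _ _ _ _ _ _ _ _ (fun x : R => x ^+ 2)).
    exact: measurable_sqr.
  exact: EE.
- move=> p d poo doo ratio; apply: (cvg_law_high_dimension LZ poo doo uv).
  (* The hypothesis gives convergence in [d] for each fixed [p]. It is taken at [p = 2], composed
     with the sequence [d n], and moved to [p n] because the law of the norm depends on [d]
     alone. *)
  have F2 : wcvg (fun d => cdfr (P 2 d) (fun w => (enorm (Z 2 d w) ^+ 2 - u d) / v d)) (cdfr PF F).
    apply/(@cvg_lawP R (disp 2) (T 2) (P 2)) => //; last exact: cvgF.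
    by move=> d'; exact: (measurableT_comp (msq _ _) (measurable_enorm_rv (Z 2 d'))).
  apply: wcvg_near_eq (wcvg_comp doo F2); near=> n.
  have p2 : (2 <= p n)%N by near: n; have /cvgnyPge := poo; exact.
  have d2 : (2 <= d n)%N by near: n; have /cvgnyPge := doo; exact.
  apply: (same_law_cdfr (msq _ _)); exact: EE.
(* The chi-squared law is realised as the square norm of the normal vector of index [p = 2], which
   makes the fixed-dimension result applicable. *)
- move=> d d2; pose Y (w : T 2 d) : R := \sum_(i < d) tnth (Z 2 d w) i ^+ 2.
  have mY' : measurable_fun [set: d.-tuple R] (fun z : d.-tuple R => \sum_(i < d) tnth z i ^+ 2).
    by apply: measurable_sum => i; apply: measurable_funX; exact: measurable_tnth.
  have mY : measurable_fun [set: T 2 d] Y by exact: (measurableT_comp mY').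
  apply: (@cvg_law_congr _ _ (pushforward (P 2 d) Y)).
    move=> x; rewrite /chi2_law [RHS]/pushforward -(ZN 2%N d)//.
    by rewrite -[X in measurable X]setTI; exact: mY'.
  apply: (cvg_law_fixed_dimension LZ d2 mY) => p p2.
  have -> : Y = (fun w => enorm (Z 2 d w) ^+ 2).
    by apply/funext => w; rewrite sqr_enorm; apply: eq_bigr => i _; rewrite expr2.
  apply: (same_law_cdfr (g := fun z : d.-tuple R => enorm z ^+ 2)).
    by apply: measurable_funX; exact: measurable_enorm.
  by move=> A mA; rewrite [LHS](ZN p d)// [RHS](ZN 2%N d).
- move=> p d poo doo ratio.
  (* Mean and standard deviation of the chi-squared law with d degrees of freedom. *)
  pose u (d : nat) : R := d%:R; pose v (d : nat) : R := Num.sqrt (2 * d%:R).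
  have uv d' : (2 <= d')%N -> 0 < u d' /\ 0 < v d'.
    move=> d2; have d0 : 0 < d'%:R :> R by rewrite ltr0n (leq_trans _ d2).
    by rewrite /u /v sqrtr_gt0 mulr_gt0.
  have cvgF dQ (TQ : measurableType dQ) (Q : probability TQ R) (G : {RV Q >-> R}) : std_normal G ->
      wcvg (fun n => cdfr (P (p n) (d n))
        (fun w => (enorm (Z (p n) (d n) w) ^+ 2 - u (d n)) / v (d n))) (cdfr Q G).
    move=> nG; have mG : measurable_fun [set: TQ] G by exact: measurable_funPT.
    have [rG _ _] := cdfr_limits Q mG.
    have ndF n : {homo cdfr (P (p n) (d n)) (fun w => (enorm (Z (p n) (d n) w) ^+ 2 - u (d n)) / v (d n)) :
        x y / x <= y}.
      by apply: nondecreasing_cdfr; exact: (measurableT_comp (msq _ _) (measurable_enorm_rv _)).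
    apply/(wcvgP ndF (nondecreasing_cdfr Q mG) rG) => x _; rewrite (cdfr_std_normal x nG).
    have h := @cvg_std_normal_tball R x.
    apply: cvg_trans (cvg_comp d _ doo h); apply: near_eq_cvg; near=> n.
    have p2 : (2 <= p n)%N by near: n; have /cvgnyPge := poo; exact.
    have d2 : (2 <= d n)%N by near: n; have /cvgnyPge := doo; exact.
    have [u0 v0] := uv _ d2.
    rewrite /=; set B := tball _; have mB : measurable B by exact: measurable_tball.
    have <- : @std_normal_tuple R (d n) B = tuple_measure (@normal_prob R 0 1) (d n) B by [].
    rewrite -(ZN _ _ p2 d2 _ mB) /cdfr; congr (fine (P _ _ _)).
    apply/seteqP; split => w; rewrite /B /tball /= sqr_enorm ler_pdivrMr// /u /v; lra.
  split.
  + move=> roo dQ TQ Q G nG.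
    have [h _ _] := cvg_law_high_dimension LZ poo doo uv (cvgF _ _ _ _ nG).
    by apply: h; exact: cvg_gaussian_ratio_pinfty.
  + move=> c c0 rc dQ TQ Q G H nG gH GH.
    have [_ h _] := cvg_law_high_dimension LZ poo doo uv (cvgF _ _ _ _ nG).
    apply: h => //; first by rewrite sqrtr_gt0 mulr_gt0.
    exact: (cvg_gaussian_ratio poo doo (ltW c0) rc).
  + move=> r0 dQ TQ Q H gH.
    (* This regime provides no normal variable, yet the general result asks for a limit of the
       standardised norm: the identity on the line under the normal law serves. *)
    pose id_ (x : measurableTypeR R) : R := x.
    have mid : measurable_fun [set: measurableTypeR R] id_ by exact: measurable_id.
    pose G : {RV (@normal_prob R 0 1) >-> R} := HB.pack id_ (isMeasurableFun.Build _ _ _ _ id_ mid).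
    have nG : std_normal G by [].
    have [_ _ h] := cvg_law_high_dimension LZ poo doo uv (cvgF _ _ _ _ nG).
    apply: h => //; have := cvg_gaussian_ratio poo doo (lexx 0) r0.
    by rewrite mulr0 sqrtr0.
Unshelve. all: by end_near.
Qed.
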